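(* For all non-negative integers $x,y,z,a$, the tiling generating function of the weighted region ${}^*\mathcal{E}_{x,y,z}(a)$ equals $E_4(x,y,z,a)$.
   Context: Triangular lattice with horizontal lattice lines. The weight of a tiling is the product of its lozenge weights (default 1); the tiling generating function is the sum of weights over all tilings. Pentagonal regions here are bounded by western and northeastern sides following zig-zag lattice paths, a horizontal northern side, a straight southeastern side and a horizontal southern side. For $y+z\ge 1$, $\mathcal{E}_{x,y,z}(a)$ is obtained from such a pentagon with western, northern, northeastern, southeastern, southern side lengths $y+z+a-1,\ x,\ y+z+2a-1,\ y+z-1,\ x+y+z+3a-2$ by removing the $(y+a)$-th through $(y+2a-1)$-th up-pointing unit triangles on the northeastern side (counting from top to bottom) and then removing forced lozenges. ${}^*\mathcal{E}_{x,y,z}(a)$ is $\mathcal{E}_{x,y,z}(a)$ with weight $1/2$ assigned to the northeastern boundary lozenges. Pochhammer: $(x)_n=x(x+1)\cdots(x+n-1)$ ($n>0$), $(x)_0=1$, $(x)_{-n}=1/((x-1)\cdots(x-n))$. Skipped Pochhammer: $[x]_n=x(x+2)\cdots(x+2n-2)$ ($n>0$), $[x]_0=1$, $[x]_n=1/((x-2)(x-4)\cdots(x+2n))$ ($n<0$). Let $f(x)=2\lfloor\frac{x+1}{2}\rfloor+\lfloor\frac{x}{2}\rfloor$. $E_4(x,0,z,a)=\frac{1}{2^{a+z-1}}\prod_{i=1}^{a-1}\frac{i!(x+i-2)!(2x+2i-2)_i(x+2i-1)_i(x+3i-1)}{(x+2i-1)!(2i)!}\prod_{i=1}^{z-1}\frac{i!(x+3a+i-2)!(2x+6a+2i-2)_i(x+3a+2i-1)_i(x+3a+3i-1)}{(x+3a+2i-1)!(2i)!}$,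 and for $y>0$, $E_4(x,y,z,a)=E_3(x,y,z,a)/K(x,y,z,a)$, where $$K(x,2k,z,a)= 2^{k+\lfloor \frac{z+1}{2}\rfloor+\lfloor \frac{a+1}{2}\rfloor-1}\frac{\prod_{i=1}^{k+\lfloor \frac{z}{2}\rfloor+a}(2x+6i-5) \prod_{i=1}^{\lfloor \frac{z+1}{2}\rfloor}(x+3k+3a+3i-4)}{\prod_{i=1}^{\lfloor \frac{a+1}{2}\rfloor}(2x+6k+6\lfloor \frac{a}{2}\rfloor+6i-5) \prod_{i=1}^{k+z+\lfloor \frac{a}{2}\rfloor}(2x+3k+3\lfloor \frac{a+1}{2}\rfloor+3i-4)},$$ $$K(x,2k+1,z,a)= 2^{k+\lfloor \frac{z}{2}\rfloor+\lfloor \frac{a}{2}\rfloor}\frac{\prod_{i=1}^{k+\lfloor \frac{z+1}{2}\rfloor+a}(2x+6i-5) \prod_{i=1}^{\lfloor \frac{z}{2}\rfloor}(x+3k+3a+3i-1)}{\prod_{i=1}^{\lfloor \frac{a}{2}\rfloor}(2x+6k+6\lfloor \frac{a+1}{2}\rfloor+6i-5) \prod_{i=1}^{k+z+\lfloor \frac{a+1}{2}\rfloor}(x+3k+3\lfloor \frac{a}{2}\rfloor+3i-1)},$$ and $E_3$ is given for $k\ge1$ by \begin{align*} E_{3}(x,2k,z,a)&=2^{\lfloor\frac{a+1}{2}\rfloor\lfloor\frac{z+1}{2}\rfloor+\lfloor\frac{a}{2}\rfloor\lfloor\frac{z}{2}\rfloor-a-z-2k+1}\prod_{i=1}^{2k-1+a+z}\frac{i!(x+i-2)!(2x+2i-2)_i(x+2i-1)_i(2x+3i-2)}{(x+2i-1)!(2i)!}\\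 &\times\prod_{i=1}^{\lceil \frac{a-1}{3}\rceil}[2x+6k+2f(a+i-1)-1]_{f(a-3i+2)-1}\prod_{i=1}^{\lceil \frac{a-2}{3}\rceil}(x+3k+f(a+i-2)+1)_{f(a-3i+1)-1}\\ &\times\prod_{i=1}^{\lfloor \frac{a+1}{2}\rfloor}[2x+6k+2z+4a+4i-5]_{\lfloor\frac{z}{2}\rfloor +a-5i+4}(x+3k+z+2a+2i-3)_{\lfloor\frac{z+1}{2}\rfloor+a-5i+4}\\ &\times\prod_{i=1}^{\lfloor\frac{a}{2}\rfloor}[2x+6k+2z+4a+4i-3]_{\lfloor\frac{z+1}{2}\rfloor+a-5i+1} (x+3k+z+2a+2i-2)_{\lfloor\frac{z}{2}\rfloor+a-5i+2}\\ &\times\prod_{i=1}^{a}\frac{[2k+2i-1]_{z+a-2i+1}(k+i)_{z+a-2i+1}}{(i)_{z+a-2i+1}[2x+4k+2a+2i-3]_{z+a-2i+1}(x+4k+z+2a+i-2)_{z+a-2i+1}}, \end{align*} and for $k\ge0$ by \begin{align*} E_{3}(x,2k+1,z,a)&=2^{\lfloor\frac{a}{2}\rfloor\lfloor\frac{z+1}{2}\rfloor+\lfloor\frac{a+1}{2}\rfloor\lfloor\frac{z}{2}\rfloor-a-z-2k}\prod_{i=1}^{2k+a+z}\frac{i!(x+i-2)!(2x+2i-2)_i(x+2i-1)_i(2x+3i-2)}{(x+2i-1)!(2i)!}\\ &\times\prod_{i=1}^{\lfloor \frac{a-2}{3}\rfloor}[2x+6k+2f(a+i)-1]_{f(a-3i+1)-1}\prod_{i=1}^{\lfloor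 \frac{a-1}{3}\rfloor}(x+3k+f(a+i-1)+1)_{f(a-3i+2)-1}\\ &\times\prod_{i=1}^{\lfloor \frac{a+1}{2}\rfloor}[2x+6k+2z+4a+4i-3]_{\lfloor\frac{z+1}{2}\rfloor +a-5i+4}(x+3k+z+2a+2i-1)_{\lfloor\frac{z}{2}\rfloor+a-5i+4}\\ &\times\prod_{i=1}^{\lfloor\frac{a}{2}\rfloor}[2x+6k+2z+4a+4i-1]_{\lfloor\frac{z}{2}\rfloor+a-5i+2} (x+3k+z+2a+2i)_{\lfloor\frac{z+1}{2}\rfloor+a-5i+1}\\ &\times\prod_{i=1}^{a}\frac{[2k+2i+1]_{z+a-2i+1}(k+i)_{z+a-2i+1}}{(i)_{z+a-2i+1}[2x+4k+2a+2i-1]_{z+a-2i+1}(x+4k+z+2a+i)_{z+a-2i+1}}. \end{align*}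
   Formalization: In K(x,2k,z,a) the last denominator product has factors x+3k+3⌊(a+1)/2⌋+3i−4 (not 2x+…); in E_3(x,2k+1,z,a) the first two products run to ⌈(a−2)/3⌉ and ⌈(a−1)/3⌉ (not floors); E_4 is evaluated as a rational function of x, removable singularities removed. *)

(* Defs.v *)
From HB Require Import structures.
From mathcomp Require Import all_boot all_order all_algebra.
From mathcomp Require Import fraction.
Set Implicit Arguments. Unset Strict Implicit. Unset Printing Implicit Defensive.
Import Order.TTheory GRing.Theory Num.Theory.
Local Open Scope ring_scope.

Section Formula.
Variable R : fieldType.

Definition poch (u : R) (n : int) : R :=
  if (0 <= n)%R then \prod_(j < `|n|%N) (u + j%:R)
  else (\prod_(j < `|n|%N) (u - (j.+1)%:R))^-1.

Definition spoch (u : R) (n : int) : R :=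
  if (0 <= n)%R then \prod_(j < `|n|%N) (u + (2 * j)%:R)
  else (\prod_(j < `|n|%N) (u - (2 * j.+1)%:R))^-1.

Definition prodz (N : int) (F : int -> R) : R :=
  \prod_(i < (if (0 <= N)%R then `|N|%N else 0%N)) F (i.+1)%:Z.

(* floor and ceiling of p/q for integers (q > 0 in all uses) *)
Definition fl (p q : int) : int := (p %/ q)%Z.
Definition cl (p q : int) : int := - ((- p) %/ q)%Z.

Definition fF (n : int) : int := 2 * fl (n + 1) 2 + fl n 2.

Definition ifac (i : int) : R := ((`|i|)`!)%:R.

(* (u+m)!/(u+n)!  for an indeterminate/variable u and integers m, n,
   i.e. the quotient Gamma(u+m+1)/Gamma(u+n+1), written with the
   (extended) Pochhammer symbol:  (u+n+1)_{m-n}. *)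
Definition facratio (u : R) (m n : int) : R := poch (u + (n + 1)%:~R) (m - n).

Definition cfac (u : R) (i : int) : R :=
  ifac i * facratio u (i - 2) (2 * i - 1) * poch (2%:R * u + (2 * i - 2)%:~R) i
  * poch (u + (2 * i - 1)%:~R) i / ifac (2 * i).

Definition E3even (u : R) (k z a : int) : R :=
  (2%:R : R) ^ (fl (a + 1) 2 * fl (z + 1) 2 + fl a 2 * fl z 2 - a - z - 2 * k + 1)
  * prodz (2 * k - 1 + a + z) (fun i => cfac u i * (2%:R * u + (3 * i - 2)%:~R))
  * prodz (cl (a - 1) 3) (fun i =>
      spoch (2%:R * u + (6 * k + 2 * fF (a + i - 1) - 1)%:~R) (fF (a - 3 * i + 2) - 1))
  * prodz (cl (a - 2) 3) (fun i =>
      poch (u + (3 * k + fF (a + i - 2) + 1)%:~R) (fF (a - 3 * i + 1) - 1))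
  * prodz (fl (a + 1) 2) (fun i =>
      spoch (2%:R * u + (6 * k + 2 * z + 4 * a + 4 * i - 5)%:~R) (fl z 2 + a - 5 * i + 4)
      * poch (u + (3 * k + z + 2 * a + 2 * i - 3)%:~R) (fl (z + 1) 2 + a - 5 * i + 4))
  * prodz (fl a 2) (fun i =>
      spoch (2%:R * u + (6 * k + 2 * z + 4 * a + 4 * i - 3)%:~R) (fl (z + 1) 2 + a - 5 * i + 1)
      * poch (u + (3 * k + z + 2 * a + 2 * i - 2)%:~R) (fl z 2 + a - 5 * i + 2))
  * prodz a (fun i =>
      spoch (2 * k + 2 * i - 1)%:~R (z + a - 2 * i + 1) * poch (k + i)%:~R (z + a - 2 * i + 1)
      / (poch i%:~R (z + a - 2 * i + 1)
         * spoch (2%:R * u + (4 * k + 2 * a + 2 * i - 3)%:~R) (z + a - 2 * i + 1)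
         * poch (u + (4 * k + z + 2 * a + i - 2)%:~R) (z + a - 2 * i + 1))).

Definition E3odd (u : R) (k z a : int) : R :=
  (2%:R : R) ^ (fl a 2 * fl (z + 1) 2 + fl (a + 1) 2 * fl z 2 - a - z - 2 * k)
  * prodz (2 * k + a + z) (fun i => cfac u i * (2%:R * u + (3 * i - 2)%:~R))
  * prodz (cl (a - 2) 3) (fun i =>
      spoch (2%:R * u + (6 * k + 2 * fF (a + i) - 1)%:~R) (fF (a - 3 * i + 1) - 1))
  * prodz (cl (a - 1) 3) (fun i =>
      poch (u + (3 * k + fF (a + i - 1) + 1)%:~R) (fF (a - 3 * i + 2) - 1))
  * prodz (fl (a + 1) 2) (fun i =>
      spoch (2%:R * u + (6 * k + 2 * z + 4 * a + 4 * i - 3)%:~R) (fl (z + 1) 2 + a - 5 * i + 4)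
      * poch (u + (3 * k + z + 2 * a + 2 * i - 1)%:~R) (fl z 2 + a - 5 * i + 4))
  * prodz (fl a 2) (fun i =>
      spoch (2%:R * u + (6 * k + 2 * z + 4 * a + 4 * i - 1)%:~R) (fl z 2 + a - 5 * i + 2)
      * poch (u + (3 * k + z + 2 * a + 2 * i)%:~R) (fl (z + 1) 2 + a - 5 * i + 1))
  * prodz a (fun i =>
      spoch (2 * k + 2 * i + 1)%:~R (z + a - 2 * i + 1) * poch (k + i)%:~R (z + a - 2 * i + 1)
      / (poch i%:~R (z + a - 2 * i + 1)
         * spoch (2%:R * u + (4 * k + 2 * a + 2 * i - 1)%:~R) (z + a - 2 * i + 1)
         * poch (u + (4 * k + z + 2 * a + i)%:~R) (z + a - 2 * i + 1))).

Definition Keven (u : R) (k z a : int) : R :=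
  (2%:R : R) ^ (k + fl (z + 1) 2 + fl (a + 1) 2 - 1)
  * (prodz (k + fl z 2 + a) (fun i => 2%:R * u + (6 * i - 5)%:~R)
     * prodz (fl (z + 1) 2) (fun i => u + (3 * k + 3 * a + 3 * i - 4)%:~R))
  / (prodz (fl (a + 1) 2) (fun i => 2%:R * u + (6 * k + 6 * fl a 2 + 6 * i - 5)%:~R)
     * prodz (k + z + fl a 2) (fun i => u + (3 * k + 3 * fl (a + 1) 2 + 3 * i - 4)%:~R)).

Definition Kodd (u : R) (k z a : int) : R :=
  (2%:R : R) ^ (k + fl z 2 + fl a 2)
  * (prodz (k + fl (z + 1) 2 + a) (fun i => 2%:R * u + (6 * i - 5)%:~R)
     * prodz (fl z 2) (fun i => u + (3 * k + 3 * a + 3 * i - 1)%:~R))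
  / (prodz (fl a 2) (fun i => 2%:R * u + (6 * k + 6 * fl (a + 1) 2 + 6 * i - 5)%:~R)
     * prodz (k + z + fl (a + 1) 2) (fun i => u + (3 * k + 3 * fl a 2 + 3 * i - 1)%:~R)).

Definition E4 (u : R) (y z a : nat) : R :=
  let Z := z%:Z in let A := a%:Z in
  if y == 0%N then
    1 / (2%:R : R) ^ (A + Z - 1)
    * prodz (A - 1) (fun i => cfac u i * (u + (3 * i - 1)%:~R))
    * prodz (Z - 1) (fun i =>
        ifac i * facratio u (3 * A + i - 2) (3 * A + 2 * i - 1)
        * poch (2%:R * u + (6 * A + 2 * i - 2)%:~R) i
        * poch (u + (3 * A + 2 * i - 1)%:~R) i * (u + (3 * A + 3 * i - 1)%:~R)
        / ifac (2 * i))
  else if ~~ odd y then E3even u (y./2)%:Z Z A / Keven u (y./2)%:Z Z A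
  else E3odd u (y./2)%:Z Z A / Kodd u (y./2)%:Z Z A.

End Formula.

Definition ratfun := {fraction {poly rat}}.
Definition Xfrac : ratfun := tofrac ('X : {poly rat}).
Definition E4rat (y z a : nat) : ratfun := E4 Xfrac y z a.

(* "the rational function F takes the value v at the point c":
   F = p/q with q(c) <> 0 and v = p(c)/q(c)  (independent of the
   representation).  This is how the product formula, whose factors may
   individually vanish or blow up at small x (e.g. (x-1)! at x = 0), is
   read at a non-negative integer x. *)
Definition value_at (F : ratfun) (c v : rat) : Prop :=
  exists p q : {poly rat},
    q.[c] != 0 /\ F = tofrac p / tofrac q /\ v = p.[c] / q.[c].

(* Coordinates.  Horizontal lattice lines are the lines  j = 0, 1, 2, ...
   (unit of height = height of a unit triangle); horizontal coordinates are
   doubled, so the lattice points on line j are the (X, j) with X + j even.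
     up-pointing unit triangle  (X, j), X + j even :
        vertices (X, j), (X+2, j), (X+1, j+1);
     down-pointing unit triangle (X, j), X + j odd :
        vertices (X, j+1), (X+2, j+1), (X+1, j).
   A lozenge is the union of two unit triangles sharing an edge; an up
   triangle (X, j) shares an edge with exactly three down triangles:
     direction 0 : (X-1, j)  (western edge),
     direction 1 : (X+1, j)  (eastern edge),
     direction 2 : (X, j-1)  (bottom edge). *)
Definition cell := (int * int)%type.

Definition nbr (t : cell) (d : 'I_3) : cell :=
  match val d with
  | 0 => (t.1 - 1, t.2)
  | 1 => (t.1 + 1, t.2)
  | _ => (t.1, t.2 - 1)
  end.

(* A region given by the duplicate-free lists U of its up triangles and D of
   its down triangles.  A lozenge tiling is encoded by assigning to each up
   triangle the direction of the down triangle it is glued to; it is a tiling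
   iff the glued down triangles are exactly the down triangles of the region,
   each used once.  The tiling generating function with lozenge weights
   wt u d (the lozenge made of up triangle u and nbr u d) is:            *)
Definition is_tiling (U D : seq cell) (f : {ffun 'I_(size U) -> 'I_3}) : bool :=
  perm_eq [seq nbr (nth (0, 0) U (val i)) (f i) | i <- enum 'I_(size U)] D.
Arguments is_tiling : clear implicits.

Definition tgf (U D : seq cell) (wt : cell -> 'I_3 -> rat) : rat :=
  \sum_(f : {ffun 'I_(size U) -> 'I_3} | is_tiling U D f)
     \prod_(i < size U) wt (nth (0, 0) U (val i)) (f i).

Definition irange (lo hi : int) : seq int :=
  [seq lo + k%:Z | k <- iota 0 (if (lo <= hi)%R then absz (hi - lo + 1) else 0%N)].

(* The pentagon P has, in the above coordinates, the vertices
     SW = (0, 0),  NW = (0, 2n),  NE = (2x, 2n),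
     E  = (2x + 3q - 2, 2n - q),  SE = (2S, 0),
   with  n = y+z+a-1,  q = y+z+2a-1,  S = x+y+z+3a-2.
   - western side: vertical zig-zag lattice path from (0,0) to (0,2n)
     through (-1,1), (0,2), (-1,3), ...  (n zig-zag periods: length n);
   - northern side: horizontal, length x;
   - northeastern side: zig-zag lattice path from NE to E alternating
     q unit steps in direction -60 degrees and q-1 horizontal unit steps
     (starting and ending with a -60 degree step): length q;
   - southeastern side: straight, q' = y+z-1 unit steps in direction
     -120 degrees, from E down to SE;
   - southern side: horizontal, length S.
   Row j (between lines j and j+1), with r = 2n-1-j the row index counted
   from the top, consists of the unit triangles (X, j) with
     -1 <= X <= 2x + min(3r - 1, 4q - 4 - r).
   The up triangles with an edge on the northeastern side are, from top to
   bottom, t_i = (2x + 3(i-1) - 1, 2n - i), i = 1..q (the last triangle of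
   row r = i-1); E_{x,y,z}(a) removes t_i for y+a <= i <= y+2a-1. *)

Section Region.
Variables x y z a : nat.

Definition En : int := (y + z + a)%:Z - 1.
Definition Eq : int := (y + z + 2 * a)%:Z - 1.
Definition rowtop (j : int) : int := 2 * En - 1 - j.
Definition rowmax (j : int) : int :=
  2 * x%:Z + Num.min (3 * rowtop j - 1) (4 * Eq - 4 - rowtop j).

(* t is the up triangle of the northeastern side in row r (i.e. t_{r+1}) *)
Definition NEup (t : cell) : bool :=
  [&& (0 <= rowtop t.2)%R, (rowtop t.2 < Eq)%R & t.1 == 2 * x%:Z + 3 * rowtop t.2 - 1].

Definition removed (t : cell) : bool :=
  NEup t && ((y + a)%:Z <= rowtop t.2 + 1 <= (y + 2 * a)%:Z - 1)%R.

Definition cellsP : seq cell :=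
  flatten [seq [seq (X, j) | X <- irange (-1) (rowmax j)] | j <- irange 0 (2 * En - 1)].

Definition Eups : seq cell :=
  [seq t <- cellsP | ~~ odd (absz (t.1 + t.2)) & ~~ removed t].
Definition Edowns : seq cell :=
  [seq t <- cellsP | odd (absz (t.1 + t.2))].

(* weights of *E: 1/2 for the northeastern boundary lozenges, i.e. the
   lozenges formed by an up triangle t_i of the northeastern side and the
   down triangle across its western edge (the down triangle lying under the
   preceding horizontal unit step of the northeastern side, resp. of the
   northern side for i = 1); weight 1 otherwise. *)
Definition Ewt (t : cell) (d : 'I_3) : rat :=
  if (val d == 0%N) && NEup t then 1 / 2 else 1.

Definition Etgf : rat := tgf Eups Edowns Ewt.

End Region.

(* Main.v *)
Require Import Defs.
From mathcomp Require Import all_boot all_order all_algebra fraction.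
From mathcomp Require Import ring lra zify.
Set Implicit Arguments. Unset Strict Implicit. Unset Printing Implicit Defensive.
Import Order.TTheory GRing.Theory Num.Theory.
Local Open Scope ring_scope.

(** Sweeping the up triangles from the top turns a tiling into a family of nonintersecting
    lattice paths from the northeastern to the western side, so the generating function is a
    determinant of weighted binomial coefficients depending polynomially on x. Over a field where
    x is generic, a unitriangular column operation, verified by a Zeilberger certificate, makes
    the entries with row index smaller than the column index vanish and gives closed forms for
    the other ones. What is left is a product of diagonal entries and a contiguous minor, which is
    evaluated by the Desnanot-Jacobi identity. The product formula satisfies the same
    recurrence in z, and at z = 0 it depends on y and a only through y + a. *)

(** * Contiguous minors *)

(** All matrices in play are windows of one infinite array [ent], or of [esum] after the column
    operation, because removing [a] consecutive triangles of the northeastern side merely skips [a]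
    row indices. The window that starts at row [y + 2a] and column [y + a] determines [y] and [a];
    moving its corner by one row or column trades [y] against [a], so the Desnanot-Jacobi identity
    closes up on the family indexed by [y], [z], [a]. The identity divides by an inner minor and the
    certificate by gamma quotients, so the evaluation needs [2u + c] nonzero for every integer [c].
    A natural number [x] violates this, and single factors of the product formula may vanish or have
    poles there; hence the work over rational functions and the return to [x] through a determinant
    of polynomials. For [y > 0] the formula depends on the parities of [y], [z] and [a], whereas its
    quotient [zratio] for consecutive [z] does not. Therefore formula and minors are compared only
    through this quotient and the values at [z = 0]. *)

Section ContiguousMinors.
Variable F : fieldType.
Implicit Types (f g : nat -> nat -> F) (s t p z : nat).

(** As windows of one array, the shifted minors in the Desnanot-Jacobi identity are instances of the
    same function, with no submatrix bookkeeping. *)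
Definition cminor f s t z : F :=
  \det (\matrix_(i < z, j < z) f (s + i)%N (t + j)%N).

Lemma eq_cminor f g s t z :
  (forall i j, (i < z)%N -> (j < z)%N -> f (s + i)%N (t + j)%N = g (s + i)%N (t + j)%N) ->
  cminor f s t z = cminor g s t z.
Proof. by move=> E; congr (\det _); apply/matrixP=> i j; rewrite !mxE E. Qed.

Lemma cminor0 f s t : cminor f s t 0 = 1.
Proof. by rewrite /cminor det_mx00. Qed.

Lemma cminor1 f s t : cminor f s t 1 = f s t.
Proof. by rewrite /cminor det_mx11 mxE !addn0. Qed.

Lemma det_single_row n (A : 'M[F]_n.+1) i0 j0 :
  (forall j, j != j0 -> A i0 j = 0) -> \det A = A i0 j0 * cofactor A i0 j0.
Proof.
move=> A0; rewrite (expand_det_row _ i0) (bigD1 j0) //= big1 ?addr0 // => j nj.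
by rewrite A0 ?mul0r.
Qed.

(** A boolean is [true] for the last row or column and [false] for the first, so one statement
    covers the four corners; deleting the first line moves the window by [~~ a]. *)
Lemma cofactor_corner f s t p (a b : bool) :
  cofactor (\matrix_(i < p.+1, j < p.+1) f (s + i)%N (t + j)%N)
     (if a then ord_max else ord0) (if b then ord_max else ord0) =
  (-1) ^+ (a * p + b * p) * cminor f (s + ~~ a) (t + ~~ b) p.
Proof.
rewrite /cofactor; congr (_ * _); first by case: a b => [] [] /=; rewrite ?mul1n ?mul0n.
congr (\det _); apply/matrixP=> i k; rewrite !mxE.
suff E (c : bool) (l : 'I_p) : (lift (if c then ord_max else ord0) l : nat) = (~~ c + l)%N.
  by rewrite !E !addnA.
case: c => /=; first exact: lift_max.
by rewrite /bump leq0n.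
Qed.

Lemma cminor_corner f s t p (a b : bool) :
  (forall j, (j < p.+1)%N -> j != (if b then p else 0)%N ->
     f (s + (if a then p else 0))%N (t + j)%N = 0) ->
  cminor f s t p.+1 = f (s + (if a then p else 0))%N (t + (if b then p else 0))%N *
    ((-1) ^+ (a * p + b * p) * cminor f (s + ~~ a) (t + ~~ b) p).
Proof.
move=> f0; rewrite {1}/cminor (det_single_row (i0 := if a then ord_max else ord0)
   (j0 := if b then ord_max else ord0)).
  rewrite cofactor_corner mxE; congr (f (s + _)%N (t + _)%N * _); first by case: (a).
  by case: (b).
move=> j nj; rewrite mxE.
have -> : nat_of_ord (if a then ord_max else ord0 : 'I_p.+1) = (if a then p else 0)%N.
  by case: (a).
apply: f0 => //; apply: contra nj => /eqP ej; apply/eqP/val_inj => /=.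
by rewrite ej; case: (b).
Qed.

(** The boolean names the only row that changes. The operation is left multiplication by a matrix
    that differs from the identity in that row alone, hence is lower triangular for the last row and
    upper triangular for the first. *)
Lemma cminor_add_rows f g s t p (a : bool) (x : nat -> F) :
  (forall i j, (i < p.+1)%N -> i != (if a then p else 0)%N -> g (s + i)%N (t + j)%N = f (s + i)%N (t + j)%N) ->
  (forall j, (j < p.+1)%N -> g (s + (if a then p else 0))%N (t + j)%N =
     f (s + (if a then p else 0))%N (t + j)%N +
     \sum_(k < p) x k * f (s + ~~ a + k)%N (t + j)%N) ->
  cminor g s t p.+1 = cminor f s t p.+1.
Proof.
pose e : 'I_p.+1 := if a then ord_max else ord0.
have ev : nat_of_ord e = (if a then p else 0)%N by rewrite /e; case: (a).
have el (l : 'I_p) : (lift e l : nat) = (~~ a + l)%N.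
  by rewrite /e; case: (a); rewrite ?lift_max //= /bump leq0n.
move=> gf ge.
pose L : 'M[F]_p.+1 := \matrix_(i, j) ((i == j)%:R +
   (if i == e then (if unlift e j is Some k then x k else 0) else 0)).
have detL : \det L = 1.
  have dL : forall i, L i i = 1.
    move=> i; rewrite mxE eqxx; case: eqP => [->|_]; last by rewrite addr0.
    by rewrite unlift_none addr0.
  have L0 i j : i != j -> i != e -> L i j = 0.
    by move=> /negPf ij /negPf ie; rewrite mxE ij ie addr0.
  suff [T|T] : is_trig_mx L \/ is_trig_mx L^T.
  - by rewrite (det_trig T) big1 // => i _; rewrite dL.
  - by rewrite -det_tr (det_trig T) big1 // => i _; rewrite mxE dL.
  case: (boolP a) => ha; [left|right]; apply/is_trig_mxP => i j ij.
  - apply: L0; first by rewrite neq_ltn ij.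
    by rewrite -(inj_eq val_inj) /= ev ha neq_ltn (leq_trans ij) // -ltnS.
  - rewrite mxE; apply: L0; first by rewrite neq_ltn ij orbT.
    by rewrite -(inj_eq val_inj) /= ev (negPf ha) -lt0n (leq_ltn_trans _ ij).
rewrite /cminor -[in RHS](mul1r (\det _)) -detL -det_mulmx; congr (\det _).
apply/matrixP=> i j; rewrite !mxE.
have [->|ne] := eqVneq i e.
  rewrite ev ge // (bigD1 e) //= !mxE eqxx unlift_none addr0 mul1r ev; congr (_ + _).
  transitivity (\sum_(k | k != e) (if unlift e k is Some k' then x k' else 0)
        * f (s + k)%N (t + j)%N); last first.
    by apply: eq_bigr => k ke; rewrite !mxE eqxx eq_sym (negPf ke) add0r.
  rewrite (reindex_omap (lift e) (unlift e)); last first.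
    by move=> k ke; case: unliftP ke => [l ->|->] //=; rewrite eqxx.
  under [RHS]eq_bigr do rewrite liftK el addnA.
  by apply: eq_bigl => k; rewrite liftK eqxx andbT eq_sym neq_lift.
rewrite (bigD1 i) //= !mxE eqxx (negPf ne) addr0 mul1r big1 ?addr0; last first.
  by move=> k ki; rewrite !mxE eq_sym (negPf ki) (negPf ne) addr0 mul0r.
by apply: gf; rewrite // -ev.
Qed.

(* Adding multiples of the inner rows to the first and the last row makes these two vanish on the
   inner columns; then both sides are products of corner entries and the inner minor. *)
Lemma desnanot_jacobi f s t p :
  cminor f s.+1 t.+1 p != 0 ->
  cminor f s t p.+2 * cminor f s.+1 t.+1 p =
  cminor f s t p.+1 * cminor f s.+1 t.+1 p.+1 - cminor f s.+1 t p.+1 * cminor f s t.+1 p.+1.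
Proof.
move=> N0; pose N := \matrix_(i < p, j < p) f (s.+1 + i)%N (t.+1 + j)%N.
have uN : N \in unitmx by rewrite unitmxE unitfE.
(* As the inner minor is nonzero, the inner columns of any row [c] are a combination [r c] of the
   inner rows; subtracting it clears them. *)
have [r rN] : exists r : nat -> 'rV[F]_p, forall c, r c *m N = \row_j f c (t.+1 + j)%N.
  by exists (fun c => (\row_j f c (t.+1 + j)%N) *m invmx N) => c; rewrite mulmxKV.
pose x (c : nat) (k : nat) : F := if insub k is Some l then - r c 0 l else 0.
pose g (c d : nat) := if (c == s) || (c == s + p.+1)%N then
   f c d + \sum_(k < p) x c k * f (s.+1 + k)%N d else f c d.
have gi c d : (s < c)%N -> (c < s + p.+1)%N -> g c d = f c d.
  by move=> h1 h2; rewrite /g [c == s]gtn_eqF // ltn_eqF.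
have g0 c j : (c == s) || (c == s + p.+1)%N -> (j < p)%N -> g c (t.+1 + j)%N = 0.
  move=> hc hj; rewrite /g hc.
  have := congr1 (fun M : 'rV[F]_p => M 0 (Ordinal hj)) (rN c).
  rewrite !mxE /= => <-; apply/eqP; rewrite addrC addr_eq0 -sumrN; apply/eqP/eq_bigr => k _.
  by rewrite !mxE /x insubT //= => hk; rewrite mulNr; congr (- (r c 0 _ * _)); apply: val_inj.
have gN : cminor g s.+1 t.+1 p = cminor f s.+1 t.+1 p.
  by apply: eq_cminor => i j hi hj; rewrite gi //; lia.
have top d : cminor g s d p.+1 = cminor f s d p.+1.
  apply: (cminor_add_rows (a := false) (x := x s)).
    by move=> i j hi i0; apply: gi; lia.
  by move=> j hj; rewrite /= addn0 /g eqxx /= !addn1.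
have bot d : cminor g s.+1 d p.+1 = cminor f s.+1 d p.+1.
  apply: (cminor_add_rows (a := true) (x := x (s + p.+1)%N)).
    by move=> i j hi i0; apply: gi; lia.
  by move=> j hj; rewrite /= addn0 /g addSnnS eqxx orbT.
have full : cminor g s t p.+2 = cminor f s t p.+2.
  (* [h] changes only the first row, so that the passage from [f] to [g] splits into two one-row
     operations; in the one on the last row, row [s] gets coefficient 0. *)
  pose h c d := if (c == s) then g c d else f c d.
  transitivity (cminor h s t p.+2).
    apply: (cminor_add_rows (a := true) (x := fun k => if k is k'.+1 then x (s + p.+1)%N k' else 0)).
      move=> i j hi i0; rewrite /h; case: eqP => // ne; apply: gi; lia.
    move=> j hj; rewrite /= addn0 /h gtn_eqF; last by lia.
    rewrite /g eqxx orbT; congr (_ + _); rewrite big_ord_recl mul0r add0r.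
    by apply: eq_bigr => k _; rewrite lift0 /= (_ : (s + k.+1 = s.+1 + k)%N) ?gtn_eqF //; lia.
  apply: (cminor_add_rows (a := false) (x := fun k => if (k < p)%N then x s k else 0)).
    by move=> i j hi i0; rewrite /h gtn_eqF //; lia.
  move=> j hj; rewrite /= addn0 /h eqxx /g eqxx /=; congr (_ + _).
  rewrite big_ord_recr /= ltnn mul0r addr0 addn1.
  by apply: eq_bigr => k _; rewrite ltn_ord.
rewrite -full -!top -!bot -gN in N0 *.
have gs0 j : (j < p)%N -> g s (t.+1 + j)%N = 0 by apply: g0; rewrite eqxx.
have gs1 j : (j < p)%N -> g (s + p.+1)%N (t.+1 + j)%N = 0 by apply: g0; rewrite eqxx orbT.
have tl : cminor g s t p.+1 = g s t * cminor g s.+1 t.+1 p.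
  rewrite (cminor_corner (a := false) (b := false)) /= ?addn0 ?addn1 ?mul1r //.
  by case=> // j hj _; rewrite ?addn0 -[(t + _)%N]addSnnS gs0.
have tr : cminor g s t.+1 p.+1 = g s (t.+1 + p)%N * ((-1) ^+ p * cminor g s.+1 t.+1 p).
  rewrite (cminor_corner (a := false) (b := true)) /= ?addn0 ?addn1 ?mul1n //.
  by move=> j hj jp; rewrite ?addn0 gs0 //; lia.
have bl : cminor g s.+1 t p.+1 = g (s + p.+1)%N t * ((-1) ^+ p * cminor g s.+1 t.+1 p).
  rewrite (cminor_corner (a := true) (b := false)) /= ?addn0 ?addn1 ?mul1n ?addSnnS //.
  by case=> // j hj _; rewrite ?addSnnS -[(t + _)%N]addSnnS gs1.
have br : cminor g s.+1 t.+1 p.+1 = g (s + p.+1)%N (t.+1 + p)%N * cminor g s.+1 t.+1 p.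
  rewrite (cminor_corner (a := true) (b := true)) /= ?addn0 ?mul1n ?addSnnS.
    by rewrite addnn -mul2n exprM sqrrN !expr1n mul1r.
  by move=> j hj jp; rewrite ?addSnnS -[(t + _)%N]addSnnS gs1 //; lia.
have fl : cminor g s t p.+2 = g s t * cminor g s.+1 t.+1 p.+1 +
    g s (t + p.+1)%N * ((-1) ^+ p.+1 * cminor g s.+1 t p.+1).
  rewrite {1}/cminor (expand_det_row _ ord0) (bigD1 ord0) //= (bigD1 ord_max) //= big1 ?addr0.
    have := @cofactor_corner g s t p.+1 false false; have := @cofactor_corner g s t p.+1 false true.
    by rewrite /= => -> ->; rewrite !mxE /= !addn0 !addn1 mul1n mul1r.
  move=> j; rewrite !mxE -!(inj_eq val_inj) /= => /andP[j0 jm].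
  rewrite (_ : (t + j = t.+1 + j.-1)%N); last by lia.
  by rewrite addn0 gs0 ?mul0r //; case: j j0 jm => /= j; lia.
rewrite fl tl br tr bl addSnnS exprS.
have : (-1) ^+ p * (-1) ^+ p = 1 :> F by rewrite -exprD addnn -mul2n exprM sqrrN !expr1n.
set e := (-1) ^+ p; set n := cminor _ _ _ p => ee.
ring: ee.
Qed.

End ContiguousMinors.

(** Side conditions of [field] are matched, up to [ring], with nonvanishing facts in the context;
    this is why the proofs below first gather such facts in the normal form they need. *)
Ltac nonzero := repeat (apply/andP; split); try done; try exact: oner_neq0; match goal with
  | H : is_true (?a != 0) |- is_true (?b != 0) => replace b with a by ring; exact H end.

(** * Pochhammer symbols of integer length *)

Section Pochhammer.
Variable F : fieldType.
Implicit Types (v : F) (n c : int).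

(** Climbing and descending by one: identities for Pochhammer symbols follow from the recursion in
    the length, without splitting on its sign. *)
Lemma int_S_ind (P : int -> Prop) :
  P 0 -> (forall n, P n -> P (n + 1)) -> (forall n, P (n + 1) -> P n) -> forall n, P n.
Proof.
move=> P0 PS PP; elim/int_ind => // n Pn; first by rewrite -addn1 PoszD; apply: PS.
by apply: PP; rewrite (_ : _ + 1 = - n%:Z); last lia.
Qed.

Lemma pochN v (m : nat) : poch v (- m%:Z) = (\prod_(j < m) (v - j.+1%:R))^-1.
Proof.
by rewrite /poch; case: m => [|m]; rewrite ?oppr0 /= ?big_ord0 ?invr1.
Qed.

Lemma spochN v (m : nat) : spoch v (- m%:Z) = (\prod_(j < m) (v - (2 * j.+1)%:R))^-1.
Proof.
by rewrite /spoch; case: m => [|m]; rewrite ?oppr0 /= ?big_ord0 ?invr1.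
Qed.

Lemma poch0 v : poch v 0 = 1.
Proof. by rewrite /poch /= big_ord0. Qed.

Lemma spoch0 v : spoch v 0 = 1.
Proof. by rewrite /spoch /= big_ord0. Qed.

(** Genericity of [v] makes the rule valid at negative length, where the factor [v + n] has to
    cancel against an inverse. *)
Lemma pochS v n : (forall c, v + c%:~R != 0) -> poch v (n + 1) = poch v n * (v + n%:~R).
Proof.
move=> nz; case: (intP n) => [|m|m]; first by rewrite /poch /= big_ord_recr.
  have -> : m.+1%:Z + 1 = m.+2 by lia.
  by rewrite /poch /= [in LHS]big_ord_recr.
have -> : - m.+1%:Z + 1 = - m%:Z by lia.
have := nz (- m.+1%:Z); rewrite intrN => nz1.
by rewrite !pochN big_ord_recr invfM /= mulfVK.
Qed.

Lemma spochS v n : (forall c, v + c%:~R != 0) -> spoch v (n + 1) = spoch v n * (v + (2 * n)%:~R).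
Proof.
move=> nz; case: (intP n) => [|m|m]; first by rewrite /spoch /= big_ord_recr.
  have -> : m.+1%:Z + 1 = m.+2 by lia.
  by rewrite /spoch /= [in LHS]big_ord_recr.
have -> : - m.+1%:Z + 1 = - m%:Z by lia.
have := nz (- (2 * m.+1)%:Z); rewrite intrN => nz1.
by rewrite !spochN big_ord_recr invfM /= mulfVK.
Qed.

Lemma poch_neq0 v n : (forall c, v + c%:~R != 0) -> poch v n != 0.
Proof.
move=> nz; elim/int_S_ind: n => [|n|n]; rewrite ?poch0 ?oner_neq0 // pochS //.
  by move=> h; rewrite mulf_neq0.
by rewrite mulf_eq0 negb_or => /andP[].
Qed.

Lemma spoch_neq0 v n : (forall c, v + c%:~R != 0) -> spoch v n != 0.
Proof.
move=> nz; elim/int_S_ind: n => [|n|n]; rewrite ?spoch0 ?oner_neq0 // spochS //.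
  by move=> h; rewrite mulf_neq0.
by rewrite mulf_eq0 negb_or => /andP[].
Qed.
End Pochhammer.

(** * Entries of the path matrix *)

Section Generic.
Variables (F : fieldType) (u : F).
Hypothesis int_inj : forall c : int, c != 0 -> c%:~R != 0 :> F.
Hypothesis generic : forall c : int, 2%:R * u + c%:~R != 0.

Lemma generic1 (c : int) : u + c%:~R != 0.
Proof.
apply: contra (generic (2 * c)) => /eqP e.
by rewrite intrM -mulrDr e mulr0.
Qed.

(* [gu c] plays the role of Gamma(u + c) / Gamma(u); likewise [g1] and [go] below for
   Gamma(2u + c) / Gamma(2u) and for the double factorial of 2u + 2c - 1. *)
Definition gu (c : int) : F := poch u c.

Lemma guS c : gu (c + 1) = gu c * (u + c%:~R).
Proof. exact/pochS/generic1. Qed.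

Lemma gu_neq0 c : gu c != 0.
Proof. exact/poch_neq0/generic1. Qed.

(** This is [1 / Gamma(e + 1)]: with value 0 at negative [e] the recursion [ifctS] holds at every
    integer, and range conditions on indices disappear. *)
Definition ifct (e : int) : F := if (0 <= e)%R then (`|e|%N`!)%:R^-1 else 0.

Lemma natr_neq0 n : (0 < n)%N -> n%:R != 0 :> F.
Proof. by move=> n0; apply: (int_inj (c := n)); lia. Qed.

Lemma ifctS e : ifct e = (e + 1)%:~R * ifct (e + 1).
Proof.
rewrite /ifct; case: (intP e) => [|m|m].
- by rewrite /= mul1r.
- have -> : m.+1%:Z + 1 = m.+2 by lia.
  rewrite /= [(m.+2)`!]factS natrM invfM mulrA divff ?mul1r //; exact: natr_neq0.
- case: m => [|m]; first by rewrite /= mul0r.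
  have -> : - m.+2%:Z + 1 = - m.+1%:Z by lia.
  by rewrite /= mulr0.
Qed.

End Generic.

(** Binomial coefficient with indeterminate upper argument. Over a [comUnitRingType], one definition
    serves polynomials, their fraction field and the rationals. *)
Definition gbin (R : comUnitRingType) (v : R) (e : nat) : R :=
  (\prod_(j < e) (v - j%:R)) / (e`!)%:R.

(* Weighted count of the lattice paths from the up triangle t_i of the northeastern side (first
   step west, of weight 1/2, or southwest) to the k-th endpoint on the western side, counted from
   the top, for x = u. *)
Definition ent (R : comUnitRingType) (u : R) (i k : nat) : R :=
  if (i <= 2 * k)%N then
    gbin (u + (i + k)%:R - 2%:R) (2 * k - i) / 2%:R +
    (if (i < 2 * k)%N then gbin (u + (i + k)%:R - 2%:R) (2 * k - i - 1) else 0)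
  else 0.

Section Entry.
Variables (F : fieldType) (u : F).
Hypothesis int_inj : forall c : int, c != 0 -> c%:~R != 0 :> F.
Hypothesis generic : forall c : int, 2%:R * u + c%:~R != 0.
Local Notation gu := (gu u).
Local Notation guS := (guS generic).
Local Notation gu0 := (gu_neq0 generic).

Lemma gbin_gu (c : int) (e : nat) : gbin (u + c%:~R) e = gu (c + 1) / gu (c + 1 - e%:Z) * ifct F e.
Proof.
rewrite /gbin /ifct /=; congr (_ / _).
elim: e => [|e IH]; first by rewrite big_ord0 subr0 divff ?gu0.
rewrite big_ord_recr /= IH -[in RHS]addn1 PoszD.
have := guS (c + 1 - (e + 1)%:Z); have := gu0 (c + 1 - e%:Z); have := gu0 (c + 1 - (e + 1)%:Z).
have -> : c + 1 - (e + 1)%:Z + 1 = c + 1 - e%:Z by lia.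
have -> : c + 1 - (e%:Z + 1) = c + 1 - (e + 1)%:Z by lia.
move=> h1 h2 h3; rewrite h3 in h2 *.
move: h2; rewrite mulf_eq0 negb_or => /andP[_ h2].
have -> : u + c%:~R - e%:R = u + (c + 1 - (e + 1)%:Z)%:~R by ring.
by rewrite invfM !mulrA mulfVK.
Qed.

(** With [m = u + i + k - 2] and [e = 2k - i], the sum C(m, e) / 2 + C(m, e - 1) equals C(m, e)
    times (m + e + 1) / (2 (m - e + 1)), and [m + e + 1 = u + 3k - 1]. Thus the entry is a single
    hypergeometric term. *)
Lemma entE (i k : nat) : (0 < i)%N -> (0 < k)%N ->
  ent u i k = (u + (3 * k%:Z - 1)%:~R) / 2%:R * gu (i%:Z + k%:Z - 1) / gu (2 * i%:Z - k%:Z) *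
              ifct F (2 * k%:Z - i%:Z).
Proof.
have n2 : (2%:R : F) != 0 by apply: (natr_neq0 int_inj).
move=> i0 k0; rewrite /ent; case: (leqP i (2 * k)) => ik; last first.
  by rewrite /ifct ifF ?mulr0 //; apply/negbTE; lia.
have -> : u + (i + k)%:R - 2 = u + (i%:Z + k%:Z - 2)%:~R by ring.
rewrite !gbin_gu.
have -> : i%:Z + k%:Z - 2 + 1 = i%:Z + k%:Z - 1 by lia.
have [d ed] : exists d, (2 * k = i + d)%N by exists (2 * k - i)%N; lia.
have -> : (2 * k - i = d)%N by lia.
have -> : 2 * k%:Z - i%:Z = d%:Z by lia.
have -> : i%:Z + k%:Z - 1 - d%:Z = 2 * i%:Z - k%:Z - 1 by lia.
have := guS (2 * i%:Z - k%:Z - 1); rewrite subrK => e1.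
have := gu0 (2 * i%:Z - k%:Z); have := gu0 (2 * i%:Z - k%:Z - 1).
rewrite e1 mulf_eq0 negb_or => h0 /andP[_ h1].
case: d ed => [|d] ed.
  have -> : (i < 2 * k)%N = false by lia.
  have ei : i = (2 * k)%N by lia.
  rewrite addr0 ei in h1 h0 *; move: h1.
  have -> : (2 * (2 * k)%:Z - k%:Z - 1) = 3 * k%:Z - 1 by lia.
  have -> : ((2 * k)%:Z + k%:Z - 1) = 3 * k%:Z - 1 by lia.
  move=> h1; have g0 := gu0 (3 * k%:Z - 1).
  field; nonzero.
have -> : (i < 2 * k)%N by lia.
have -> : (d.+1 - 1 = d)%N by lia.
rewrite (ifctS int_inj d%:Z) (_ : d%:Z + 1 = d.+1%:Z); last by lia.
have -> : i%:Z + k%:Z - 1 - d%:Z = 2 * i%:Z - k%:Z by lia.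
rewrite e1.
have -> : u + (3 * k%:Z - 1)%:~R = (u + (2 * i%:Z - k%:Z - 1)%:~R) + 2 * d.+1%:R.
  rewrite (_ : 3 * k%:Z - 1 = 2 * i%:Z - k%:Z - 1 + 2 * d.+1%:Z); last by lia.
  by ring.
field; nonzero.
Qed.

End Entry.

(** * Triangularization of the path matrix *)

Section Elimination.
Variables (F : fieldType) (u : F).
Hypothesis int_inj : forall c : int, c != 0 -> c%:~R != 0 :> F.
Hypothesis generic : forall c : int, 2%:R * u + c%:~R != 0.
Local Notation gu := (gu u).
Local Notation guS := (guS generic).
Local Notation gu0 := (gu_neq0 generic).
Local Notation ifct := (ifct F).

(* [elim n k] are the coefficients of a column operation, with [elim n n = 1], after which the
   entry in row [i] and column [n] vanishes for [i < n]. *)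
Definition elim_raw (n k : nat) : F :=
  (- 2%:R) ^+ k * (\prod_(j < k) (2 * j + 1)%:R) * ifct (n%:Z - k%:Z) *
  gu (2 * n%:Z - 1 - k%:Z) * gu (n%:Z - 1 + k%:Z) / (gu (k%:Z - 1) * gu (2 * n%:Z + k%:Z)).

Definition elim (n k : nat) : F := elim_raw n k / elim_raw n n.

Lemma elim_raw_neq0 n : elim_raw n n != 0.
Proof.
have n2 : (2%:R : F) != 0 by apply: (natr_neq0 int_inj).
rewrite /elim_raw subrr /ifct /= fact0 invr1 mulr1 !mulf_neq0 ?invr_eq0 ?mulf_neq0 ?gu0 //.
  by rewrite expf_neq0 // oppr_eq0.
by apply/prodf_neq0 => j _; apply: (natr_neq0 int_inj); rewrite addn1.
Qed.

Lemma elim_diag n : elim n n = 1.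
Proof. by rewrite /elim divff // elim_raw_neq0. Qed.

Lemma elim_last n : elim n n.+1 = 0.
Proof.
rewrite /elim /elim_raw (_ : n%:Z - n.+1%:Z = - 1%:Z); last by lia.
by rewrite /ifct /= !(mulr0, mul0r).
Qed.

Lemma elimS n k : (0 < k)%N ->
  elim n k.+1 * ((u + k%:R - 1) * (u + 2%:R * n%:R - 2%:R - k%:R) * (u + 2%:R * n%:R + k%:R)) =
  - 2%:R * (n%:R - k%:R) * (2%:R * k%:R + 1) * (u + n%:R - 1 + k%:R) * elim n k.
Proof.
move=> k0; rewrite /elim mulrAC [RHS]mulrA; congr (_ / _); rewrite /elim_raw.
rewrite big_ord_recr exprS /=.
have -> : k.+1%:Z - 1 = k%:Z - 1 + 1 by lia.
have -> : 2 * n%:Z + k.+1%:Z = 2 * n%:Z + k%:Z + 1 by lia.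
have -> : n%:Z - 1 + k.+1%:Z = n%:Z - 1 + k%:Z + 1 by lia.
have e1 : 2 * n%:Z - 1 - k%:Z = (2 * n%:Z - 1 - k.+1%:Z) + 1 by lia.
rewrite e1 !guS (ifctS int_inj (n%:Z - k.+1%:Z)).
have -> : n%:Z - k.+1%:Z + 1 = n%:Z - k%:Z by lia.
have h1 := gu0 (k%:Z - 1); have h2 := gu0 (2 * n%:Z + k%:Z).
have h3 := generic1 generic (k%:Z - 1); have h4 := generic1 generic (2 * n%:Z + k%:Z).
have -> : u + k%:R - 1 = u + (k%:Z - 1)%:~R by ring.
have -> : u + 2 * n%:R + k%:R = u + (2 * n%:Z + k%:Z)%:~R by ring.
move: h1 h2 h3 h4; set G1 := gu (k%:Z - 1); set G2 := gu (2 * n%:Z + k%:Z).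
set A := u + (k%:Z - 1)%:~R; set B := u + (2 * n%:Z + k%:Z)%:~R => h1 h2 h3 h4.
have -> : u + (2 * n%:Z - 1 - k.+1%:Z)%:~R = u + 2 * n%:R - 2 - k%:R by ring.
have -> : u + (n%:Z - 1 + k%:Z)%:~R = u + n%:R - 1 + k%:R by ring.
have -> : (n%:Z - k%:Z)%:~R = n%:R - k%:R :> F by ring.
have -> : (2 * k + 1)%:R = 2%:R * k%:R + 1 :> F by ring.
by field; nonzero.
Qed.

Definition esum (i n : nat) : F := \sum_(1 <= k < n.+1) ent u i k * elim n k.

(* Zeilberger certificate of the recurrence with coefficients [rec0], [rec1], [rec2] in [i]. *)
Definition cert (i n k : nat) : F :=
  let t := 2%:R * u + 3%:R * i%:R in
  t * (t + 2%:R) * (t + 3%:R) / 2%:R * (3%:R * k%:R - u - 3%:R * i%:R - 5%:R) *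
  ((u + k%:R - 2%:R) * (u + 2%:R * n%:R - 1 - k%:R) * (u + 2%:R * n%:R + k%:R - 1)) *
  gu (i%:Z + k%:Z - 1) / gu (2 * i%:Z - k%:Z + 4) * ifct (2 * k%:Z - i%:Z - 2) * elim n k.

Definition rec0 (i n : F) : F :=
  2%:R * (2%:R * u + 3%:R * i + 3%:R) * (2%:R * n - i) * (i + 1) * (2%:R * u + 2%:R * n - 2%:R + i).
Definition rec1 (i n : F) : F :=
  let t := 2%:R * u + 3%:R * i in
  t * (t + 2%:R) * (2%:R * n - i - 1) * (i + 2%:R) * (2%:R * u + 2%:R * n - 1 + i) -
  (t + 1) * (t + 3%:R) * (2%:R * n - i) * (i + 1) * (2%:R * u + 2%:R * n - 2%:R + i).
Definition rec2 (i n : F) : F :=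
  2%:R * (i + 2%:R - n) * (u + n + i + 1) * (2%:R * u + 2%:R * i + 1) * (2%:R * u + 3%:R * i).

(** Both sides are [elim n k] times a common gamma quotient times a rational function; once all
    gammas and reciprocal factorials are moved to a common base, [field] decides the identity. *)
Lemma certP (i n k : nat) : (0 < i)%N -> (0 < k)%N ->
  (rec0 i%:R n%:R * ent u i k + rec1 i%:R n%:R * ent u i.+1 k + rec2 i%:R n%:R * ent u i.+2 k) * elim n k
  = cert i n k.+1 - cert i n k.
Proof.
move=> i0 k0; have n2 : (2%:R : F) != 0 by apply: (natr_neq0 int_inj).
rewrite !(entE int_inj generic) //.
have := elimS n k0; rewrite /cert.
have -> : 2 * i%:Z - k.+1%:Z + 4 = 2 * i%:Z - k%:Z + 1 + 1 + 1 by lia.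
have -> : 2 * i.+1%:Z - k%:Z = 2 * i%:Z - k%:Z + 1 + 1 by lia.
have -> : 2 * i.+2%:Z - k%:Z = 2 * i%:Z - k%:Z + 1 + 1 + 1 + 1 by lia.
have -> : 2 * i%:Z - k%:Z + 4 = 2 * i%:Z - k%:Z + 1 + 1 + 1 + 1 by lia.
have -> : i%:Z + k.+1%:Z - 1 = i%:Z + k%:Z - 1 + 1 by lia.
have -> : i.+1%:Z + k%:Z - 1 = i%:Z + k%:Z - 1 + 1 by lia.
have -> : i.+2%:Z + k%:Z - 1 = i%:Z + k%:Z - 1 + 1 + 1 by lia.
rewrite !guS.
have -> : 2 * k.+1%:Z - i%:Z - 2 = 2 * k%:Z - i%:Z by lia.
rewrite (ifctS int_inj (2 * k%:Z - i%:Z - 2)).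
have -> : 2 * k%:Z - i%:Z - 2 + 1 = 2 * k%:Z - i%:Z - 1 by lia.
have -> : 2 * k%:Z - i.+1%:Z = 2 * k%:Z - i%:Z - 1 by lia.
have -> : 2 * k%:Z - i.+2%:Z = 2 * k%:Z - i%:Z - 2 by lia.
rewrite (ifctS int_inj (2 * k%:Z - i%:Z - 2)).
have -> : 2 * k%:Z - i%:Z - 2 + 1 = 2 * k%:Z - i%:Z - 1 by lia.
rewrite (ifctS int_inj (2 * k%:Z - i%:Z - 1)) subrK.
have h := gu0 (2 * i%:Z - k%:Z).
have w0 := generic1 generic (2 * i%:Z - k%:Z).
have w1 := generic1 generic (2 * i%:Z - k%:Z + 1).
have w2 := generic1 generic (2 * i%:Z - k%:Z + 1 + 1).
have w3 := generic1 generic (2 * i%:Z - k%:Z + 1 + 1 + 1).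
move: h w0 w1 w2 w3.
have -> : u + (2 * i%:Z - k%:Z)%:~R = u + 2%:R * i%:R - k%:R by ring.
have -> : u + (2 * i%:Z - k%:Z + 1)%:~R = u + 2%:R * i%:R - k%:R + 1 by ring.
have -> : u + (2 * i%:Z - k%:Z + 1 + 1)%:~R = u + 2%:R * i%:R - k%:R + 2%:R by ring.
have -> : u + (2 * i%:Z - k%:Z + 1 + 1 + 1)%:~R = u + 2%:R * i%:R - k%:R + 3%:R by ring.
set h := gu (2 * i%:Z - k%:Z); set g := gu (i%:Z + k%:Z - 1); set f := ifct _.
set v1 := elim n k.+1; set v := elim n k.
have -> : (i%:Z + k%:Z - 1)%:~R = i%:R + k%:R - 1 :> F by ring.
have -> : (i%:Z + k%:Z - 1 + 1)%:~R = i%:R + k%:R :> F by ring.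
have -> : (3 * k%:Z - 1)%:~R = 3%:R * k%:R - 1 :> F by ring.
have -> : (2 * k%:Z - i%:Z)%:~R = 2%:R * k%:R - i%:R :> F by ring.
have -> : (2 * k%:Z - i%:Z - 1)%:~R = 2%:R * k%:R - i%:R - 1 :> F by ring.
rewrite -[k.+1]addn1 natrD.
have [w ew] : exists w, w = u + 2%:R * i%:R - k%:R by eexists.
move=> h0 w0 w1 w2 w3 ev.
have ev' : v1 * ((u + (k%:R + 1%:R) - 2) * (u + 2 * n%:R - 1 - (k%:R + 1%:R)) * (u + 2 * n%:R + (k%:R + 1%:R) - 1))
   = - 2 * (n%:R - k%:R) * (2 * k%:R + 1) * (u + n%:R - 1 + k%:R) * v.
  by rewrite -ev; ring.
(* The cubic factor of [cert] at [k + 1] is exactly the left-hand factor in [elimS], so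
   [elim n k.+1] is eliminated without a division. *)
rewrite [X in _ = X - _](_ : _ = (2 * u + 3 * i%:R) * (2 * u + 3 * i%:R + 2) * (2 * u + 3 * i%:R + 3) / 2 *
    (3 * (k%:R + 1%:R) - u - 3 * i%:R - 5) * (g * (u + (i%:R + k%:R - 1))) /
    (h * (u + 2 * i%:R - k%:R) * (u + 2 * i%:R - k%:R + 1) * (u + 2 * i%:R - k%:R + 2)) * f *
    (v1 * ((u + (k%:R + 1%:R) - 2) * (u + 2 * n%:R - 1 - (k%:R + 1%:R)) * (u + 2 * n%:R + (k%:R + 1%:R) - 1))));
  last by ring.
rewrite ev' /rec0 /rec1 /rec2 /=.
field; nonzero.
Qed.
End Elimination.

Section EliminationSum.
Variables (F : fieldType) (u : F).
Hypothesis int_inj : forall c : int, c != 0 -> c%:~R != 0 :> F.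
Hypothesis generic : forall c : int, 2%:R * u + c%:~R != 0.
Local Notation gu := (gu u).
Local Notation guS := (guS generic).
Local Notation gu0 := (gu_neq0 generic).

Definition g1 (p : int) : F := poch (2%:R * u) p.

Lemma g1S p : g1 (p + 1) = g1 p * (2%:R * u + p%:~R).
Proof. exact: pochS. Qed.

Lemma g1_neq0 p : g1 p != 0.
Proof. exact: poch_neq0. Qed.

Lemma esum_rec (i n : nat) : (0 < i)%N ->
  rec0 u i%:R n%:R * esum u i n + rec1 u i%:R n%:R * esum u i.+1 n + rec2 u i%:R n%:R * esum u i.+2 n = 0.
Proof.
move=> i0; rewrite /esum !big_distrr -!big_split /=.
transitivity (\sum_(1 <= k < n.+1) (cert u i n k.+1 - cert u i n k)).
  rewrite [LHS]big_nat [RHS]big_nat; apply: eq_bigr => k /andP[k0 _].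
  by rewrite -(certP int_inj generic) // !mulrDl !mulrA.
(* The upper boundary term dies with [elim n n.+1 = 0]; the lower one, at [k = 1], contains the
   reciprocal factorial of [- i < 0]. *)
rewrite telescope_sumr // /cert elim_last !mulr0 sub0r.
rewrite /ifct ifF ?mulr0 ?mul0r ?oppr0 //; apply/negbTE; lia.
Qed.

(** Closed form of [esum u (2 * n - y) n] for [y < 2n], where [y] counts rows backwards from [2n],
    the last row that meets column [n]. The falling factorial [n ^_ y] makes it vanish for [y > n],
    that is, in the rows of index less than [n]. *)
Definition sig (n y : nat) : F :=
  1 / 2%:R * (gu (3 * n%:Z) / gu (3 * n%:Z - y%:Z)) * ((n ^_ y)%:R / (y`! * (2 * n) ^_ y)%:R) *
  (g1 (4 * n%:Z - y%:Z - 2) / g1 (4 * n%:Z - 2 * y%:Z - 2)) *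
  (gu (2 * n%:Z - y%:Z - 1) / gu (2 * n%:Z - 1)).

Lemma sig0 n : sig n 0 = 1 / 2%:R.
Proof.
rewrite /sig (_ : 4 * n%:Z - 2 * 0%:Z - 2 = 4 * n%:Z - 0%:Z - 2); last by lia.
by rewrite !subr0 !ffactn0 !divff ?gu0 ?g1_neq0 ?oner_neq0 // !mulr1.
Qed.

Lemma sigS n y : (y < 2 * n)%N ->
  sig n y.+1 * ((y%:R + 1) * (2%:R * n%:R - y%:R) * (2%:R * u + 4%:R * n%:R - y%:R - 3%:R)) =
  sig n y * (2%:R * (u + 3%:R * n%:R - 1 - y%:R) * (n%:R - y%:R) * (2%:R * u + 4%:R * n%:R - 2%:R * y%:R - 3%:R)).
Proof.
move=> yn; have n2 : (2%:R : F) != 0 by apply: (natr_neq0 int_inj).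
rewrite /sig !ffactnSr factS !natrM.
have -> : (n ^_ y)%:R * (n - y)%:R = (n ^_ y)%:R * (n%:R - y%:R) :> F.
  by case: (leqP y n) => h; [rewrite natrB | rewrite ffact_small // !mul0r].
have e : (2 * n - y)%:R = 2 * n%:R - y%:R :> F by rewrite natrB ?natrM // ltnW.
rewrite e.
have c1 : (2 * n%:R - y%:R : F) != 0 by rewrite -e; apply: (natr_neq0 int_inj); lia.
have c2 : (y.+1%:R : F) != 0 by apply: (natr_neq0 int_inj).
have c3 : ((y`!)%:R : F) != 0 by apply: (natr_neq0 int_inj); apply: fact_gt0.
have c4 : (((2 * n) ^_ y)%:R : F) != 0 by apply: (natr_neq0 int_inj); rewrite ffact_gt0 ltnW.
have -> : 3 * n%:Z - y%:Z = 3 * n%:Z - y.+1%:Z + 1 by lia.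
have -> : 4 * n%:Z - y%:Z - 2 = 4 * n%:Z - y.+1%:Z - 2 + 1 by lia.
have -> : 4 * n%:Z - 2 * y%:Z - 2 = 4 * n%:Z - 2 * y.+1%:Z - 2 + 1 + 1 by lia.
have -> : 2 * n%:Z - y%:Z - 1 = 2 * n%:Z - y.+1%:Z - 1 + 1 by lia.
rewrite !guS !g1S.
have d1 := gu0 (3 * n%:Z - y.+1%:Z).
have d2 := g1_neq0 (4 * n%:Z - 2 * y.+1%:Z - 2).
have d3 := gu0 (2 * n%:Z - 1).
have d4 := generic1 generic (3 * n%:Z - y.+1%:Z).
have d5 := generic (4 * n%:Z - 2 * y.+1%:Z - 2).
have d6 := generic (4 * n%:Z - 2 * y.+1%:Z - 2 + 1).
move: d1 d2 d3 d4 d5 d6 c2.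
rewrite -[y.+1]addn1 !PoszD.
have -> : u + (3 * n%:Z - (y%:Z + 1))%:~R = u + 3 * n%:R - 1 - y%:R by ring.
have -> : u + (2 * n%:Z - (y%:Z + 1) - 1)%:~R = u + 2 * n%:R - 2 - y%:R by ring.
have -> : 2 * u + (4 * n%:Z - 2 * (y%:Z + 1) - 2)%:~R = 2 * u + 4 * n%:R - 4 - 2 * y%:R by ring.
have -> : 2 * u + (4 * n%:Z - 2 * (y%:Z + 1) - 2 + 1)%:~R = 2 * u + 4 * n%:R - 3 - 2 * y%:R by ring.
have -> : 2 * u + (4 * n%:Z - (y%:Z + 1) - 2)%:~R = 2 * u + 4 * n%:R - 3 - y%:R by ring.
set G1 := gu (3 * n%:Z - _); set G2 := g1 (4 * n%:Z - 2 * _ - 2); set G3 := gu (2 * n%:Z - 1).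
set G4 := gu (2 * n%:Z - _ - 1); set G5 := g1 (4 * n%:Z - _ - 2); set G6 := gu (3 * n%:Z).
rewrite natrD; move=> d1 d2 d3 d4 d5 d6 c2.
by field; nonzero.
Qed.

Lemma esum_top n : (0 < n)%N -> esum u (2 * n) n = 1 / 2%:R.
Proof.
move=> n0; rewrite /esum big_nat_recr //= (elim_diag int_inj generic) mulr1 big_nat big1 ?add0r.
  by rewrite /ent leqnn ltnn subnn addr0 /gbin big_ord0 fact0 divr1.
by move=> k /andP[k0 kn]; rewrite /ent leqNgt ltn_pmul2l // kn mul0r.
Qed.

Lemma esum_above n i : (2 * n < i)%N -> esum u i n = 0.
Proof.
move=> ni; rewrite /esum big_nat big1 // => k /andP[k0 kn].
by rewrite /ent leqNgt (leq_ltn_trans _ ni) ?mul0r // leq_mul2l -ltnS kn.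
Qed.

Lemma sig_next n y : (y < 2 * n)%N ->
  sig n y.+1 = sig n y * (2%:R * (u + 3%:R * n%:R - 1 - y%:R) * (n%:R - y%:R) *
     (2%:R * u + 4%:R * n%:R - 2%:R * y%:R - 3%:R)) /
    ((y%:R + 1) * (2%:R * n%:R - y%:R) * (2%:R * u + 4%:R * n%:R - y%:R - 3%:R)).
Proof.
move=> yn; rewrite -sigS // mulfK // !mulf_neq0 //.
- by rewrite natr1; apply: (natr_neq0 int_inj).
- by rewrite -natrM -natrB ?(ltnW yn) //; apply: (natr_neq0 int_inj); lia.
- have := generic (4 * n%:Z - y%:Z - 3); congr (_ != 0); ring.
Qed.

Lemma esumE n y : (y < 2 * n)%N -> esum u (2 * n - y) n = sig n y.
Proof.
move=> yn; have n0 : (0 < n)%N by lia.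
have n2 : (2%:R : F) != 0 by apply: (natr_neq0 int_inj).
suff [] : esum u (2 * n - y) n = sig n y /\
  (if y is y'.+1 then esum u (2 * n - y') n = sig n y' else True) by [].
elim: y yn => [_|y IH yn]; first by rewrite subn0 esum_top // sig0.
have {IH}[E1 E2] := IH (ltnW yn); split=> //.
have i0 : (0 < 2 * n - y.+1)%N by lia.
have := esum_rec n i0.
have -> : ((2 * n - y.+1).+1 = 2 * n - y)%N by lia.
have ei : (2 * n - y.+1)%:R = 2 * n%:R - y%:R - 1 :> F.
  by rewrite natrB ?natrM -?[y.+1]addn1 ?natrD; [ring | lia].
have d1 : 2 * u + 6 * n%:R - 3 * y%:R != 0 :> F.
  by have := generic (6 * n%:Z - 3 * y%:Z); congr (_ != 0); ring.
have d2 : y%:R + 1 != 0 :> F by rewrite natr1; apply: (natr_neq0 int_inj).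
have d3 : 2 * n%:R - y%:R != 0 :> F.
  by rewrite -natrM -natrB ?(ltnW (ltnW yn)) //; apply: (natr_neq0 int_inj); lia.
have d4 : 2 * u + 4 * n%:R - y%:R - 3 != 0.
  by have := generic (4 * n%:Z - y%:Z - 3); congr (_ != 0); ring.
(* [rec0] is the coefficient of the new row, so its nonvanishing lets the recurrence determine that
   row. *)
have r0 : rec0 u (2 * n - y.+1)%:R n%:R != 0.
  rewrite ei (_ : rec0 _ _ _ = 2 * (2 * u + 6 * n%:R - 3 * y%:R) * (y%:R + 1) * (2 * n%:R - y%:R)
     * (2 * u + 4 * n%:R - y%:R - 3)); last by rewrite /rec0; ring.
  by rewrite !mulf_neq0.
rewrite E1 => R; apply: (mulfI r0); apply/eqP; rewrite -subr_eq0; apply/eqP.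
case: y yn E1 E2 R r0 ei d1 d2 d3 d4 i0 => [|y] yn E1 E2 R r0 ei d1 d2 d3 d4 i0.
  (* To start, row [2n + 1] of column [n] vanishes, and the recurrence has only two terms. *)
  move: R; rewrite (@esum_above n (2 * n - 0).+1); last by lia.
  rewrite mulr0 addr0 => /eqP; rewrite addr_eq0 => /eqP ->.
  rewrite sig_next ?(ltnW yn) // ei /rec0 /rec1.
  have nn : n%:R != 0 :> F by apply: (natr_neq0 int_inj).
  by field; nonzero.
move: R; rewrite (_ : (2 * n - y.+1).+1 = 2 * n - y)%N; last by lia.
rewrite E2 -addrA => /eqP; rewrite addr_eq0 => /eqP ->.
have f2 : y%:R + 1 != 0 :> F by rewrite natr1; apply: (natr_neq0 int_inj).
have f3 : 2 * n%:R - y%:R != 0 :> F.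
  by rewrite -natrM -natrB; [apply: (natr_neq0 int_inj); lia | lia].
have f4 : 2 * u + 4 * n%:R - y%:R - 3 != 0.
  by have := generic (4 * n%:Z - y%:Z - 3); congr (_ != 0); ring.
rewrite (sig_next (y := y.+1)) ?(sig_next (y := y)) ?ei; [|lia|lia].
rewrite /rec0 /rec1 /rec2; move: d1 d2 d3 d4; rewrite -[y.+1]addn1 natrD => d1 d2 d3 d4.
by field; nonzero.
Qed.

Lemma esum_below n i : (0 < i < n)%N -> esum u i n = 0.
Proof.
move=> /andP[i0 ni]; rewrite (_ : i = 2 * n - (2 * n - i))%N; last by lia.
rewrite esumE; last by lia.
by rewrite /sig ffact_small ?mul0r ?mulr0 ?mul0r //; lia.
Qed.

End EliminationSum.

(** * The remaining minor *)

Section ZRatio.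
Variables (F : fieldType) (u : F).
Hypothesis int_inj : forall c : int, c != 0 -> c%:~R != 0 :> F.
Hypothesis generic : forall c : int, 2%:R * u + c%:~R != 0.
Local Notation gu := (gu u).
Local Notation guS := (guS generic).
Local Notation gu0 := (gu_neq0 generic).
Local Notation g1 := (g1 u).
Local Notation g1S := (g1S generic).
Local Notation g1_0 := (g1_neq0 generic).

Definition go (m : int) : F := spoch (2%:R * u + 1) m.

Lemma goS m : go (m + 1) = go m * (2%:R * u + (2 * m + 1)%:~R).
Proof.
rewrite /go spochS; last by move=> c; have := generic (1 + c); rewrite intrD addrA.
by congr (_ * _); ring.
Qed.

Lemma go_neq0 m : go m != 0.
Proof. by apply: spoch_neq0 => c; have := generic (1 + c); rewrite intrD addrA. Qed.

(* Quotient of the [z.+1]-st by the [z]-th minor in [cminor_esum]. *)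
Definition zratio (y z a : nat) : F :=
  let n := (y + z + a)%:Z in let Y := y%:Z in let Z := z%:Z in let A := a%:Z in
  sig u (y + z + a) (y + z + a) * 2%:R^-1 ^+ a *
  (g1 (3 * n + 3 * A - 2) / g1 (3 * n - 2)) *
  (g1 (3 * Y + 2 * Z + 4 * A - 2) / g1 (3 * Y + 2 * Z + 6 * A - 2)) *
  (((y + 2 * z + 2 * a)`! * z`!)%:R / ((y + 2 * z)`! * (z + a)`!)%:R) *
  (gu (2 * Y + Z + 3 * A - 1) / gu (2 * Y + Z + 2 * A - 1)) *
  (go (n - 1) / go (n + A - 1)) * (gu (2 * n - 1) / gu (2 * n + A - 1)) * (gu (2 * n) / gu (2 * n + A)).

Lemma fact0F n : (n`!)%:R != 0 :> F.
Proof. by apply: (natr_neq0 int_inj); apply: fact_gt0. Qed.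

Lemma sig_neq0 n y : (y <= n)%N -> sig u n y != 0.
Proof.
move=> yn; rewrite /sig !mulf_neq0 ?invr_eq0 ?mulf_neq0 ?gu0 ?g1_0 ?oner_neq0 //.
- exact: (natr_neq0 int_inj).
- by apply: (natr_neq0 int_inj); rewrite ffact_gt0.
- by apply: (natr_neq0 int_inj); rewrite muln_gt0 fact_gt0 ffact_gt0; lia.
Qed.

Lemma zratio_neq0 y z a : zratio y z a != 0.
Proof.
have n2 : (2%:R : F) != 0 by apply: (natr_neq0 int_inj).
rewrite /zratio; move: (sig u _ _) (sig_neq0 (leqnn (y + z + a))) => s s0.
rewrite !mulf_neq0 ?invr_eq0 ?natrM ?mulf_neq0 ?gu0 ?g1_0 ?go_neq0 ?fact0F //.
by rewrite expf_neq0 // invr_eq0.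
Qed.

(** Trading a unit of [z] for one of [y] keeps [n = y + z + a], so [sig] and the gammas in [n] and
    [a] alone cancel; each remaining gamma or factorial moves by one and leaves a linear factor. *)
Lemma zratio_shift_z y z a :
  zratio y z.+1 a * ((z%:R + 1 + a%:R) * (2%:R * z%:R + 2%:R + y%:R) *
     (2%:R * u + 4%:R * a%:R + 3%:R * y%:R + 2%:R * z%:R) * (u + 3%:R * a%:R + 2%:R * y%:R + z%:R)) =
  zratio y.+1 z a * ((z%:R + 1) * (2%:R * z%:R + 2%:R + y%:R + 2%:R * a%:R) *
     (u + z%:R + 2%:R * a%:R + 2%:R * y%:R) * (2%:R * u + 2%:R * z%:R + 6%:R * a%:R + 3%:R * y%:R)).
Proof.
rewrite /zratio.
have -> : (y + z.+1 + a = (y + z + a).+1)%N by lia.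
have -> : (y.+1 + z + a = (y + z + a).+1)%N by lia.
have [m em] : exists m, m = (y.+1 + 2 * z)%N by eexists.
have [m' em'] : exists m', m' = (m + 2 * a)%N by eexists.
have -> : (y + 2 * z.+1 = m.+1)%N by lia.
have -> : (m.+1 + 2 * a = m'.+1)%N by lia.
rewrite -em -em'.
have eM : m%:R = y%:R + 1 + 2 * z%:R :> F by rewrite em; ring.
have eM' : m'%:R = y%:R + 1 + 2 * z%:R + 2 * a%:R :> F by rewrite em' natrD eM; ring.
have -> : (z.+1 + a = (z + a).+1)%N by lia.
rewrite (factS m) (factS m') (factS z) (factS (z + a)) !natrM -![m.+1%:R]natr1 -![m'.+1%:R]natr1 eM eM'.
have -> : 3 * y.+1%:Z + 2 * z%:Z + 4 * a%:Z - 2 = 3 * y%:Z + 2 * z.+1%:Z + 4 * a%:Z - 2 + 1 by lia.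
have -> : 3 * y.+1%:Z + 2 * z%:Z + 6 * a%:Z - 2 = 3 * y%:Z + 2 * z.+1%:Z + 6 * a%:Z - 2 + 1 by lia.
have -> : 2 * y.+1%:Z + z%:Z + 3 * a%:Z - 1 = 2 * y%:Z + z.+1%:Z + 3 * a%:Z - 1 + 1 by lia.
have -> : 2 * y.+1%:Z + z%:Z + 2 * a%:Z - 1 = 2 * y%:Z + z.+1%:Z + 2 * a%:Z - 1 + 1 by lia.
rewrite !guS !g1S.
have z1 : z%:R + 1 + a%:R != 0 :> F by have := @natr_neq0 _ int_inj (z + a).+1 isT; congr (_ != 0); ring.
have z2 : 2 * z%:R + 2 + y%:R != 0 :> F by have := @natr_neq0 _ int_inj (2 * z + y + 2); rewrite addn2 => /(_ isT); congr (_ != 0); ring.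
have z3 := generic (4 * a%:Z + 3 * y%:Z + 2 * z%:Z).
have z4 := generic1 generic (3 * a%:Z + 2 * y%:Z + z%:Z).
have z5 := generic1 generic (2 * a%:Z + 2 * y%:Z + z%:Z).
have z6 := generic (6 * a%:Z + 3 * y%:Z + 2 * z%:Z).
have g2 := g1_0 (3 * y%:Z + 2 * z.+1%:Z + 6 * a%:Z - 2).
have g3 := gu0 (2 * y%:Z + z.+1%:Z + 2 * a%:Z - 1).
have g4 := g1_0 (3 * (y + z + a).+1%:Z - 2).
have g5 := go_neq0 ((y + z + a).+1%:Z + a%:Z - 1).
have g6 := gu0 (2 * (y + z + a).+1%:Z + a%:Z).
have g7 := gu0 (2 * (y + z + a).+1%:Z + a%:Z - 1).
have f1 := fact0F (z + a); have f2 := fact0F m.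
set s := sig _ _ _; set G1 := g1 _; set G2 := g1 _ in g4 *; set G3 := g1 _; set G4 := g1 _ in g2 *.
set G5 := gu _; set G6 := gu _ in g3 *; set H1 := go _; set H2 := go _ in g5 *.
set G7 := gu _; set G8 := gu _ in g7 *; set G9 := gu _; set G10 := gu _ in g6 *.
set e := 2%:R^-1 ^+ a.
set F1 := (m'`!)%:R; set F2 := (z`!)%:R.
set F3 := (m`!)%:R in f2 *; set F4 := ((z + a)`!)%:R in f1 *.
have -> : 2 * u + (3 * y%:Z + 2 * z.+1%:Z + 4 * a%:Z - 2)%:~R = 2 * u + 4 * a%:R + 3 * y%:R + 2 * z%:R by ring.
have -> : 2 * u + (3 * y%:Z + 2 * z.+1%:Z + 6 * a%:Z - 2)%:~R = 2 * u + 6 * a%:R + 3 * y%:R + 2 * z%:R by ring.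
have -> : u + (2 * y%:Z + z.+1%:Z + 3 * a%:Z - 1)%:~R = u + 3 * a%:R + 2 * y%:R + z%:R by ring.
have -> : u + (2 * y%:Z + z.+1%:Z + 2 * a%:Z - 1)%:~R = u + 2 * a%:R + 2 * y%:R + z%:R by ring.
field; nonzero.
Qed.

(** Again [n] is unchanged, so [sig] cancels; now the gammas that combine [n] with [a] move as
    well. *)
Lemma zratio_shift_a y z a :
  zratio y z a.+1 * (2%:R * (2%:R * u + 3%:R * y%:R + 2%:R * z%:R + 6%:R * a%:R + 1) *
     (2%:R * u + 3%:R * y%:R + 2%:R * z%:R + 6%:R * a%:R + 2%:R) *
     (2%:R * u + 3%:R * y%:R + 2%:R * z%:R + 6%:R * a%:R + 3%:R) * (z%:R + a%:R + 1) *
     (2%:R * u + 2%:R * y%:R + 2%:R * z%:R + 4%:R * a%:R + 1) *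
     (u + 2%:R * y%:R + 2%:R * z%:R + 3%:R * a%:R + 1) * (u + 2%:R * y%:R + 2%:R * z%:R + 3%:R * a%:R + 2%:R)) =
  zratio y.+1 z a * ((2%:R * u + 3%:R * y%:R + 3%:R * z%:R + 6%:R * a%:R + 1) *
     (2%:R * u + 3%:R * y%:R + 3%:R * z%:R + 6%:R * a%:R + 2%:R) *
     (2%:R * u + 3%:R * y%:R + 3%:R * z%:R + 6%:R * a%:R + 3%:R) *
     (2%:R * u + 3%:R * y%:R + 2%:R * z%:R + 4%:R * a%:R + 1) * (y%:R + 2%:R * z%:R + 2%:R * a%:R + 2%:R) *
     (y%:R + 2%:R * z%:R + 1) * (u + 2%:R * y%:R + z%:R + 3%:R * a%:R + 1)).
Proof.
have n2 : (2%:R : F) != 0 by apply: (natr_neq0 int_inj).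
rewrite /zratio.
have -> : (y + z + a.+1 = (y + z + a).+1)%N by lia.
have -> : (y.+1 + z + a = (y + z + a).+1)%N by lia.
have -> : (y + 2 * z + 2 * a.+1 = (y + 2 * z + 2 * a).+2)%N by lia.
have -> : (y.+1 + 2 * z = (y + 2 * z).+1)%N by lia.
have -> : ((y + 2 * z).+1 + 2 * a = (y + 2 * z + 2 * a).+1)%N by lia.
rewrite addnS exprSr (factS (y + 2 * z + 2 * a).+1) (factS (y + 2 * z + 2 * a)) (factS (y + 2 * z)).
rewrite (factS (z + a)) !natrM.
have f1 := fact0F (z + a); have f2 := fact0F (y + 2 * z).
set N := (y + z + a).+1.
have -> : 3 * N%:Z + 3 * a.+1%:Z - 2 = 3 * N%:Z + 3 * a%:Z - 2 + 1 + 1 + 1 by lia.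
have -> : 3 * y%:Z + 2 * z%:Z + 4 * a.+1%:Z - 2 = 3 * y.+1%:Z + 2 * z%:Z + 4 * a%:Z - 2 + 1 by lia.
have -> : 3 * y%:Z + 2 * z%:Z + 6 * a.+1%:Z - 2 = 3 * y.+1%:Z + 2 * z%:Z + 6 * a%:Z - 2 + 1 + 1 + 1 by lia.
have -> : 2 * y%:Z + z%:Z + 3 * a.+1%:Z - 1 = 2 * y.+1%:Z + z%:Z + 3 * a%:Z - 1 + 1 by lia.
have -> : 2 * y%:Z + z%:Z + 2 * a.+1%:Z - 1 = 2 * y.+1%:Z + z%:Z + 2 * a%:Z - 1 by lia.
have -> : N%:Z + a.+1%:Z - 1 = N%:Z + a%:Z - 1 + 1 by lia.
have -> : 2 * N%:Z + a.+1%:Z - 1 = 2 * N%:Z + a%:Z - 1 + 1 by lia.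
have -> : 2 * N%:Z + a.+1%:Z = 2 * N%:Z + a%:Z + 1 by lia.
rewrite !guS !g1S goS.
have z1 : z%:R + a%:R + 1 != 0 :> F by have := @natr_neq0 _ int_inj (z + a).+1 isT; congr (_ != 0); ring.
have z2 : y%:R + 2 * z%:R + 1 != 0 :> F by have := @natr_neq0 _ int_inj (y + 2 * z).+1 isT; congr (_ != 0); ring.
have w1 := generic (3 * y%:Z + 2 * z%:Z + 6 * a%:Z + 1).
have w2 := generic (3 * y%:Z + 2 * z%:Z + 6 * a%:Z + 2).
have w3 := generic (3 * y%:Z + 2 * z%:Z + 6 * a%:Z + 3).
have w4 := generic (2 * y%:Z + 2 * z%:Z + 4 * a%:Z + 1).
have w5 := generic1 generic (2 * y%:Z + 2 * z%:Z + 3 * a%:Z + 1).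
have w6 := generic1 generic (2 * y%:Z + 2 * z%:Z + 3 * a%:Z + 2).
have g2 := g1_0 (3 * y.+1%:Z + 2 * z%:Z + 6 * a%:Z - 2).
have g3 := gu0 (2 * y.+1%:Z + z%:Z + 2 * a%:Z - 1).
have g4 := g1_0 (3 * N%:Z - 2).
have g5 := go_neq0 (N%:Z + a%:Z - 1).
have g6 := gu0 (2 * N%:Z + a%:Z).
have g7 := gu0 (2 * N%:Z + a%:Z - 1).
set s := sig _ _ _; set G1 := g1 _; set G2 := g1 _ in g4 *; set G3 := g1 _; set G4 := g1 _ in g2 *.
set G5 := gu _; set G6 := gu _ in g3 *; set H1 := go _; set H2 := go _ in g5 *.
set G7 := gu _; set G8 := gu _ in g7 *; set G9 := gu _; set G10 := gu _ in g6 *.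
set e := 2%:R^-1 ^+ a.
set F1 := ((y + 2 * z + 2 * a)`!)%:R; set F2 := (z`!)%:R.
set F3 := ((y + 2 * z)`!)%:R in f2 *; set F4 := ((z + a)`!)%:R in f1 *.
have eN : N%:R = y%:R + z%:R + a%:R + 1 :> F by rewrite /N; ring.
rewrite (_ : 2 * u + (3 * y.+1%:Z + 2 * z%:Z + 4 * a%:Z - 2)%:~R = 2 * u + 3 * y%:R + 2 * z%:R + 4 * a%:R + 1); last by ring.
rewrite (_ : 2 * u + (3 * y.+1%:Z + 2 * z%:Z + 6 * a%:Z - 2)%:~R = 2 * u + 3 * y%:R + 2 * z%:R + 6 * a%:R + 1); last by ring.
rewrite (_ : 2 * u + (3 * y.+1%:Z + 2 * z%:Z + 6 * a%:Z - 2 + 1)%:~R = 2 * u + 3 * y%:R + 2 * z%:R + 6 * a%:R + 2); last by ring.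
rewrite (_ : 2 * u + (3 * y.+1%:Z + 2 * z%:Z + 6 * a%:Z - 2 + 1 + 1)%:~R = 2 * u + 3 * y%:R + 2 * z%:R + 6 * a%:R + 3); last by ring.
rewrite (_ : 2 * u + (3 * N%:Z + 3 * a%:Z - 2)%:~R = 2 * u + 3 * y%:R + 3 * z%:R + 6 * a%:R + 1); last by ring: eN.
rewrite (_ : 2 * u + (3 * N%:Z + 3 * a%:Z - 2 + 1)%:~R = 2 * u + 3 * y%:R + 3 * z%:R + 6 * a%:R + 2); last by ring: eN.
rewrite (_ : 2 * u + (3 * N%:Z + 3 * a%:Z - 2 + 1 + 1)%:~R = 2 * u + 3 * y%:R + 3 * z%:R + 6 * a%:R + 3); last by ring: eN.
rewrite (_ : u + (2 * y.+1%:Z + z%:Z + 3 * a%:Z - 1)%:~R = u + 2 * y%:R + z%:R + 3 * a%:R + 1); last by ring.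
rewrite (_ : 2 * u + (2 * (N%:Z + a%:Z - 1) + 1)%:~R = 2 * u + 2 * y%:R + 2 * z%:R + 4 * a%:R + 1); last by ring: eN.
rewrite (_ : u + (2 * N%:Z + a%:Z)%:~R = u + 2 * y%:R + 2 * z%:R + 3 * a%:R + 2); last by ring: eN.
rewrite (_ : u + (2 * N%:Z + a%:Z - 1)%:~R = u + 2 * y%:R + 2 * z%:R + 3 * a%:R + 1); last by ring: eN.
field; nonzero.
Qed.
End ZRatio.

Section Minors.
Variables (F : fieldType) (u : F).
Hypothesis int_inj : forall c : int, c != 0 -> c%:~R != 0 :> F.
Hypothesis generic : forall c : int, 2%:R * u + c%:~R != 0.
Local Notation sig := (sig u).

Lemma zratio_a0 y z : zratio u y z 0 = sig (y + z) (y + z).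
Proof.
rewrite /zratio !addn0; set n := (y + z)%N.
rewrite (_ : 3 * n%:Z + 3 * 0%:Z - 2 = 3 * n%:Z - 2); last by lia.
rewrite (_ : 3 * y%:Z + 2 * z%:Z + 6 * 0%:Z - 2 = 3 * y%:Z + 2 * z%:Z + 4 * 0%:Z - 2); last by lia.
rewrite (_ : 2 * y%:Z + z%:Z + 3 * 0%:Z - 1 = 2 * y%:Z + z%:Z + 2 * 0%:Z - 1); last by lia.
rewrite (_ : n%:Z + 0%:Z - 1 = n%:Z - 1); last by lia.
rewrite (_ : 2 * n%:Z + 0%:Z - 1 = 2 * n%:Z - 1); last by lia.
rewrite (_ : 2 * n%:Z + 0%:Z = 2 * n%:Z); last by lia.
by rewrite !divff ?mulr1 // ?natrM ?mulf_neq0 ?fact0F ?(go_neq0 generic) ?(g1_neq0 generic) ?(gu_neq0 generic).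
Qed.

(** The first minor is a single entry of [esum]. The induction trades [a] for [y] at fixed [y + a],
    and [sig_next] undoes the resulting step in [y]. *)
Lemma zratio_z0 y a : zratio u y 0 a = sig (y + a) y.
Proof.
have n2 : (2%:R : F) != 0 by apply: (natr_neq0 int_inj).
elim: a y => [|a IH] y; first by rewrite zratio_a0 addn0.
have := zratio_shift_a int_inj generic y 0 a; rewrite IH.
rewrite (_ : (y.+1 + a = y + a.+1)%N); last by lia.
rewrite (sig_next int_inj generic); last by lia.
rewrite natrD -natr1.
have w1 := generic (3 * y%:Z + 6 * a%:Z + 1).
have w2 := generic (3 * y%:Z + 6 * a%:Z + 2).
have w3 := generic (3 * y%:Z + 6 * a%:Z + 3).
have w4 := generic (2 * y%:Z + 4 * a%:Z + 1).
have w5 := generic1 generic (2 * y%:Z + 3 * a%:Z + 1).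
have w6 := generic1 generic (2 * y%:Z + 3 * a%:Z + 2).
have w7 := generic (3 * y%:Z + 4 * a%:Z + 1).
have z1 : a%:R + 1 != 0 :> F by rewrite natr1; apply: (natr_neq0 int_inj).
have z2 : y%:R + 1 != 0 :> F by rewrite natr1; apply: (natr_neq0 int_inj).
have z3 : y%:R + 2 * a%:R + 2 != 0 :> F.
  have := @natr_neq0 _ int_inj (y + 2 * a).+2 isT; congr (_ != 0); ring.
move: (zratio _ _ _ _) (sig _ _) => q s E.
have D : 2 * (2 * u + 3 * y%:R + 6 * a%:R + 1) * (2 * u + 3 * y%:R + 6 * a%:R + 2) *
  (2 * u + 3 * y%:R + 6 * a%:R + 3) * (a%:R + 1) * (2 * u + 2 * y%:R + 4 * a%:R + 1) *
  (u + 2 * y%:R + 3 * a%:R + 1) * (u + 2 * y%:R + 3 * a%:R + 2) != 0.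
  rewrite !mulf_neq0 //.
  - by move: w1; congr (_ != 0); ring.
  - by move: w2; congr (_ != 0); ring.
  - by move: w3; congr (_ != 0); ring.
  - by move: w4; congr (_ != 0); ring.
  - by move: w5; congr (_ != 0); ring.
  - by move: w6; congr (_ != 0); ring.
apply: (mulIf D).
rewrite -[RHS](_ : q * (2 * (2 * u + 3 * y%:R + 2 * 0 + 6 * a%:R + 1) * (2 * u + 3 * y%:R + 2 * 0 + 6 * a%:R + 2) *
     (2 * u + 3 * y%:R + 2 * 0 + 6 * a%:R + 3) * (0 + a%:R + 1) * (2 * u + 2 * y%:R + 2 * 0 + 4 * a%:R + 1) *
     (u + 2 * y%:R + 2 * 0 + 3 * a%:R + 1) * (u + 2 * y%:R + 2 * 0 + 3 * a%:R + 2)) = _); first by ring.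
rewrite E.
field; nonzero.
Qed.

Definition zprod (y z a : nat) : F := \prod_(i < z) zratio u y i a.

Lemma zprodS y z a : zprod y z.+1 a = zprod y z a * zratio u y z a.
Proof. by rewrite /zprod big_ord_recr. Qed.

Lemma zprod_neq0 y z a : zprod y z a != 0.
Proof. by apply/prodf_neq0 => i _; apply: zratio_neq0. Qed.

(** Two instances of [zratio_shift_a], one at [y], [a + 1] and one at [y + 2], [a]; most of their
    linear factors coincide ([kd] and [kn]) and cancel in the quotient. *)
Lemma zratio_cross y z a :
  zratio u y z a.+2 * zratio u y.+3 z a * ((z%:R + a%:R + 2%:R) * (u + 2%:R * y%:R + 2%:R * z%:R + 3%:R * a%:R + 4%:R) *
   ((2%:R * u + 3%:R * y%:R + 2%:R * z%:R + 4%:R * a%:R + 7%:R) * (y%:R + 2%:R * z%:R + 3%:R) *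
    (u + 2%:R * y%:R + z%:R + 3%:R * a%:R + 5%:R))) =
  zratio u y.+1 z a.+1 * zratio u y.+2 z a.+1 * ((z%:R + a%:R + 1) * (u + 2%:R * y%:R + 2%:R * z%:R + 3%:R * a%:R + 6%:R) *
   ((2%:R * u + 3%:R * y%:R + 2%:R * z%:R + 4%:R * a%:R + 5%:R) * (y%:R + 2%:R * z%:R + 1) *
    (u + 2%:R * y%:R + z%:R + 3%:R * a%:R + 4%:R))).
Proof.
have n2 : (2%:R : F) != 0 by apply: (natr_neq0 int_inj).
have A1 := zratio_shift_a int_inj generic y z a.+1.
have A2 := zratio_shift_a int_inj generic y.+2 z a.
pose kd := 2%:R * (2%:R * u + 3%:R * y%:R + 2%:R * z%:R + 6%:R * a%:R + 7%:R) *
     (2%:R * u + 3%:R * y%:R + 2%:R * z%:R + 6%:R * a%:R + 8%:R) *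
     (2%:R * u + 3%:R * y%:R + 2%:R * z%:R + 6%:R * a%:R + 9%:R) *
     (2%:R * u + 2%:R * y%:R + 2%:R * z%:R + 4%:R * a%:R + 5%:R) *
     (u + 2%:R * y%:R + 2%:R * z%:R + 3%:R * a%:R + 5%:R).
pose kn := (2%:R * u + 3%:R * y%:R + 3%:R * z%:R + 6%:R * a%:R + 7%:R) *
     (2%:R * u + 3%:R * y%:R + 3%:R * z%:R + 6%:R * a%:R + 8%:R) *
     (2%:R * u + 3%:R * y%:R + 3%:R * z%:R + 6%:R * a%:R + 9%:R) * (y%:R + 2%:R * z%:R + 2%:R * a%:R + 4%:R).
have kd0 : kd != 0.
  rewrite !mulf_neq0 //.
  - by have := generic (3 * y%:Z + 2 * z%:Z + 6 * a%:Z + 7); congr (_ != 0); ring.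
  - by have := generic (3 * y%:Z + 2 * z%:Z + 6 * a%:Z + 8); congr (_ != 0); ring.
  - by have := generic (3 * y%:Z + 2 * z%:Z + 6 * a%:Z + 9); congr (_ != 0); ring.
  - by have := generic (2 * y%:Z + 2 * z%:Z + 4 * a%:Z + 5); congr (_ != 0); ring.
  - by have := generic1 generic (2 * y%:Z + 2 * z%:Z + 3 * a%:Z + 5); congr (_ != 0); ring.
have c0 : (z%:R + a%:R + 1) * (u + 2%:R * y%:R + 2%:R * z%:R + 3%:R * a%:R + 6%:R) != 0 :> F.
  rewrite mulf_neq0 //; first by rewrite -natrD natr1; apply: (natr_neq0 int_inj).
  by have := generic1 generic (2 * y%:Z + 2 * z%:Z + 3 * a%:Z + 6); congr (_ != 0); ring.
set d1 := (X in zratio u y z _ * X = _) in A1; set m1 := (X in _ = zratio u y.+1 z _ * X) in A1.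
set d2 := (X in zratio u y.+2 z _ * X = _) in A2; set m2 := (X in _ = zratio u y.+3 z _ * X) in A2.
have e1 : d1 = kd * ((z%:R + a%:R + 2) * (u + 2 * y%:R + 2 * z%:R + 3 * a%:R + 4)) by rewrite /d1 /kd; ring.
have e2 : d2 = kd * ((z%:R + a%:R + 1) * (u + 2 * y%:R + 2 * z%:R + 3 * a%:R + 6)) by rewrite /d2 /kd; ring.
have e3 : m1 = kn * ((2 * u + 3 * y%:R + 2 * z%:R + 4 * a%:R + 5) * (y%:R + 2 * z%:R + 1) *
    (u + 2 * y%:R + z%:R + 3 * a%:R + 4)) by rewrite /m1 /kn; ring.
have e4 : m2 = kn * ((2 * u + 3 * y%:R + 2 * z%:R + 4 * a%:R + 7) * (y%:R + 2 * z%:R + 3) *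
    (u + 2 * y%:R + z%:R + 3 * a%:R + 5)) by rewrite /m2 /kn; ring.
move: A1 A2; rewrite e1 e2 e3 e4.
have q2 : zratio u y.+2 z a.+1 != 0 by apply: zratio_neq0.
move: kd0 c0 q2; set a1 := (_ + 2) * _; set a2 := (_ + 1) * _.
set b1 := _ * _ * _; set b2 := (_ * _ * _) in e4 *.
clearbody kd kn a1 a2 b1 b2.
move: (zratio u y z a.+2) (zratio u y.+1 z a.+1) (zratio u y.+2 z a.+1) (zratio u y.+3 z a).
move=> q0 q1 q2 q3 kd0 c0 q20 A1 A2.
(* Otherwise [A2] would force [kd = 0]. *)
have kn0 : kn != 0.
  apply: contra_neq kd0 => k0; move: A2; rewrite k0 mul0r mulr0 => /eqP.
  by rewrite !mulf_eq0 (negPf q20) (negPf c0) orbF /= => /eqP.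
apply: (mulfI kd0); apply: (mulfI kn0).
transitivity ((q0 * (kd * a1)) * (q3 * (kn * b2))); first by ring.
by rewrite A1 -A2; ring.
Qed.

(* [cross_num / cross_den] is the quotient of the two products in the Desnanot-Jacobi identity. *)
Definition cross_den (y z a : nat) : F :=
  (z%:R + a%:R) * (2%:R * z%:R + y%:R) * (2%:R * u + 4%:R * a%:R + 3%:R * y%:R - 2%:R + 2%:R * z%:R) *
  (u + 3%:R * a%:R + 2%:R * y%:R - 1 + z%:R).

Definition cross_num (y z a : nat) : F :=
  a%:R * y%:R * (2%:R * u + 4%:R * a%:R + 3%:R * y%:R - 2%:R) *
  (u + 3%:R * a%:R + 2%:R * y%:R - 1 + 2%:R * z%:R).

Lemma cross_den_neq0 y z a : (0 < z + a)%N -> (0 < z + y)%N -> cross_den y z a != 0.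
Proof.
move=> za zy; rewrite /cross_den !mulf_neq0 //.
- by rewrite -natrD; apply: (natr_neq0 int_inj).
- by rewrite -natrM -natrD; apply: (natr_neq0 int_inj); lia.
- by have := generic (4 * a%:Z + 3 * y%:Z - 2 + 2 * z%:Z); congr (_ != 0); ring.
- by have := generic1 generic (3 * a%:Z + 2 * y%:Z - 1 + z%:Z); congr (_ != 0); ring.
Qed.

(** At [z = 0] the products are empty and [cross_den] equals [cross_num]; the induction step is
    [zratio_cross]. *)
Lemma zprod_cross y z a :
  zprod y z a.+2 * zprod y.+3 z a * cross_den y.+1 z a.+1 =
  cross_num y.+1 z a.+1 * (zprod y.+1 z a.+1 * zprod y.+2 z a.+1).
Proof.
elim: z => [|z IH].
  by rewrite /zprod !big_ord0 /cross_den /cross_num; ring.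
rewrite !zprodS.
have D0 : cross_den y.+1 z a.+1 != 0 by apply: cross_den_neq0; lia.
have := zratio_cross y z a.
set k1 := (X in _ * X = _ -> _); set k2 := (X in _ = _ * X -> _).
have k0 : k1 != 0.
  rewrite !mulf_neq0 //.
  - by have := @natr_neq0 _ int_inj (z + a).+2 isT; congr (_ != 0); ring.
  - by have := generic1 generic (2 * y%:Z + 2 * z%:Z + 3 * a%:Z + 4); congr (_ != 0); ring.
  - by have := generic (3 * y%:Z + 2 * z%:Z + 4 * a%:Z + 7); congr (_ != 0); ring.
  - by have := @natr_neq0 _ int_inj (y + 2 * z).+3 isT; congr (_ != 0); ring.
  - by have := generic1 generic (2 * y%:Z + z%:Z + 3 * a%:Z + 5); congr (_ != 0); ring.
have K : cross_num y.+1 z a.+1 * k2 * cross_den y.+1 z.+1 a.+1 =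
    cross_num y.+1 z.+1 a.+1 * k1 * cross_den y.+1 z a.+1.
  by rewrite /cross_num /cross_den /k1 /k2; ring.
move: D0 k0 K IH; clearbody k1 k2.
move: (cross_den y.+1 z a.+1) (cross_den y.+1 z.+1 a.+1) => D0 D1.
move: (cross_num y.+1 z a.+1) (cross_num y.+1 z.+1 a.+1) => N0 N1.
move: (zratio u y z a.+2) (zratio u y.+1 z a.+1) (zratio u y.+2 z a.+1) (zratio u y.+3 z a).
move: (zprod y z a.+2) (zprod y.+1 z a.+1) (zprod y.+2 z a.+1) (zprod y.+3 z a).
move=> p0 p1 p2 p3 q0 q1 q2 q3 D00 k0 K IH A.
apply: (mulfI D00); apply: (mulfI k0).
transitivity ((p0 * p3 * D0) * (q0 * q3 * k1) * D1); first by ring.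
rewrite IH A.
transitivity ((N0 * k2 * D1) * (p1 * p2 * q1 * q2)); first by ring.
by rewrite K; ring.
Qed.

(** The decisive fact is that [cross_den - cross_num] splits into linear factors again, namely those
    on the right of [zratio_shift_z]. *)
Lemma zprod_condense y z a : (0 < y + a)%N ->
  zprod y z.+2 a * zprod y.+1 z a * cross_den y z.+1 a =
  zprod y z.+1 a * zprod y.+1 z.+1 a * (cross_den y z.+1 a - cross_num y z.+1 a).
Proof.
move=> ya; rewrite (zprodS y z.+1) (zprodS y.+1 z).
have := zratio_shift_z int_inj generic y z a.
have -> : cross_den y z.+1 a = (z%:R + 1 + a%:R) * (2%:R * z%:R + 2%:R + y%:R) *
     (2%:R * u + 4%:R * a%:R + 3%:R * y%:R + 2%:R * z%:R) * (u + 3%:R * a%:R + 2%:R * y%:R + z%:R).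
  by rewrite /cross_den; ring.
set d := _ * _ * _ * _ => E.
have -> : d - cross_num y z.+1 a = (z%:R + 1) * (2%:R * z%:R + 2%:R + y%:R + 2%:R * a%:R) *
     (u + z%:R + 2%:R * a%:R + 2%:R * y%:R) * (2%:R * u + 2%:R * z%:R + 6%:R * a%:R + 3%:R * y%:R).
  by rewrite /d /cross_num; ring.
transitivity (zprod y z.+1 a * zprod y.+1 z a * (zratio u y z.+1 a * d)); first by ring.
by rewrite E; ring.
Qed.

Definition esum0 (i j : nat) : F := esum u i.+1 j.+1.

Lemma cminor_zero_row f s t z : (forall j, (j < z.+1)%N -> f s (t + j)%N = 0) -> cminor f s t z.+1 = 0 :> F.
Proof.
move=> f0; rewrite /cminor (expand_det_row _ ord0) big1 // => j _.
by rewrite mxE addn0 f0 ?mul0r.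
Qed.

Lemma cminor_zero_col f s t z : (forall i, (i < z.+1)%N -> f (s + i)%N t = 0) -> cminor f s t z.+1 = 0 :> F.
Proof.
move=> f0; rewrite /cminor (expand_det_col _ ord0) big1 // => j _.
by rewrite mxE addn0 f0 ?mul0r.
Qed.

Lemma cminor_esum y z a : (0 < y + a)%N ->
  cminor esum0 (y + 2 * a).-1 (y + a).-1 z = zprod y z a.
Proof.
elim/ltn_ind: z y a => [[|[|z]]] IH y a ya.
- by rewrite cminor0 /zprod big_ord0.
- rewrite cminor1 /zprod big_ord1 zratio_z0 /esum0 !prednK; [|lia|lia].
  by rewrite -(esumE int_inj generic); [congr (esum _ _ _); lia | lia].
have D0 : cross_den y z.+1 a != 0 by apply: cross_den_neq0; lia.
have E1 : cminor esum0 (y + 2 * a).-1.+1 (y + a).-1.+1 z = zprod y.+1 z a.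
  by rewrite -IH; [congr (cminor _ _ _ _); lia | lia | lia].
have E2 : cminor esum0 (y + 2 * a).-1.+1 (y + a).-1.+1 z.+1 = zprod y.+1 z.+1 a.
  by rewrite -IH; [congr (cminor _ _ _ _); lia | lia | lia].
have N0 : cminor esum0 (y + 2 * a).-1.+1 (y + a).-1.+1 z != 0 by rewrite E1 zprod_neq0.
have := desnanot_jacobi N0; rewrite E1 E2 (IH z.+1) //.
(* Moving the window down by one row turns [(y, a)] into [(y - 1, a + 1)]; moving it right by one
   column turns it into [(y + 2, a - 1)]. For [y = 0] or [a = 0] one of these pairs does not exist,
   but then a column or a row of the corresponding window is zero, and so is [cross_num]. *)
have X : cminor esum0 (y + 2 * a).-1.+1 (y + a).-1 z.+1 * cminor esum0 (y + 2 * a).-1 (y + a).-1.+1 z.+1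
   * cross_den y z.+1 a = cross_num y z.+1 a * (zprod y z.+1 a * zprod y.+1 z.+1 a).
  case: y ya D0 {E1 E2 N0} => [|y] ya D0.
    rewrite (cminor_zero_col (t := _.-1)); last first.
      by move=> i _; apply: esum_above; lia.
    by rewrite /cross_num mulr0 !mul0r.
  case: a ya D0 => [|a] ya D0.
    rewrite [X in _ * X * _]cminor_zero_row; last first.
      by move=> j _; apply: (esum_below int_inj generic); lia.
    by rewrite /cross_num mulr0 !mul0r.
  rewrite -zprod_cross -!IH //; try lia.
  by congr (cminor _ _ _ _ * cminor _ _ _ _ * _); lia.
have := zprod_condense z ya; move: X D0.
set m := cminor _ _ _ z.+2.
move=> X D0 C E; apply: (mulIf D0); apply: (mulIf (zprod_neq0 y.+1 z a)).
transitivity (m * zprod y.+1 z a * cross_den y z.+1 a); first by ring.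
rewrite E mulrBl X [in RHS]mulrAC C; ring.
Qed.

End Minors.

(* Row indices, counted from 1, of the up triangles left on the northeastern side. *)
Definition row_index (y a i : nat) : nat := if (i.+1 < y + a)%N then i.+1 else (i.+1 + a)%N.

Definition path_mx (R : comUnitRingType) (u : R) (y z a : nat) : 'M[R]_((y + z + a).-1) :=
  \matrix_(i, j) ent u (row_index y a i) j.+1.

(** * Evaluation of the path determinant *)

Section PathDeterminant.
Variables (F : fieldType) (u : F).
Hypothesis int_inj : forall c : int, c != 0 -> c%:~R != 0 :> F.
Hypothesis generic : forall c : int, 2%:R * u + c%:~R != 0.

Definition lead (n : nat) : F := \prod_(j < n) sig u j.+1 j.+1.

(** The operation is right multiplication by the unitriangular matrix of the coefficients [elim]. It
    mixes columns only, so it works for any choice [r] of rows. *)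
Lemma det_path_elim N (r : nat -> nat) :
  \det (\matrix_(i < N, j < N) ent u (r i) j.+1) = \det (\matrix_(i < N, j < N) esum u (r i) j.+1).
Proof.
pose V : 'M[F]_N := \matrix_(k, j) if (k <= j)%N then elim u j.+1 k.+1 else 0.
have dV : \det V = 1.
  rewrite -det_tr det_trig; first by rewrite big1 // => i _; rewrite !mxE leqnn elim_diag.
  by apply/is_trig_mxP => i j ij; rewrite !mxE leqNgt ij.
rewrite -[LHS]mulr1 -dV -det_mulmx; congr (\det _); apply/matrixP=> i j; rewrite !mxE /esum.
rewrite big_add1 /= big_mkord (big_ord_widen _ (fun k => ent u (r i) k.+1 * elim u j.+1 k.+1) (ltn_ord j)).
rewrite [RHS]big_mkcond /=; apply: eq_bigr => k _; rewrite !mxE ltnS.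
by case: ifP => //; rewrite mulr0.
Qed.

Lemma det_path y z a : (0 < y + a)%N ->
  \det (path_mx u y z a) = lead (y + a).-1 * zprod u y z a.
Proof.
move=> ya; rewrite /path_mx (det_path_elim _ (row_index y a)).
rewrite (_ : (y + z + a).-1 = ((y + a).-1 + z)%N); last by lia.
set m := (y + a).-1; set M := \matrix_(_, _) _.
(* The first [y + a - 1] rows keep their indices, and there [esum] vanishes right of the
   diagonal. *)
have ur0 : ursubmx M = 0.
  apply/matrixP=> i j; rewrite !mxE /= /row_index ifT; last by have := ltn_ord i; rewrite /m; lia.
  by apply: (esum_below int_inj generic); have := ltn_ord i; lia.
rewrite -[M]submxK ur0 det_lblock; congr (_ * _).
  rewrite det_trig.
    apply: eq_bigr => i _; rewrite !mxE /= /row_index ifT; last by have := ltn_ord i; rewrite /m; lia.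
    by rewrite -(esumE int_inj generic); [congr (esum _ _ _); lia | lia].
  apply/is_trig_mxP => i j ij; rewrite !mxE /= /row_index ifT; last by have := ltn_ord i; rewrite /m; lia.
  by apply: (esum_below int_inj generic); lia.
(* The other rows have their index raised by [a]: counted from 1, their window starts at row
   [y + 2a] and column [y + a]. *)
rewrite -(cminor_esum int_inj generic) //; congr (\det _); apply/matrixP=> i j; rewrite !mxE /=.
rewrite /row_index ifF; last by apply/negbTE; rewrite /m; lia.
by rewrite /esum0; congr (esum _ _ _); rewrite /m; lia.
Qed.

(** For [y = a = 0] no row index is skipped and the matrix depends on [y + z] only; exchanging [y]
    and [z] brings it within the reach of [det_path]. *)
Lemma det_path00 z : \det (path_mx u 0 z 0) = lead z.-1.
Proof.
case: z => [|z]; first by rewrite /lead big_ord0 det_mx00.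
rewrite /path_mx (_ : (0 + z.+1 + 0).-1 = (z.+1 + 0 + 0).-1); last by lia.
transitivity (\det (path_mx u z.+1 0 0)); last first.
  by rewrite det_path // /zprod big_ord0 mulr1 addn0.
congr (\det _); apply/matrixP=> i j; rewrite !mxE /row_index /= !addn0.
by congr (ent _ _ _); case: ifP.
Qed.

End PathDeterminant.

(** * The product formula *)

Section ProdZ.
Variable F : fieldType.
Implicit Types f g : int -> F.

Lemma prodz_nat (n : nat) f : prodz n%:Z f = \prod_(i < n) f i.+1%:Z.
Proof. by []. Qed.

Lemma eq_prodz (n : int) f g : (forall i : nat, (0 < i)%N -> (i%:Z <= n)%R -> f i = g i) -> prodz n f = prodz n g.
Proof.
case: (intP n) => [|m|m] E.
- by rewrite /prodz !big_ord0.
- by apply: eq_bigr => i _; apply: E => //; have /= := ltn_ord i; lia.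
- by rewrite /prodz !big_ord0.
Qed.

Lemma prodz_le0 (n : int) f : (n <= 0)%R -> prodz n f = 1.
Proof. by case: (intP n) => [|m|m] //; rewrite /prodz big_ord0. Qed.

Lemma prodzS (n : nat) f : prodz (n%:Z + 1) f = prodz n f * f (n%:Z + 1).
Proof.
rewrite (_ : n%:Z + 1 = n.+1%:Z); last by lia.
by rewrite !prodz_nat big_ord_recr.
Qed.

Lemma prodz_add (m n : nat) f : prodz (m%:Z + n%:Z) f = prodz m f * prodz n (fun i => f (m%:Z + i)).
Proof.
rewrite -PoszD !prodz_nat big_split_ord /=; congr (_ * _).
by apply: eq_bigr => i _; rewrite -addnS.
Qed.

Lemma prodzM (n : int) f g : prodz n (fun i => f i * g i) = prodz n f * prodz n g.
Proof. by rewrite /prodz big_split. Qed.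

Lemma prodz_cst (n : nat) (c : F) : prodz n (fun=> c) = c ^+ n.
Proof. by rewrite prodz_nat prodr_const card_ord. Qed.

Lemma prodz_neq0 n f : (forall i, f i != 0) -> prodz n f != 0.
Proof. by move=> f0; apply/prodf_neq0 => i _. Qed.

Lemma fl_half (n : nat) : fl n%:Z 2 = (n./2)%:Z.
Proof. by rewrite /fl divz_nat divn2. Qed.

Lemma fl_half1 (n : nat) : fl (n%:Z + 1) 2 = (uphalf n)%:Z.
Proof. by rewrite (_ : n%:Z + 1 = n.+1%:Z) ?fl_half //; lia. Qed.

(** The formula has separate products of lengths [uphalf a] and [a./2]; they are the factors of odd
    and of even index of one product of length [a]. *)
Lemma prodz_merge (a : nat) f :
  prodz (uphalf a) (fun i => f (2 * i - 1)) * prodz a./2 (fun i => f (2 * i)) = prodz a f.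
Proof.
elim: a => [|a IH]; first by rewrite /prodz !big_ord0 mulr1.
rewrite (_ : a.+1%:Z = a%:Z + 1) ?prodzS -?IH //; last by lia.
have -> : (uphalf a.+1 = a./2.+1)%N by [].
have -> : (a.+1)./2 = uphalf a by [].
case: (boolP (odd a)) => oa; last first.
  have -> : uphalf a = a./2 by rewrite uphalf_half (negPf oa).
  rewrite (_ : a./2.+1%:Z = a./2%:Z + 1) ?prodzS; last by lia.
  rewrite -mulrA [_ * prodz _ _]mulrC mulrA; congr (_ * f _).
  by have := odd_double_half a; rewrite (negPf oa); lia.
have -> : uphalf a = a./2.+1 by rewrite uphalf_half oa.
rewrite (_ : a./2.+1%:Z = a./2%:Z + 1) ?prodzS; last by lia.
rewrite -!mulrA; congr (_ * (_ * (_ * f _))).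
by have := odd_double_half a; rewrite oa; lia.
Qed.

Lemma prodz_telescope (a : nat) (h : int -> F) : (forall i : nat, (i <= a)%N -> h i != 0) ->
  prodz a (fun i => h i / h (i - 1)) = h a / h 0.
Proof.
elim: a => [|a IH] h0; first by rewrite /prodz big_ord0 divff // h0.
rewrite (_ : a.+1%:Z = a%:Z + 1) ?prodzS ?IH; [|by move=> i ia; apply: h0; lia|lia].
rewrite addrK mulrC mulrA mulfVK //; exact: h0.
Qed.

End ProdZ.

(** * Pochhammer symbols as gamma quotients *)

Section Gamma.
Variables (F : fieldType) (u : F).
Hypothesis int_inj : forall c : int, c != 0 -> c%:~R != 0 :> F.
Hypothesis generic : forall c : int, 2%:R * u + c%:~R != 0.
Local Notation gu := (gu u).
Local Notation guS := (guS generic).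
Local Notation gu0 := (gu_neq0 generic).
Local Notation g1 := (g1 u).
Local Notation g1S := (g1S generic).
Local Notation g1_0 := (g1_neq0 generic).
Local Notation go := (go u).
Local Notation goS := (goS generic).
Local Notation go0 := (go_neq0 generic).

Lemma pochD (v : F) (m n : int) : (forall c : int, v + c%:~R != 0) ->
  poch (v + m%:~R) n = poch v (m + n) / poch v m.
Proof.
move=> nz; have nz' c : v + m%:~R + c%:~R != 0 by rewrite -addrA -intrD.
have p0 := poch_neq0 m nz.
elim/int_S_ind: n => [|n IH|n]; first by rewrite poch0 addr0 divff.
  by rewrite pochS // IH addrA pochS // -addrA -intrD mulrAC.
rewrite addrA !pochS // -addrA -intrD => E.
by apply: (mulIf (nz (m + n))); rewrite E mulrAC.
Qed.

Lemma poch_gu (c m : int) : poch (u + c%:~R) m = gu (c + m) / gu c.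
Proof. exact/pochD/generic1. Qed.

Lemma poch_g1 (c m : int) : poch (2%:R * u + c%:~R) m = g1 (c + m) / g1 c.
Proof. exact/pochD. Qed.

Lemma spoch_go (c m : int) : spoch (2%:R * u + (2 * c + 1)%:~R) m = go (c + m) / go c.
Proof.
have nz (d : int) : 2 * u + (2 * c + 1)%:~R + d%:~R != 0 by rewrite -addrA -intrD.
have p0 := go0 c.
have e n : 2 * u + (2 * c + 1)%:~R + (2 * n)%:~R = 2 * u + (2 * (c + n) + 1)%:~R by ring.
elim/int_S_ind: m => [|n IH|n]; first by rewrite spoch0 addr0 divff.
  by rewrite spochS // IH addrA goS e mulrAC.
rewrite addrA goS spochS // e => E.
by apply: (mulIf (generic (2 * (c + n) + 1))); rewrite E mulrAC.
Qed.

(** Legendre's duplication formula. *)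
Lemma g1_double (m : nat) : g1 (2 * m%:Z) = 2%:R ^+ m * gu m * go m.
Proof.
elim: m => [|m IH]; first by rewrite /g1 /gu /go mulr0 !poch0 spoch0 !mulr1.
have -> : 2 * m.+1%:Z = 2 * m%:Z + 1 + 1 by lia.
rewrite (_ : m.+1%:Z = m%:Z + 1); last by lia.
by rewrite guS goS !g1S IH exprSr; ring.
Qed.

(** This ties the factors of the product formula to the diagonal entries of the triangularized
    matrix. *)
Lemma cfac_sig (n : nat) : 1 / 2%:R * (cfac u n * (u + (3 * n%:Z - 1)%:~R)) = sig u n n.
Proof.
have n2 : (2%:R : F) != 0 by apply: (natr_neq0 int_inj).
rewrite /cfac /facratio /ifac /= !poch_gu !poch_g1 /sig.
have -> : 2 * n%:Z - 1 + 1 = 2 * n%:Z by lia.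
have -> : 2 * n%:Z + (n%:Z - 2 - (2 * n%:Z - 1)) = n%:Z - 1 by lia.
have -> : 3 * n%:Z = 3 * n%:Z - 1 + 1 by lia.
have -> : 3 * n%:Z - 1 + 1 - n%:Z = 2 * n%:Z by lia.
have -> : 3 * n%:Z - 1 + 1 - 1 = 3 * n%:Z - 1 by lia.
have -> : 2 * n%:Z - 1 + n%:Z = 3 * n%:Z - 1 by lia.
have -> : 2 * n%:Z - n%:Z - 1 = n%:Z - 1 by lia.
have -> : 2 * n%:Z - 2 + n%:Z = 3 * n%:Z - 2 by lia.
have -> : 4 * n%:Z - n%:Z - 2 = 3 * n%:Z - 2 by lia.
have -> : 4 * n%:Z - 2 * n%:Z - 2 = 2 * n%:Z - 2 by lia.
rewrite guS ffactnn.
have -> : (absz (2 * n%:Z)%R)`! = ((2 * n) ^_ n * n`!)%N.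
  have -> : absz (2 * n%:Z)%R = (2 * n)%N by rewrite abszM.
  have h : (n <= 2 * n)%N by lia.
  by rewrite -(ffact_fact h) (_ : (2 * n - n = n)%N) //; lia.
rewrite !natrM.
have f1 := fact0F int_inj n.
have f2 : ((2 * n) ^_ n)%:R != 0 :> F by apply: (natr_neq0 int_inj); rewrite ffact_gt0; lia.
have h1 := gu0 (2 * n%:Z); have h2 := gu0 (2 * n%:Z - 1); have h3 := g1_0 (2 * n%:Z - 2).
move: (gu (2 * n%:Z)) (gu (2 * n%:Z - 1)) (g1 (2 * n%:Z - 2)) h1 h2 h3 => a b c h1 h2 h3.
by field; nonzero.
Qed.

Definition odd_fact (q : nat) : F := \prod_(j < q) (2 * j + 1)%:R.

Lemma odd_factS q : odd_fact q.+1 = odd_fact q * (2 * q + 1)%:R.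
Proof. by rewrite /odd_fact big_ord_recr. Qed.

Lemma odd_fact_neq0 q : odd_fact q != 0.
Proof. by apply/prodf_neq0 => j _; apply: (natr_neq0 int_inj); rewrite addn1. Qed.

Lemma poch_nat (p q : nat) : poch (p.+1%:R : F) (q%:Z - p%:Z) = (q`!)%:R / (p`!)%:R.
Proof.
have f0 := fact0F int_inj.
case: (leqP p q) => pq.
  rewrite -(subnKC pq); move: (q - p)%N => {pq} d.
  have -> : (p + d)%:Z - p%:Z = d%:Z by lia.
  rewrite -[LHS]/(\prod_(j < d) (p.+1%:R + j%:R)).
  elim: d => [|d IH]; first by rewrite big_ord0 addn0 divff.
  by rewrite big_ord_recr /= IH addnS factS natrM mulrAC -natrD addSn [_`!%:R * _]mulrC.
rewrite -(subnKC (ltnW pq)); move: (p - q)%N => {pq} d.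
have -> : q%:Z - (q + d)%:Z = - d%:Z by lia.
rewrite pochN; suff -> : \prod_(j < d) ((q + d).+1%:R - j.+1%:R) = ((q + d)`!)%:R / (q`!)%:R :> F.
  by rewrite invf_div.
elim: d => [|d IH]; first by rewrite big_ord0 addn0 divff.
rewrite big_ord_recl addnS factS natrM -mulrA -IH; congr (_ * _).
  by rewrite -natrB // subn1.
apply: eq_bigr => j _; rewrite lift0 -!natrB //; have := ltn_ord j; lia.
Qed.

Lemma spoch_nat (p q : nat) : spoch ((2 * p + 1)%:R : F) (q%:Z - p%:Z) = odd_fact q / odd_fact p.
Proof.
have f0 := odd_fact_neq0.
case: (leqP p q) => pq.
  rewrite -(subnKC pq); move: (q - p)%N => {pq} d.
  have -> : (p + d)%:Z - p%:Z = d%:Z by lia.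
  rewrite -[LHS]/(\prod_(j < d) ((2 * p + 1)%:R + (2 * j)%:R)).
  elim: d => [|d IH]; first by rewrite big_ord0 addn0 divff.
  by rewrite big_ord_recr /= IH (addnS p d) odd_factS mulrAC -natrD; congr (_ * _%:R / _); lia.
rewrite -(subnKC (ltnW pq)); move: (p - q)%N => {pq} d.
have -> : q%:Z - (q + d)%:Z = - d%:Z by lia.
rewrite spochN; suff -> : \prod_(j < d) ((2 * (q + d) + 1)%:R - (2 * j.+1)%:R) = odd_fact (q + d) / odd_fact q :> F.
  by rewrite invf_div.
elim: d => [|d IH]; first by rewrite big_ord0 addn0 divff.
rewrite big_ord_recl (addnS q d) odd_factS [_ * _%:R]mulrC -mulrA -IH; congr (_ * _).
  by rewrite /= -natrB; [congr (_%:R); lia | lia].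
by apply: eq_bigr => j _; rewrite lift0 -!natrB; [congr (_%:R); lia | have := ltn_ord j; lia..].
Qed.

End Gamma.

(** * Dependence of the mixed factors on [z] *)

Section ZStep.
Variables (F : fieldType) (u : F).
Hypothesis int_inj : forall c : int, c != 0 -> c%:~R != 0 :> F.
Hypothesis generic : forall c : int, 2%:R * u + c%:~R != 0.
Local Notation gu := (gu u).
Local Notation guS := (guS generic).
Local Notation gu0 := (gu_neq0 generic).
Local Notation go := (go u).
Local Notation goS := (goS generic).
Local Notation go0 := (go_neq0 generic).
Local Notation L p := (2%:R * u + p%:~R).

(* The shape of the factors of E_3 that mix a skipped and an ordinary Pochhammer symbol; raising
   [z] by one multiplies it by [rho P R] up to a power of 2, and [hterm_top], [hterm_bot] are the
   two ways this happens, depending on the parity of [z] and of the factor. *)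
Definition hterm (c d l l' : int) : F := spoch (L (2 * c + 1)) l * poch (u + d%:~R) l'.

Definition rho (P R : int) : F := L P * L (P + 1) * L (P + 2) / (L R * L (R + 1)).

Lemma half_lin (c : int) : u + c%:~R = L (2 * c) / 2%:R.
Proof.
have n2 : (2%:R : F) != 0 by apply: (natr_neq0 int_inj).
by rewrite intrM; field.
Qed.

(** The alternatives are the shapes that occur for even [y] ([d = c]) and for odd [y] ([d = c + 1]);
    in both, the two initial factors are consecutive linear forms in [2u]. *)
Lemma rho_den (c d R : int) : (R = 2 * c /\ d = c \/ R = 2 * c + 1 /\ d = c + 1) ->
  L (2 * c + 1) * (u + d%:~R) = L R * L (R + 1) / 2%:R.
Proof.
case=> [[-> ->]|[-> ->]]; rewrite half_lin ?mulrA.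
  by rewrite [_ * L (2 * c)]mulrC.
by congr (_ * L _ / _); lia.
Qed.

Lemma hterm_top (c d l l' P R : int) : P = 2 * (c + l) -> d + l' = c + l ->
  (R = 2 * c /\ d = c \/ R = 2 * c + 1 /\ d = c + 1) ->
  hterm (c + 1) (d + 1) l (l' + 1) = hterm c d l l' * (2%:R^-1 * rho P R).
Proof.
have n2 : (2%:R : F) != 0 by apply: (natr_neq0 int_inj).
move=> eP ed eR; rewrite /hterm !(spoch_go generic) !(poch_gu generic) /rho.
have -> : c + 1 + l = c + l + 1 by lia.
have -> : d + 1 + (l' + 1) = c + l + 1 + 1 by lia.
rewrite ed !goS !guS.
have -> : L (2 * (c + l) + 1) = L (P + 1) by rewrite eP.
have -> : u + (c + l)%:~R = L P / 2 by rewrite half_lin eP.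
have -> : u + (c + l + 1)%:~R = L (P + 2) / 2 by rewrite half_lin eP; congr (L _ / 2); lia.
have e := rho_den eR.
have -> : L R * L (R + 1) = 2 * (L (2 * c + 1) * (u + d%:~R)) by rewrite e; field.
have h1 := generic (2 * c + 1); have h2 := generic1 generic d.
have h3 := go0 c; have h4 := gu0 d.
move: (L (2 * c + 1)) (u + d%:~R) (go c) (gu d) (go (c + l)) (gu (c + l)) (L P) (L (P + 1)) (L (P + 2)) h1 h2 h3 h4.
by move=> *; field; nonzero.
Qed.

Lemma hterm_bot (c d l l' P R : int) : P = 2 * (c + l) + 1 -> d + l' = c + l + 1 ->
  (R = 2 * c /\ d = c \/ R = 2 * c + 1 /\ d = c + 1) ->
  hterm (c + 1) (d + 1) (l + 1) l' = hterm c d l l' * rho P R.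
Proof.
have n2 : (2%:R : F) != 0 by apply: (natr_neq0 int_inj).
move=> eP ed eR; rewrite /hterm !(spoch_go generic) !(poch_gu generic) /rho.
have -> : c + 1 + (l + 1) = c + l + 1 + 1 by lia.
have -> : d + 1 + l' = c + l + 1 + 1 by lia.
rewrite ed !goS (guS (c + l + 1)) (guS d).
have -> : L (2 * (c + l) + 1) = L P by rewrite eP.
have -> : L (2 * (c + l + 1) + 1) = L (P + 2) by rewrite eP; congr (L _); lia.
have -> : u + (c + l + 1)%:~R = L (P + 1) / 2 by rewrite half_lin eP; congr (L _ / 2); lia.
have e := rho_den eR.
have -> : L R * L (R + 1) = 2 * (L (2 * c + 1) * (u + d%:~R)) by rewrite e; field.
have h1 := generic (2 * c + 1); have h2 := generic1 generic d.
have h3 := go0 c; have h4 := gu0 d.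
move: (L (2 * c + 1)) (u + d%:~R) (go c) (gu d) (go (c + l)) (gu (c + l + 1)) (L P) (L (P + 1)) (L (P + 2)) h1 h2 h3 h4.
by move=> *; field; nonzero.
Qed.

(** Uniform in all parities: index [j = 2i - 1] belongs to the factor [i] of the product of length
    [uphalf a], and [j = 2i] to that of the product of length [a./2]. *)
Definition rhoj (y z a : nat) (j : int) : F :=
  rho (3 * y%:Z + 3 * z%:Z + 6 * a%:Z - 3 * j - 1) (3 * y%:Z + 2 * z%:Z + 4 * a%:Z + 2 * j - 4).

Definition evenH (k z a : nat) : F :=
  (2%:R : F) ^ ((uphalf a * uphalf z + a./2 * z./2)%:Z - a%:Z - z%:Z - 2 * k%:Z + 1)
  * prodz (uphalf a) (fun i => let c := 3 * k%:Z + z%:Z + 2 * a%:Z + 2 * i - 3 in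
      hterm c c (z./2%:Z + a%:Z - 5 * i + 4) ((uphalf z)%:Z + a%:Z - 5 * i + 4))
  * prodz a./2 (fun i => let c := 3 * k%:Z + z%:Z + 2 * a%:Z + 2 * i - 2 in
      hterm c c ((uphalf z)%:Z + a%:Z - 5 * i + 1) (z./2%:Z + a%:Z - 5 * i + 2)).

Definition oddH (k z a : nat) : F :=
  (2%:R : F) ^ ((a./2 * uphalf z + uphalf a * z./2)%:Z - a%:Z - z%:Z - 2 * k%:Z)
  * prodz (uphalf a) (fun i => let c := 3 * k%:Z + z%:Z + 2 * a%:Z + 2 * i - 2 in
      hterm c (c + 1) ((uphalf z)%:Z + a%:Z - 5 * i + 4) (z./2%:Z + a%:Z - 5 * i + 4))
  * prodz a./2 (fun i => let c := 3 * k%:Z + z%:Z + 2 * a%:Z + 2 * i - 1 in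
      hterm c (c + 1) (z./2%:Z + a%:Z - 5 * i + 2) ((uphalf z)%:Z + a%:Z - 5 * i + 1)).

Lemma two_pow (m : int) (n : nat) : (2%:R : F) ^ (m + n%:Z) = 2%:R ^ m * 2%:R ^+ n.
Proof. by rewrite expfzDr //; apply: (natr_neq0 int_inj). Qed.

Lemma half_sum (a : nat) : (uphalf a + a./2 = a)%N.
Proof. by rewrite uphalf_half -addnA addnn odd_double_half. Qed.

(** Exactly one of the two products gains a factor 1/2 per term, and [b] says which. The explicit
    power of 2 grows by the number of these terms, less one, so that a single 1/2 survives whatever
    the parity. *)
Lemma prod_step (f f' g g' r : int -> F) (e e' : int) (a : nat) (b : bool) :
  (forall i : nat, f' i = f i * ((if b then 1 else 2%:R^-1) * r (2 * i%:Z - 1))) ->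
  (forall i : nat, g' i = g i * ((if b then 2%:R^-1 else 1) * r (2 * i%:Z))) ->
  e' = e - 1 + (if b then a./2 else uphalf a)%:Z ->
  2%:R ^ e' * prodz (uphalf a) f' * prodz a./2 g' =
  2%:R ^ e * prodz (uphalf a) f * prodz a./2 g * (2%:R^-1 * prodz a r).
Proof.
have n2 : (2%:R : F) != 0 by apply: (natr_neq0 int_inj).
move=> ef eg ->; rewrite two_pow expfzDr // -(prodz_merge a r).
rewrite (eq_prodz (f := f') (g := fun i => f i * ((if b then 1 else 2^-1) * r (2 * i - 1)))); last by move=> i _ _; apply: ef.
rewrite (eq_prodz (f := g') (g := fun i => g i * ((if b then 2^-1 else 1) * r (2 * i)))); last by move=> i _ _; apply: eg.
rewrite !prodzM !prodz_cst.
have -> : 2 ^ (- 1%:Z) = 2^-1 :> F by [].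
have := expf_neq0 (if b then a./2 else uphalf a) n2.
by case: b {ef eg}; rewrite expr1n exprVn; move: (2 ^+ _) => t t0; field; nonzero.
Qed.

Lemma evenH_step k z a : evenH k z.+1 a = evenH k z a * (2%:R^-1 * prodz a (rhoj (2 * k) z a)).
Proof.
have ea := half_sum a; have ez := half_sum z; have oz := uphalf_half z.
have eS : (z.+1)./2 = uphalf z by [].
rewrite /evenH eS [uphalf z.+1]/=.
apply: (prod_step (b := odd z)) => [i|i|].
- rewrite /rhoj; case: (odd z) oz => /= oz; rewrite ?mul1r.
    by rewrite -(hterm_bot _ _ (or_introl (conj _ _))); [congr hterm; lia | lia..].
  by rewrite -(hterm_top _ _ (or_introl (conj _ _))); [congr hterm; lia | lia..].
- rewrite /rhoj; case: (odd z) oz => /= oz; rewrite ?mul1r.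
    by rewrite -(hterm_top _ _ (or_introl (conj _ _))); [congr hterm; lia | lia..].
  by rewrite -(hterm_bot _ _ (or_introl (conj _ _))); [congr hterm; lia | lia..].
- case: (odd z) oz => /= oz; nia.
Qed.

Lemma oddH_step k z a : oddH k z.+1 a = oddH k z a * (2%:R^-1 * prodz a (rhoj (2 * k).+1 z a)).
Proof.
have ea := half_sum a; have ez := half_sum z; have oz := uphalf_half z.
have eS : (z.+1)./2 = uphalf z by [].
rewrite /oddH eS [uphalf z.+1]/=.
apply: (prod_step (b := ~~ odd z)) => [i|i|].
- rewrite /rhoj; case: (odd z) oz => /= oz; rewrite ?mul1r.
    by rewrite -(hterm_top _ _ (or_intror (conj _ _))); [congr hterm; lia | lia..].
  by rewrite -(hterm_bot _ _ (or_intror (conj _ _))); [congr hterm; lia | lia..].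
- rewrite /rhoj; case: (odd z) oz => /= oz; rewrite ?mul1r.
    by rewrite -(hterm_bot _ _ (or_intror (conj _ _))); [congr hterm; lia | lia..].
  by rewrite -(hterm_top _ _ (or_intror (conj _ _))); [congr hterm; lia | lia..].
- case: (odd z) oz => /= oz; nia.
Qed.
End ZStep.

(** * The last product of E_3 *)

Section LastProduct.
Variables (F : fieldType) (u : F).
Hypothesis int_inj : forall c : int, c != 0 -> c%:~R != 0 :> F.
Hypothesis generic : forall c : int, 2%:R * u + c%:~R != 0.
Local Notation gu := (gu u).
Local Notation gu0 := (gu_neq0 generic).
Local Notation g1 := (g1 u).
Local Notation g1S := (g1S generic).
Local Notation g1_0 := (g1_neq0 generic).
Local Notation go := (go u).
Local Notation go0 := (go_neq0 generic).
Local Notation L p := (2%:R * u + p%:~R).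

Lemma odd_fact_fact q : odd_fact F q * (q`!)%:R = ((2 * q)`!)%:R / 2%:R ^+ q.
Proof.
have n2 : (2%:R : F) != 0 by apply: (natr_neq0 int_inj).
elim: q => [|q IH]; first by rewrite /odd_fact big_ord0 mul1r expr0 divr1.
rewrite (_ : (2 * q.+1 = (2 * q).+2)%N); last by lia.
rewrite odd_factS !factS !natrM exprSr.
have -> : odd_fact F q * (2 * q + 1)%:R * (q.+1%:R * (q`!)%:R) = (odd_fact F q * (q`!)%:R) * ((2 * q + 1)%:R * q.+1%:R) by ring.
rewrite IH; have := expf_neq0 q n2; move: (2 ^+ q) => t t0.
by field; nonzero.
Qed.

(** Together with [odd_fact_fact] this merges a skipped and an ordinary symbol into one factorial,
    [(2q)!] for even [y] and [(2q + 1)!] for odd [y]; hence [lterm] depends on [y] without reference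
    to its parity. *)
Lemma odd_fact_factS q : odd_fact F q.+1 * (q`!)%:R = ((2 * q).+1`!)%:R / 2%:R ^+ q.
Proof.
rewrite odd_factS mulrAC odd_fact_fact [(2 * q).+1`!]factS natrM.
by rewrite addn1; ring.
Qed.

(* The last product of E_3 rewritten as a product over [t]; half of its gamma factors are taken in
   the reverse order, whence [r]. *)
Definition lterm (y z a t : nat) : F :=
  let r := (a - t.+1)%N in let Y := y%:Z in let Z := z%:Z in let A := a%:Z in
  (((y + 2 * (z + r))`!)%:R / 2%:R ^+ (z + r) / ((y + 2 * t)`!)%:R * 2%:R ^+ t) *
  ((t`!)%:R / ((z + r)`!)%:R) * (go (Y + A + t%:Z - 1) / go (Y + Z + A + r%:Z - 1)) *
  (gu (2 * Y + Z + 2 * A + t%:Z - 1) / gu (2 * Y + 2 * Z + 2 * A + r%:Z - 1)).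

Lemma evenL (k z a : nat) :
  prodz a (fun i =>
      spoch ((2 * k%:Z + 2 * i - 1)%:~R : F) (z%:Z + a%:Z - 2 * i + 1) * poch (k%:Z + i)%:~R (z%:Z + a%:Z - 2 * i + 1)
      / (poch i%:~R (z%:Z + a%:Z - 2 * i + 1)
         * spoch (L (4 * k%:Z + 2 * a%:Z + 2 * i - 3)) (z%:Z + a%:Z - 2 * i + 1)
         * poch (u + (4 * k%:Z + z%:Z + 2 * a%:Z + i - 2)%:~R) (z%:Z + a%:Z - 2 * i + 1)))
  = \prod_(t < a) lterm (2 * k) z a t.
Proof.
have n2 : (2%:R : F) != 0 by apply: (natr_neq0 int_inj).
rewrite prodz_nat; apply: eq_bigr => t _; have ta := ltn_ord t; rewrite /lterm.
set r := (a - t.+1)%N.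
(* The length as a difference shows each symbol as a quotient of a value indexed by [z + r] by one
   indexed by [t]. *)
have em : z%:Z + a%:Z - 2 * t.+1%:Z + 1 = (z + r)%N%:Z - t%:Z by rewrite /r; lia.
rewrite em.
rewrite (_ : (2 * k%:Z + 2 * t.+1%:Z - 1)%:~R = (2 * (k + t) + 1)%:R :> F); last by ring.
rewrite (_ : (k%:Z + t.+1%:Z)%:~R = (k + t).+1%:R :> F); last by ring.
rewrite (_ : t.+1%:Z%:~R = t.+1%:R :> F) //.
rewrite (_ : 4 * k%:Z + 2 * a%:Z + 2 * t.+1%:Z - 3 = 2 * ((2 * k)%:Z + a%:Z + t%:Z - 1) + 1); last by lia.
rewrite (_ : 4 * k%:Z + z%:Z + 2 * a%:Z + t.+1%:Z - 2 = 2 * (2 * k)%:Z + z%:Z + 2 * a%:Z + t%:Z - 1); last by lia.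
rewrite (spoch_go generic) (poch_gu generic) poch_nat //.
have -> : (z + r)%:Z - t%:Z = (k + (z + r))%:Z - (k + t)%:Z by lia.
rewrite spoch_nat // poch_nat //.
have -> : (2 * k)%:Z + a%:Z + t%:Z - 1 + ((k + (z + r))%:Z - (k + t)%:Z) = (2 * k)%:Z + z%:Z + a%:Z + r%:Z - 1 by rewrite /r; lia.
have -> : 2 * (2 * k)%:Z + z%:Z + 2 * a%:Z + t%:Z - 1 + ((k + (z + r))%:Z - (k + t)%:Z) = 2 * (2 * k)%:Z + 2 * z%:Z + 2 * a%:Z + r%:Z - 1 by rewrite /r; lia.
have E1 := odd_fact_fact (k + (z + r)); have E2 := odd_fact_fact (k + t).
have -> : (2 * k + 2 * (z + r) = 2 * (k + (z + r)))%N by lia.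
have -> : (2 * k + 2 * t = 2 * (k + t))%N by lia.
move: E1 E2; rewrite !exprD.
have f1 := fact0F int_inj (k + t); have f2 := fact0F int_inj t; have f3 := fact0F int_inj (2 * (k + t)).
have f4 := fact0F int_inj (z + r).
have o1 := odd_fact_neq0 int_inj (k + t).
have t1 := expf_neq0 k n2; have t2 := expf_neq0 t n2; have t3 := expf_neq0 z n2; have t4 := expf_neq0 r n2.
have g1' := go0 ((2 * k)%:Z + a%:Z + t%:Z - 1); have g2' := go0 ((2 * k)%:Z + z%:Z + a%:Z + r%:Z - 1).
have g3' := gu0 (2 * (2 * k)%:Z + z%:Z + 2 * a%:Z + t%:Z - 1); have g4' := gu0 (2 * (2 * k)%:Z + 2 * z%:Z + 2 * a%:Z + r%:Z - 1).
move: (go _) (go _) (gu _) (gu _) g1' g2' g3' g4' => A1 A2 A3 A4 A10 A20 A30 A40.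
move: (2 ^+ k) (2 ^+ t) (2 ^+ z) (2 ^+ r) t1 t2 t3 t4 => T1 T2 T3 T4 T10 T20 T30 T40.
move: ((k + t)`!%:R) (odd_fact F (k + t)) ((2 * (k + t))`!%:R) f1 o1 f3 => B1 B2 B3 B10 B20 B30.
move: ((k + (z + r))`!%:R) (odd_fact F (k + (z + r))) ((2 * (k + (z + r)))`!%:R) => C1 C2 C3 E1 E2.
move: (t`!%:R) ((z + r)`!%:R) f2 f4 => D1 D2 D10 D20.
have -> : C3 = C2 * C1 * (T1 * (T3 * T4)) by rewrite E1; field; nonzero.
have -> : B3 = B2 * B1 * (T1 * T2) by rewrite E2; field; nonzero.
by field; nonzero.
Qed.
Lemma oddL (k z a : nat) :
  prodz a (fun i =>
      spoch ((2 * k%:Z + 2 * i + 1)%:~R : F) (z%:Z + a%:Z - 2 * i + 1) * poch (k%:Z + i)%:~R (z%:Z + a%:Z - 2 * i + 1)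
      / (poch i%:~R (z%:Z + a%:Z - 2 * i + 1)
         * spoch (L (4 * k%:Z + 2 * a%:Z + 2 * i - 1)) (z%:Z + a%:Z - 2 * i + 1)
         * poch (u + (4 * k%:Z + z%:Z + 2 * a%:Z + i)%:~R) (z%:Z + a%:Z - 2 * i + 1)))
  = \prod_(t < a) lterm (2 * k).+1 z a t.
Proof.
have n2 : (2%:R : F) != 0 by apply: (natr_neq0 int_inj).
rewrite prodz_nat; apply: eq_bigr => t _; have ta := ltn_ord t; rewrite /lterm.
set r := (a - t.+1)%N.
have em : z%:Z + a%:Z - 2 * t.+1%:Z + 1 = (z + r)%N%:Z - t%:Z by rewrite /r; lia.
rewrite em.
rewrite (_ : (2 * k%:Z + 2 * t.+1%:Z + 1)%:~R = (2 * (k + t).+1 + 1)%:R :> F); last by ring.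
rewrite (_ : (k%:Z + t.+1%:Z)%:~R = (k + t).+1%:R :> F); last by ring.
rewrite (_ : t.+1%:Z%:~R = t.+1%:R :> F) //.
rewrite (_ : 4 * k%:Z + 2 * a%:Z + 2 * t.+1%:Z - 1 = 2 * ((2 * k).+1%:Z + a%:Z + t%:Z - 1) + 1); last by lia.
rewrite (_ : 4 * k%:Z + z%:Z + 2 * a%:Z + t.+1%:Z = 2 * (2 * k).+1%:Z + z%:Z + 2 * a%:Z + t%:Z - 1); last by lia.
rewrite (spoch_go generic) (poch_gu generic) poch_nat //.
have -> : (z + r)%:Z - t%:Z = (k + (z + r))%:Z - (k + t)%:Z by lia.
rewrite poch_nat //.
have -> : (k + (z + r))%:Z - (k + t)%:Z = (k + (z + r)).+1%:Z - (k + t).+1%:Z by lia.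
rewrite spoch_nat //.
have -> : (2 * k).+1%:Z + a%:Z + t%:Z - 1 + ((k + (z + r)).+1%:Z - (k + t).+1%:Z) = (2 * k).+1%:Z + z%:Z + a%:Z + r%:Z - 1 by rewrite /r; lia.
have -> : 2 * (2 * k).+1%:Z + z%:Z + 2 * a%:Z + t%:Z - 1 + ((k + (z + r)).+1%:Z - (k + t).+1%:Z) = 2 * (2 * k).+1%:Z + 2 * z%:Z + 2 * a%:Z + r%:Z - 1 by rewrite /r; lia.
have E1 := odd_fact_factS (k + (z + r)); have E2 := odd_fact_factS (k + t).
have -> : ((2 * k).+1 + 2 * (z + r) = (2 * (k + (z + r))).+1)%N by lia.
have -> : ((2 * k).+1 + 2 * t = (2 * (k + t)).+1)%N by lia.
move: E1 E2; rewrite !exprD.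
have f1 := fact0F int_inj (k + t); have f2 := fact0F int_inj t; have f3 := fact0F int_inj (2 * (k + t)).+1.
have f4 := fact0F int_inj (z + r).
have o1 := odd_fact_neq0 int_inj (k + t).+1.
have t1 := expf_neq0 k n2; have t2 := expf_neq0 t n2; have t3 := expf_neq0 z n2; have t4 := expf_neq0 r n2.
have g1' := go0 ((2 * k).+1%:Z + a%:Z + t%:Z - 1); have g2' := go0 ((2 * k).+1%:Z + z%:Z + a%:Z + r%:Z - 1).
have g3' := gu0 (2 * (2 * k).+1%:Z + z%:Z + 2 * a%:Z + t%:Z - 1); have g4' := gu0 (2 * (2 * k).+1%:Z + 2 * z%:Z + 2 * a%:Z + r%:Z - 1).
move: (go _) (go _) (gu _) (gu _) g1' g2' g3' g4' => A1 A2 A3 A4 A10 A20 A30 A40.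
move: (2 ^+ k) (2 ^+ t) (2 ^+ z) (2 ^+ r) t1 t2 t3 t4 => T1 T2 T3 T4 T10 T20 T30 T40.
move: ((k + t)`!%:R) (odd_fact F (k + t).+1) ((2 * (k + t)).+1`!%:R) f1 o1 f3 => B1 B2 B3 B10 B20 B30.
move: ((k + (z + r))`!%:R) (odd_fact F (k + (z + r)).+1) ((2 * (k + (z + r))).+1`!%:R) => C1 C2 C3 E1 E2.
move: (t`!%:R) ((z + r)`!%:R) f2 f4 => D1 D2 D10 D20.
have -> : C3 = C2 * C1 * (T1 * (T3 * T4)) by rewrite E1; field; nonzero.
have -> : B3 = B2 * B1 * (T1 * T2) by rewrite E2; field; nonzero.
by field; nonzero.
Qed.

(* Makes the product over [t] of the quotients in [lterm_step] telescope. *)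
Definition tele (y z a t : nat) : F :=
  let s := (a - t)%N in let Y := y%:Z in let Z := z%:Z in let A := a%:Z in let T := t%:Z in
  (g1 (3 * Y + 3 * Z + 6 * A - 1 - 3 * T) * g1 (3 * Y + 2 * Z + 4 * A + 2 * T - 2))^-1 *
  (((z + s)`!)%:R / ((y + 2 * (z + s))`!)%:R) *
  (go (Y + Z + 2 * A - 1 - T) * gu (2 * Y + Z + 2 * A + T - 1) *
   (gu (2 * Y + 2 * Z + 3 * A - T - 1) * gu (2 * Y + 2 * Z + 3 * A - T))).

Lemma tele_neq0 y z a t : tele y z a t != 0.
Proof.
by rewrite /tele !mulf_neq0 ?invr_eq0 ?mulf_neq0 ?g1_0 ?go0 ?gu0 ?(fact0F int_inj).
Qed.

(** Pairing the factor [t] of the last product with the mixed factor [j = t + 1] is what produces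
    quotients of consecutive values of [tele]. *)
Lemma lterm_step (y z a t : nat) : (t < a)%N ->
  lterm y z.+1 a t * rhoj u y z a t.+1 = lterm y z a t * (2%:R^-1 * (tele y z a t.+1 / tele y z a t)).
Proof.
have n2 : (2%:R : F) != 0 by apply: (natr_neq0 int_inj).
move=> ta; rewrite /lterm /tele /rhoj /rho.
have [r er] : exists r, r = (a - t.+1)%N by eexists.
have -> : (a - t = r.+1)%N by lia.
rewrite -er addSn addnS.
have -> : (y + 2 * (z + r).+1 = (y + 2 * (z + r)).+2)%N by lia.
have eA : a%:Z = t%:Z + 1 + r%:Z by lia.
rewrite eA.
have -> : 3 * y%:Z + 3 * z%:Z + 6 * (t%:Z + 1 + r%:Z) - 1 - 3 * t%:Z = 3 * y%:Z + 3 * z%:Z + 6 * r%:Z + 3 * t%:Z + 2 + 1 + 1 + 1 by lia.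
have -> : 3 * y%:Z + 3 * z%:Z + 6 * (t%:Z + 1 + r%:Z) - 1 - 3 * t.+1%:Z = 3 * y%:Z + 3 * z%:Z + 6 * r%:Z + 3 * t%:Z + 2 by lia.
have -> : 3 * y%:Z + 2 * z%:Z + 4 * (t%:Z + 1 + r%:Z) + 2 * t.+1%:Z - 2 = 3 * y%:Z + 2 * z%:Z + 4 * r%:Z + 6 * t%:Z + 2 + 1 + 1 by lia.
have -> : 3 * y%:Z + 2 * z%:Z + 4 * (t%:Z + 1 + r%:Z) + 2 * t%:Z - 2 = 3 * y%:Z + 2 * z%:Z + 4 * r%:Z + 6 * t%:Z + 2 by lia.
have -> : 3 * y%:Z + 3 * z%:Z + 6 * (t%:Z + 1 + r%:Z) - 3 * t.+1%:Z - 1 = 3 * y%:Z + 3 * z%:Z + 6 * r%:Z + 3 * t%:Z + 2 by lia.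
have -> : 3 * y%:Z + 2 * z%:Z + 4 * (t%:Z + 1 + r%:Z) + 2 * t.+1%:Z - 4 = 3 * y%:Z + 2 * z%:Z + 4 * r%:Z + 6 * t%:Z + 2 by lia.
set P := 3 * y%:Z + 3 * z%:Z + 6 * r%:Z + 3 * t%:Z + 2.
set R := 3 * y%:Z + 2 * z%:Z + 4 * r%:Z + 6 * t%:Z + 2.
have -> : y%:Z + z.+1%:Z + (t%:Z + 1 + r%:Z) + r%:Z - 1 = y%:Z + z%:Z + (t%:Z + 1 + r%:Z) + r%:Z - 1 + 1 by lia.
have -> : y%:Z + z%:Z + 2 * (t%:Z + 1 + r%:Z) - 1 - t.+1%:Z = y%:Z + z%:Z + (t%:Z + 1 + r%:Z) + r%:Z - 1 by lia.
have -> : y%:Z + z%:Z + 2 * (t%:Z + 1 + r%:Z) - 1 - t%:Z = y%:Z + z%:Z + (t%:Z + 1 + r%:Z) + r%:Z - 1 + 1 by lia.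
have -> : 2 * y%:Z + z.+1%:Z + 2 * (t%:Z + 1 + r%:Z) + t%:Z - 1 = 2 * y%:Z + z%:Z + 2 * (t%:Z + 1 + r%:Z) + t%:Z - 1 + 1 by lia.
have -> : 2 * y%:Z + z%:Z + 2 * (t%:Z + 1 + r%:Z) + t.+1%:Z - 1 = 2 * y%:Z + z%:Z + 2 * (t%:Z + 1 + r%:Z) + t%:Z - 1 + 1 by lia.
set c := 2 * y%:Z + 2 * z%:Z + 2 * (t%:Z + 1 + r%:Z) + r%:Z - 1.
have -> : 2 * y%:Z + 2 * z.+1%:Z + 2 * (t%:Z + 1 + r%:Z) + r%:Z - 1 = c + 1 + 1 by rewrite /c; lia.
have -> : 2 * y%:Z + 2 * z%:Z + 3 * (t%:Z + 1 + r%:Z) - t.+1%:Z - 1 = c by rewrite /c; lia.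
have -> : 2 * y%:Z + 2 * z%:Z + 3 * (t%:Z + 1 + r%:Z) - t.+1%:Z = c + 1 by rewrite /c; lia.
have -> : 2 * y%:Z + 2 * z%:Z + 3 * (t%:Z + 1 + r%:Z) - t%:Z - 1 = c + 1 by rewrite /c; lia.
have -> : 2 * y%:Z + 2 * z%:Z + 3 * (t%:Z + 1 + r%:Z) - t%:Z = c + 1 + 1 by rewrite /c; lia.
rewrite !g1S (factS (z + r)) exprSr natrM.
have -> : L (P + 2) = L (P + 1 + 1) by congr (L _); lia.
have f1 := fact0F int_inj (z + r); have f2 : (z + r).+1%:R != 0 :> F by apply: (natr_neq0 int_inj).
have f3 := fact0F int_inj (y + 2 * (z + r)); have f4 := fact0F int_inj (y + 2 * t).
have f5 := fact0F int_inj (y + 2 * (z + r)).+2.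
have a1 := g1_0 P; have a2 := g1_0 R; have a3 := generic P; have a4 := generic (P + 1); have a5 := generic (P + 1 + 1).
have a6 := generic R; have a7 := generic (R + 1).
have b1 := go0 (y%:Z + z%:Z + (t%:Z + 1 + r%:Z) + r%:Z - 1).
have b2 := go0 (y%:Z + z%:Z + (t%:Z + 1 + r%:Z) + r%:Z - 1 + 1).
have b3 := gu0 (2 * y%:Z + z%:Z + 2 * (t%:Z + 1 + r%:Z) + t%:Z - 1).
have b4 := gu0 (c + 1); have b5 := gu0 (c + 1 + 1); have b6 := gu0 c.
have p1 := expf_neq0 (z + r) n2.
move: f1 f3 f4 f5 p1.
move: ((z + r)`!%:R) ((y + 2 * (z + r))`!%:R) ((y + 2 * t)`!%:R) ((y + 2 * (z + r)).+2`!%:R) (2 ^+ (z + r)) => F1 F2 F3 F4 T f1 f3 f4 f5 p1.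
move: f2 a1 a2 a3 a4 a5 a6 a7; move: ((z + r).+1%:R) (g1 P) (g1 R) (L P) (L (P + 1)) (L (P + 1 + 1)) (L R) (L (R + 1)).
move=> K G1 G2 x1 x2 x3 x4 x5 f2 a1 a2 a3 a4 a5 a6 a7.
move: b1 b2; move: (go (y%:Z + z%:Z + (t%:Z + 1 + r%:Z) + r%:Z - 1)) (go (y%:Z + z%:Z + (t%:Z + 1 + r%:Z) + r%:Z - 1 + 1)) => H1 H2 b1 b2.
move: b3; move: (gu (2 * y%:Z + z%:Z + 2 * (t%:Z + 1 + r%:Z) + t%:Z - 1)) (gu (2 * y%:Z + z%:Z + 2 * (t%:Z + 1 + r%:Z) + t%:Z - 1 + 1)) => H3 H4 b3.
move: b4 b5 b6; move: (gu (c + 1)) (gu (c + 1 + 1)) (gu c) => H5 H6 H7 b4 b5 b6.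
by field; nonzero.
Qed.
End LastProduct.

(** * The product formula under [z] to [z + 1] *)

Section ZStepE4.
Variables (F : fieldType) (u : F).
Hypothesis int_inj : forall c : int, c != 0 -> c%:~R != 0 :> F.
Hypothesis generic : forall c : int, 2%:R * u + c%:~R != 0.
Local Notation gu0 := (gu_neq0 generic).
Local Notation g1S := (g1S generic).
Local Notation g1_0 := (g1_neq0 generic).
Local Notation go0 := (go_neq0 generic).
Local Notation L p := (2%:R * u + p%:~R).

Lemma prod_telescope (f : nat -> F) n : (forall i, f i != 0) ->
  \prod_(i < n) (f i.+1 / f i) = f n / f 0.
Proof.
move=> f0; elim: n => [|n IH]; first by rewrite big_ord0 divff.
by rewrite big_ord_recr /= IH mulrC mulrA mulfVK.
Qed.

Lemma prod_ltermS y z a :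
  (\prod_(t < a) lterm u y z.+1 a t) * prodz a (rhoj u y z a) =
  (\prod_(t < a) lterm u y z a t) * (2%:R^-1 ^+ a * (tele u y z a a / tele u y z a 0)).
Proof.
have <- : \prod_(t < a) (2^-1 : F) = 2^-1 ^+ a by rewrite prodr_const card_ord.
rewrite -(@prod_telescope (tele u y z a)); last by move=> i; apply: (tele_neq0 int_inj generic).
rewrite prodz_nat -!big_split /=.
by apply: eq_bigr => t _; rewrite (lterm_step int_inj generic) ?ltn_ord.
Qed.

(** The two end values of [tele] supply the gammas of [zratio]. The extra linear factors are those
    of the formula: [numer] has [L (3n - 2)] where [sig] has [u + 3n - 1], and the other factor
    comes from [K]. *)
Lemma zratio_tele y z a (n := (y + z + a)%N) :
  zratio u y z a * L (3 * n%:Z + 3 * a%:Z - 2) =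
  sig u n n * L (3 * n%:Z - 2) * (2%:R^-1 ^+ a * (tele u y z a a / tele u y z a 0)).
Proof.
have n2 : (2%:R : F) != 0 by apply: (natr_neq0 int_inj).
rewrite /zratio /tele -/n subnn subn0 !addn0.
have -> : 3 * y%:Z + 3 * z%:Z + 6 * a%:Z - 1 - 3 * a%:Z = 3 * n%:Z - 2 + 1 by rewrite /n; lia.
have -> : 3 * y%:Z + 2 * z%:Z + 4 * a%:Z + 2 * a%:Z - 2 = 3 * y%:Z + 2 * z%:Z + 6 * a%:Z - 2 by lia.
have -> : 3 * y%:Z + 3 * z%:Z + 6 * a%:Z - 1 - 3 * 0%:Z = 3 * n%:Z + 3 * a%:Z - 2 + 1 by rewrite /n; lia.
have -> : 3 * y%:Z + 2 * z%:Z + 4 * a%:Z + 2 * 0%:Z - 2 = 3 * y%:Z + 2 * z%:Z + 4 * a%:Z - 2 by lia.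
have -> : y%:Z + z%:Z + 2 * a%:Z - 1 - a%:Z = n%:Z - 1 by rewrite /n; lia.
have -> : y%:Z + z%:Z + 2 * a%:Z - 1 - 0%:Z = n%:Z + a%:Z - 1 by rewrite /n; lia.
have -> : 2 * y%:Z + z%:Z + 2 * a%:Z + a%:Z - 1 = 2 * y%:Z + z%:Z + 3 * a%:Z - 1 by lia.
have -> : 2 * y%:Z + z%:Z + 2 * a%:Z + 0%:Z - 1 = 2 * y%:Z + z%:Z + 2 * a%:Z - 1 by lia.
have -> : 2 * y%:Z + 2 * z%:Z + 3 * a%:Z - a%:Z - 1 = 2 * n%:Z - 1 by rewrite /n; lia.
have -> : 2 * y%:Z + 2 * z%:Z + 3 * a%:Z - a%:Z = 2 * n%:Z by rewrite /n; lia.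
have -> : 2 * y%:Z + 2 * z%:Z + 3 * a%:Z - 0%:Z - 1 = 2 * n%:Z + a%:Z - 1 by rewrite /n; lia.
have -> : 2 * y%:Z + 2 * z%:Z + 3 * a%:Z - 0%:Z = 2 * n%:Z + a%:Z by rewrite /n; lia.
have -> : (y + 2 * (z + a) = y + 2 * z + 2 * a)%N by lia.
rewrite !g1S !natrM.
have f1 := fact0F int_inj (z + a); have f2 := fact0F int_inj (y + 2 * z).
have f3 := fact0F int_inj (y + 2 * z + 2 * a); have f4 := fact0F int_inj z.
have a1 := g1_0 (3 * n%:Z - 2); have a2 := g1_0 (3 * n%:Z + 3 * a%:Z - 2).
have a3 := g1_0 (3 * y%:Z + 2 * z%:Z + 6 * a%:Z - 2); have a4 := g1_0 (3 * y%:Z + 2 * z%:Z + 4 * a%:Z - 2).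
have b1 := gu0 (2 * y%:Z + z%:Z + 2 * a%:Z - 1); have b2 := gu0 (2 * n%:Z + a%:Z - 1); have b3 := gu0 (2 * n%:Z + a%:Z).
have b4 := go0 (n%:Z + a%:Z - 1).
have l1 := generic (3 * n%:Z - 2); have l2 := generic (3 * n%:Z + 3 * a%:Z - 2).
have t1 := expf_neq0 a n2; rewrite exprVn.
move: f1 f2 f3; move: ((z + a)`!%:R) ((y + 2 * z)`!%:R) ((y + 2 * z + 2 * a)`!%:R) => F1 F2 F3 f1 f2 f3.
move: l1 l2; move: (L (3 * n%:Z - 2)) (L (3 * n%:Z + 3 * a%:Z - 2)) => L1 L2 l1 l2.
by field; nonzero.
Qed.

(** The products free of [z]: they cancel in the step in [z] and matter only at [z = 0]. *)
Definition evenF (k a : int) : F :=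
  prodz (cl (a - 1) 3) (fun i => spoch (L (6 * k + 2 * fF (a + i - 1) - 1)) (fF (a - 3 * i + 2) - 1)) *
  prodz (cl (a - 2) 3) (fun i => poch (u + (3 * k + fF (a + i - 2) + 1)%:~R) (fF (a - 3 * i + 1) - 1)).

Definition oddF (k a : int) : F :=
  prodz (cl (a - 2) 3) (fun i => spoch (L (6 * k + 2 * fF (a + i) - 1)) (fF (a - 3 * i + 1) - 1)) *
  prodz (cl (a - 1) 3) (fun i => poch (u + (3 * k + fF (a + i - 1) + 1)%:~R) (fF (a - 3 * i + 2) - 1)).

Definition numer (n : nat) : F := prodz n (fun i => cfac u i * L (3 * i - 2)).

Lemma regroup7 (t1 t2 t3 t4 t5 t6 t7 s1 s2 s5 s6 s7 : F) :
  t1 = s1 -> t2 = s2 -> t5 = s5 -> t6 = s6 -> t7 = s7 ->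
  t1 * t2 * t3 * t4 * t5 * t6 * t7 = s1 * s5 * s6 * (s2 * (t3 * t4) * s7).
Proof. by move=> -> -> -> -> ->; ring. Qed.

Lemma E3evenE (k z a : nat) : (0 < k)%N ->
  E3even u k z a = evenH u k z a * (numer (2 * k + z + a).-1 * evenF k a * \prod_(t < a) lterm u (2 * k) z a t).
Proof.
move=> k0; rewrite -(evenL int_inj generic) /E3even !fl_half1 !fl_half.
apply: regroup7 => //.
- by congr (prodz _ _); lia.
- by apply: eq_prodz => i _ _; rewrite /hterm; congr (spoch (L _) _ * poch _ _); lia.
- by apply: eq_prodz => i _ _; rewrite /hterm; congr (spoch (L _) _ * poch _ _); lia.
Qed.

Lemma E3oddE (k z a : nat) :
  E3odd u k z a = oddH u k z a * (numer ((2 * k).+1 + z + a).-1 * oddF k a * \prod_(t < a) lterm u (2 * k).+1 z a t).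
Proof.
rewrite -(oddL int_inj generic) /E3odd !fl_half1 !fl_half.
apply: regroup7 => //.
- by congr (prodz _ _); lia.
- by apply: eq_prodz => i _ _; rewrite /hterm; congr (spoch (L _) _ * poch (u + _%:~R) _); lia.
- by apply: eq_prodz => i _ _; rewrite /hterm; congr (spoch (L _) _ * poch (u + _%:~R) _); lia.
Qed.

(** For odd [z] the first product of the numerator gains the factor. For even [z] the second one
    gains half of it, and the power of 2 makes up for the half. *)
Lemma Keven_step (k z a : nat) (n := (2 * k + z + a)%N) :
  Keven u k z.+1 a * (u + (3 * n%:Z - 1)%:~R) = Keven u k z a * L (3 * n%:Z + 3 * a%:Z - 2).
Proof.
have n2 : (2%:R : F) != 0 by apply: (natr_neq0 int_inj).
have ea := half_sum a; have ez := half_sum z; have oz := uphalf_half z.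
have eS : (z.+1)./2 = uphalf z by [].
rewrite /Keven !fl_half1 !fl_half eS [uphalf z.+1]/=.
set f := fun i : int => L (6 * i - 5).
set g := fun i : int => u + (3 * k%:Z + 3 * a%:Z + 3 * i - 4)%:~R.
set h := fun i : int => L (6 * k%:Z + _ + 6 * i - 5).
set m := fun i : int => u + (3 * k%:Z + 3 * (uphalf a)%:Z + 3 * i - 4)%:~R.
have -> : k%:Z + z.+1%:Z + a./2%:Z = (k + z + a./2)%:Z + 1 by lia.
have -> : k%:Z + z%:Z + a./2%:Z = (k + z + a./2)%:Z by lia.
rewrite prodzS.
have em : m ((k + z + a./2)%:Z + 1) = u + (3 * n%:Z - 1)%:~R by rewrite /m; congr (u + _%:~R); lia.
have h0 : prodz (uphalf a) h != 0 by apply: prodz_neq0 => i; apply: generic.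
have m0 : prodz (k + z + a./2)%N m != 0 by apply: prodz_neq0 => i; apply: (generic1 generic).
have l0 : u + (3 * n%:Z - 1)%:~R != 0 by apply: (generic1 generic).
rewrite em; case: (odd z) oz => /= oz.
  have -> : k%:Z + (uphalf z)%:Z + a%:Z = (k + z./2 + a)%N%:Z + 1 by lia.
  have -> : k%:Z + (z./2)%:Z + a%:Z = (k + z./2 + a)%N%:Z by lia.
  have -> : (z./2).+1 = uphalf z by lia.
  rewrite prodzS.
  have -> : f ((k + z./2 + a)%N%:Z + 1) = L (3 * n%:Z + 3 * a%:Z - 2) by rewrite /f; congr (L _); lia.
  move: (2 ^ _) (prodz _ f) (prodz _ g) (prodz _ h) (prodz _ m) (u + _) (L _) h0 m0 l0 => *.
  by field; nonzero.
have -> : uphalf z = z./2 by lia.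
have -> : (z./2).+1%:Z = (z./2)%:Z + 1 by lia.
rewrite prodzS.
have -> : g ((z./2)%:Z + 1) = L (3 * n%:Z + 3 * a%:Z - 2) / 2.
  by rewrite /g (half_lin _ int_inj); congr (L _ / 2); lia.
have -> : k%:Z + (z./2%:Z + 1) + (uphalf a)%:Z - 1 = k%:Z + z./2%:Z + (uphalf a)%:Z - 1 + 1%N by lia.
rewrite (two_pow int_inj) expr1.
move: (2 ^ _) (prodz _ f) (prodz _ g) (prodz _ h) (prodz _ m) (u + _) (L _) h0 m0 l0 => *.
by field; nonzero.
Qed.

Lemma Kodd_step (k z a : nat) (n := ((2 * k).+1 + z + a)%N) :
  Kodd u k z.+1 a * (u + (3 * n%:Z - 1)%:~R) = Kodd u k z a * L (3 * n%:Z + 3 * a%:Z - 2).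
Proof.
have n2 : (2%:R : F) != 0 by apply: (natr_neq0 int_inj).
have ea := half_sum a; have ez := half_sum z; have oz := uphalf_half z.
have eS : (z.+1)./2 = uphalf z by [].
rewrite /Kodd !fl_half1 !fl_half eS [uphalf z.+1]/=.
set f := fun i : int => L (6 * i - 5).
set g := fun i : int => u + (3 * k%:Z + 3 * a%:Z + 3 * i - 1)%:~R.
set h := fun i : int => L (6 * k%:Z + _ + 6 * i - 5).
set m := fun i : int => u + (3 * k%:Z + 3 * (a./2)%:Z + 3 * i - 1)%:~R.
have -> : k%:Z + z.+1%:Z + (uphalf a)%:Z = (k + z + uphalf a)%:Z + 1 by lia.
have -> : k%:Z + z%:Z + (uphalf a)%:Z = (k + z + uphalf a)%:Z by lia.
rewrite prodzS.
have em : m ((k + z + uphalf a)%:Z + 1) = u + (3 * n%:Z - 1)%:~R by rewrite /m; congr (u + _%:~R); lia.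
have h0 : prodz (a./2) h != 0 by apply: prodz_neq0 => i; apply: generic.
have m0 : prodz (k + z + uphalf a)%N m != 0 by apply: prodz_neq0 => i; apply: (generic1 generic).
have l0 : u + (3 * n%:Z - 1)%:~R != 0 by apply: (generic1 generic).
rewrite em; case: (odd z) oz => /= oz.
  have -> : uphalf z = (z./2).+1 by lia.
  have -> : (z./2).+1%:Z = (z./2)%:Z + 1 by lia.
  rewrite prodzS.
  have -> : g ((z./2)%:Z + 1) = L (3 * n%:Z + 3 * a%:Z - 2) / 2.
    by rewrite /g (half_lin _ int_inj); congr (L _ / 2); lia.
  have -> : k%:Z + (z./2%:Z + 1) + (a./2)%:Z = k%:Z + z./2%:Z + (a./2)%:Z + 1%N by lia.
  rewrite (two_pow int_inj) expr1.
  move: (2 ^ _) (prodz _ f) (prodz _ g) (prodz _ h) (prodz _ m) (u + _) (L _) h0 m0 l0 => *.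
  by field; nonzero.
have -> : k%:Z + (z./2).+1%:Z + a%:Z = (k + z./2 + a)%N%:Z + 1 by lia.
have -> : k%:Z + (uphalf z)%:Z + a%:Z = (k + z./2 + a)%N%:Z by lia.
have -> : uphalf z = z./2 by lia.
rewrite prodzS.
have -> : f ((k + z./2 + a)%N%:Z + 1) = L (3 * n%:Z + 3 * a%:Z - 2) by rewrite /f; congr (L _); lia.
move: (2 ^ _) (prodz _ f) (prodz _ g) (prodz _ h) (prodz _ m) (u + _) (L _) h0 m0 l0 => *.
by field; nonzero.
Qed.

End ZStepE4.

Section E4Formula.
Variables (F : fieldType) (u : F).
Hypothesis int_inj : forall c : int, c != 0 -> c%:~R != 0 :> F.
Hypothesis generic : forall c : int, 2%:R * u + c%:~R != 0.
Local Notation L p := (2%:R * u + p%:~R).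

Lemma Keven_neq0 k z a : Keven u k z a != 0.
Proof.
have n2 : (2%:R : F) != 0 by apply: (natr_neq0 int_inj).
rewrite /Keven !mulf_neq0 ?invr_eq0 ?mulf_neq0 ?expfz_neq0 //; apply: prodz_neq0 => i;
  [exact: generic | exact: (generic1 generic) | exact: generic | exact: (generic1 generic)].
Qed.

Lemma Kodd_neq0 k z a : Kodd u k z a != 0.
Proof.
have n2 : (2%:R : F) != 0 by apply: (natr_neq0 int_inj).
rewrite /Kodd !mulf_neq0 ?invr_eq0 ?mulf_neq0 ?expfz_neq0 //; apply: prodz_neq0 => i;
  [exact: generic | exact: (generic1 generic) | exact: generic | exact: (generic1 generic)].
Qed.

Lemma E4_even k z a : E4 u (2 * k.+1) z a = E3even u k.+1 z a / Keven u k.+1 z a.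
Proof. by rewrite /E4 mul2n odd_double doubleK. Qed.

Lemma E4_odd k z a : E4 u (2 * k).+1 z a = E3odd u k z a / Kodd u k z a.
Proof. by rewrite /E4 mul2n /= odd_double uphalf_double. Qed.

Lemma numerS n : (0 < n)%N -> numer u n = numer u n.-1 * (cfac u n * L (3 * n%:Z - 2)).
Proof.
by move=> n0; rewrite /numer -{1}(prednK n0) -addn1 PoszD prodzS; congr (_ * (cfac u _ * L _)); lia.
Qed.

(** From here on the parity of [y] is immaterial: [H], [Fp] and [K] stand for either version. *)
Lemma step_combine (y z a : nat) (n := (y + z + a)%N) (H' H N Fp K' K : F) : K != 0 -> K' != 0 ->
  H' = H * (2%:R^-1 * prodz a (rhoj u y z a)) ->
  K' * (u + (3 * n%:Z - 1)%:~R) = K * L (3 * n%:Z + 3 * a%:Z - 2) ->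
  H' * (N * (cfac u n * L (3 * n%:Z - 2)) * Fp * \prod_(t < a) lterm u y z.+1 a t) / K' =
  H * (N * Fp * \prod_(t < a) lterm u y z a t) / K * zratio u y z a.
Proof.
have n2 : (2%:R : F) != 0 by apply: (natr_neq0 int_inj).
move=> K0 K0' eH eK.
have l1 := generic1 generic (3 * n%:Z - 1); have l2 := generic (3 * n%:Z + 3 * a%:Z - 2).
apply: (mulIf l2); rewrite -[RHS]mulrA zratio_tele // -/n -(cfac_sig int_inj generic).
have := prod_ltermS int_inj generic y z a; rewrite eH.
move: (\prod_(t < a) lterm u y z.+1 a t) (\prod_(t < a) lterm u y z a t) (prodz a _) (2^-1 ^+ a * _) => p' p r t et.
have -> : K' = K * L (3 * n%:Z + 3 * a%:Z - 2) / (u + (3 * n%:Z - 1)%:~R) by rewrite -eK mulfK.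
transitivity (H * 2^-1 * (p' * r) * (N * (cfac u n * L (3 * n%:Z - 2)) * Fp) / (K * L (3 * n%:Z + 3 * a%:Z - 2) / (u + (3 * n%:Z - 1)%:~R)) * L (3 * n%:Z + 3 * a%:Z - 2)); first by ring.
rewrite et; move: l1 l2; move: (cfac u n) (L (3 * n%:Z - 2)) (L (3 * n%:Z + 3 * a%:Z - 2)) (u + _) => c L1 L2 L3 l1 l2.
by field; nonzero.
Qed.

Lemma E4_zstep y z a : (0 < y)%N -> E4 u y z.+1 a = E4 u y z a * zratio u y z a.
Proof.
move=> y0; have := odd_double_half y; case: (odd y) => /= ey.
  rewrite -ey add1n -mul2n !E4_odd !(E3oddE int_inj generic); set k := y./2.
  have -> : ((2 * k).+1 + z.+1 + a).-1 = ((2 * k).+1 + z + a)%N by lia.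
  rewrite (numerS (n := (2 * k).+1 + z + a)) //.
  by apply: step_combine; [exact: Kodd_neq0 | exact: Kodd_neq0 | exact: oddH_step | exact: Kodd_step].
rewrite add0n -mul2n in ey; have [k ek] : exists k, y = (2 * k.+1)%N by exists (y./2).-1; lia.
rewrite ek !E4_even !(E3evenE int_inj generic) //.
have -> : (2 * k.+1 + z.+1 + a).-1 = (2 * k.+1 + z + a)%N by lia.
rewrite (numerS (n := 2 * k.+1 + z + a)) //.
by apply: step_combine; [exact: Keven_neq0 | exact: Keven_neq0 | exact: evenH_step | exact: Keven_step].
Qed.

End E4Formula.

(** * Trading [a] for [y] at [z = 0] *)

Section E4Base.
Variables (F : fieldType) (u : F).
Hypothesis int_inj : forall c : int, c != 0 -> c%:~R != 0 :> F.
Hypothesis generic : forall c : int, 2%:R * u + c%:~R != 0.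
Local Notation gu := (gu u).
Local Notation gu0 := (gu_neq0 generic).
Local Notation g1 := (g1 u).
Local Notation go := (go u).
Local Notation go0 := (go_neq0 generic).
Local Notation L p := (2%:R * u + p%:~R).

(** At [z = 0] the factor [t] is [h t / h (a - 1 - t)], and reversing the index permutes the
    denominators. *)
Lemma prod_lterm0 y a : \prod_(t < a) lterm u y 0 a t = 1.
Proof.
have n2 : (2%:R : F) != 0 by apply: (natr_neq0 int_inj).
pose h (t : nat) : F := (2%:R ^+ t * (t`!)%:R * go (y%:Z + a%:Z + t%:Z - 1) * gu (2 * y%:Z + 2 * a%:Z + t%:Z - 1)) / ((y + 2 * t)`!)%:R.
have h0 t : h t != 0 by rewrite /h !mulf_neq0 ?invr_eq0 ?(fact0F int_inj) ?go0 ?gu0 ?expf_neq0.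
transitivity ((\prod_(t < a) h t) / \prod_(t < a) h (a - t.+1)%N); last first.
  by rewrite [X in X / _](reindex_inj rev_ord_inj) /= divff //; apply/prodf_neq0 => t _.
rewrite -prodf_div; apply: eq_bigr => t _; rewrite /lterm /h add0n addr0 mulr0 addr0.
set r := (a - t.+1)%N.
have f1 := fact0F int_inj (y + 2 * t); have f2 := fact0F int_inj (y + 2 * r); have f3 := fact0F int_inj r.
have p1 := expf_neq0 r n2.
have b1 := go0 (y%:Z + a%:Z + r%:Z - 1); have b2 := gu0 (2 * y%:Z + 2 * a%:Z + r%:Z - 1).
move: f1 f2 f3 p1; move: ((y + 2 * t)`!%:R) ((y + 2 * r)`!%:R) (r`!%:R) (2 ^+ r) => F1 F2 F3 T f1 f2 f3 p1.
by field; nonzero.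
Qed.

(** Raising [a] by one interchanges the two product lengths, apart from one new factor [f 1]. So [f]
    is compared, with index shifted, to the old second product [q0], and [g] to the old first
    product [q1]. *)
Lemma prod_shift (f g q1 q0 s : int -> F) (a : nat) :
  (forall i : nat, f (1 + i%:Z) = q0 i * s (2 * i%:Z)) ->
  (forall i : nat, g i = q1 i * s (2 * i%:Z - 1)) ->
  prodz (a./2.+1) f * prodz (uphalf a) g = prodz (uphalf a) q1 * prodz a./2 q0 * (f 1 * prodz a s).
Proof.
move=> ef eg; rewrite (_ : (a./2.+1)%:Z = 1%N%:Z + (a./2)%:Z); last by lia.
rewrite prodz_add -(prodz_merge a s) [prodz 1%N f]big_ord1.
rewrite (eq_prodz (n := a./2) (g := fun i => q0 i * s (2 * i))); last by move=> i _ _; rewrite -ef.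
rewrite (eq_prodz (n := uphalf a) (f := g) (g := fun i => q1 i * s (2 * i - 1))); last by move=> i _ _; rewrite -eg.
by rewrite !prodzM; ring.
Qed.

Lemma hterm_ratio (c d l l' T T' : int) : c + l = T -> d + l' = T' ->
  hterm u c d l l' = go T * gu T' / (go c * gu d).
Proof.
move=> <- <-; rewrite /hterm (spoch_go generic) (poch_gu generic).
by rewrite mulrACA invfM.
Qed.

(** Passing from [y = 2k], [a + 1] to [y = 2k + 1], [a] leaves a surplus that is exactly cancelled
    by [evenF_z0]. *)
Lemma evenH_z0 (k a : nat) (M := 3 * k%:Z + 2 * a%:Z) :
  evenH u k 0 a.+1 = oddH u k 0 a * (go M / go (M + a%:Z)).
Proof.
rewrite /evenH /oddH !muln0.
have -> : (uphalf a.+1 = a./2.+1)%N by [].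
have -> : (a.+1)./2 = uphalf a by [].
rewrite [uphalf 0]/= [0./2]/= -!mulrA; congr (_ * _); first by congr (2 ^ _); lia.
(* Chosen so that the [j]-th factor changes by [b j / b (j - 1)] for either parity of [j]; the
   changes then telescope. *)
pose b (j : int) := (go (M + 1 + j) * go (M + j) * gu (M + 1 + j))^-1.
rewrite (prod_shift (s := fun j => b j / b (j - 1)) (q1 := fun i => let c := 3 * k%:Z + 0%N%:Z + 2 * a%:Z + 2 * i - 2 in
      hterm u c (c + 1) (0%N%:Z + a%:Z - 5 * i + 4) (0%N%:Z + a%:Z - 5 * i + 4))
   (q0 := fun i => let c := 3 * k%:Z + 0%N%:Z + 2 * a%:Z + 2 * i - 1 in
      hterm u c (c + 1) (0%N%:Z + a%:Z - 5 * i + 2) (0%N%:Z + a%:Z - 5 * i + 1))).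
- rewrite -mulrA; congr (_ * (_ * _)).
  rewrite prodz_telescope; last by move=> i _; rewrite invr_eq0 !mulf_neq0 ?go0 ?gu0.
  rewrite /b (hterm_ratio (T := M + 1 + a%:Z) (T' := M + 1 + a%:Z)); try by rewrite /M; lia.
  have -> : 3 * k%:Z + 0%N%:Z + 2 * a.+1%:Z + 2 * 1 - 3 = M + 1 by rewrite /M; lia.
  rewrite !addr0.
  have h1 := go0 (M + 1); have h2 := gu0 (M + 1); have h3 := go0 (M + 1 + a%:Z); have h4 := gu0 (M + 1 + a%:Z).
  have h5 := go0 M; have h6 := go0 (M + a%:Z).
  by field; nonzero.
- move=> i /=; set T := 3 * k%:Z + 3 * a%:Z - 3 * i%:Z + 1.
  rewrite !(hterm_ratio (T := T) (T' := T)); try by rewrite /T; lia.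
  have -> : 3 * k%:Z + 0%N%:Z + 2 * a.+1%:Z + 2 * (1 + i%:Z) - 3 = M + 1 + 2 * i%:Z by rewrite /M; lia.
  have -> : 3 * k%:Z + 0%N%:Z + 2 * a%:Z + 2 * i%:Z - 1 = M - 1 + 2 * i%:Z by rewrite /M; lia.
  have -> : M - 1 + 2 * i%:Z + 1 = M + 2 * i%:Z by lia.
  rewrite /b.
  have -> : M + 1 + (2 * i%:Z - 1) = M + 2 * i%:Z by lia.
  have -> : M + (2 * i%:Z - 1) = M - 1 + 2 * i%:Z by lia.
  have h1 := go0 (M + 1 + 2 * i%:Z); have h2 := gu0 (M + 1 + 2 * i%:Z); have h3 := go0 (M + 2 * i%:Z).
  have h4 := gu0 (M + 2 * i%:Z); have h5 := go0 (M - 1 + 2 * i%:Z).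
  by field; nonzero.
- move=> i /=; set T := 3 * k%:Z + 3 * a%:Z - 3 * i%:Z + 2.
  rewrite !(hterm_ratio (T := T) (T' := T + 1)); try by rewrite /T; lia.
  have -> : 3 * k%:Z + 0%N%:Z + 2 * a.+1%:Z + 2 * i%:Z - 2 = M + 1 + (2 * i%:Z - 1) by rewrite /M; lia.
  have -> : 3 * k%:Z + 0%N%:Z + 2 * a%:Z + 2 * i%:Z - 2 = M + (2 * i%:Z - 1) - 1 by rewrite /M; lia.
  rewrite /b; set j := 2 * i%:Z - 1.
  have -> : M + j - 1 + 1 = M + j by lia.
  have -> : M + 1 + (j - 1) = M + j by lia.
  have -> : M + (j - 1) = M + j - 1 by lia.
  have h1 := go0 (M + 1 + j); have h2 := gu0 (M + 1 + j); have h3 := go0 (M + j).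
  have h4 := gu0 (M + j); have h5 := go0 (M + j - 1).
  by field; nonzero.
Qed.

Lemma oddH_z0 (k a : nat) (M := 3 * k%:Z + 2 * a%:Z + 2) :
  oddH u k 0 a.+1 = evenH u k.+1 0 a * (gu M / gu (M + a%:Z)).
Proof.
rewrite /evenH /oddH !muln0.
have -> : (uphalf a.+1 = a./2.+1)%N by [].
have -> : (a.+1)./2 = uphalf a by [].
rewrite [uphalf 0]/= [0./2]/= -!mulrA; congr (_ * _); first by congr (2 ^ _); lia.
pose b (j : int) := (go (M + j) * gu (M + 1 + j) * gu (M + j))^-1.
rewrite (prod_shift (s := fun j => b j / b (j - 1)) (q1 := fun i => let c := 3 * k.+1%:Z + 0%N%:Z + 2 * a%:Z + 2 * i - 3 in
      hterm u c c (0%N%:Z + a%:Z - 5 * i + 4) (0%N%:Z + a%:Z - 5 * i + 4))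
   (q0 := fun i => let c := 3 * k.+1%:Z + 0%N%:Z + 2 * a%:Z + 2 * i - 2 in
      hterm u c c (0%N%:Z + a%:Z - 5 * i + 1) (0%N%:Z + a%:Z - 5 * i + 2))).
- rewrite -mulrA; congr (_ * (_ * _)).
  rewrite prodz_telescope; last by move=> i _; rewrite invr_eq0 !mulf_neq0 ?go0 ?gu0.
  rewrite /b (hterm_ratio (T := M + a%:Z) (T' := M + 1 + a%:Z)); try by rewrite /M; lia.
  have -> : 3 * k%:Z + 0%N%:Z + 2 * a.+1%:Z + 2 * 1 - 2 = M by rewrite /M; lia.
  rewrite !addr0.
  have h1 := go0 M; have h2 := gu0 (M + 1); have h3 := go0 (M + a%:Z); have h4 := gu0 (M + 1 + a%:Z).
  have h5 := gu0 M; have h6 := gu0 (M + a%:Z).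
  by field; nonzero.
- move=> i /=; set T := 3 * k%:Z + 3 * a%:Z - 3 * i%:Z + 2.
  rewrite !(hterm_ratio (T := T) (T' := T + 1)); try by rewrite /T; lia.
  have -> : 3 * k%:Z + 0%N%:Z + 2 * a.+1%:Z + 2 * (1 + i%:Z) - 2 = M + 2 * i%:Z by rewrite /M; lia.
  have -> : 3 * k.+1%:Z + 0%N%:Z + 2 * a%:Z + 2 * i%:Z - 2 = M + 2 * i%:Z - 1 by rewrite /M; lia.
  rewrite /b; set j := 2 * i%:Z.
  have -> : M + j + 1 = M + 1 + j by lia.
  have -> : M + 1 + (j - 1) = M + j by lia.
  have -> : M + (j - 1) = M + j - 1 by lia.
  have h1 := go0 (M + j); have h2 := gu0 (M + 1 + j); have h3 := gu0 (M + j).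
  have h4 := go0 (M + j - 1); have h5 := gu0 (M + j - 1).
  by field; nonzero.
- move=> i /=; set T := 3 * k%:Z + 3 * a%:Z - 3 * i%:Z + 4.
  rewrite !(hterm_ratio (T := T) (T' := T)); try by rewrite /T; lia.
  have -> : 3 * k%:Z + 0%N%:Z + 2 * a.+1%:Z + 2 * i%:Z - 1 = M + (2 * i%:Z - 1) by rewrite /M; lia.
  have -> : 3 * k.+1%:Z + 0%N%:Z + 2 * a%:Z + 2 * i%:Z - 3 = M + (2 * i%:Z - 1) - 1 by rewrite /M; lia.
  rewrite /b; set j := 2 * i%:Z - 1.
  have -> : M + j + 1 = M + 1 + j by lia.
  have -> : M + 1 + (j - 1) = M + j by lia.
  have -> : M + (j - 1) = M + j - 1 by lia.
  have h1 := go0 (M + j); have h2 := gu0 (M + 1 + j); have h3 := gu0 (M + j).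
  have h4 := go0 (M + j - 1); have h5 := gu0 (M + j - 1).
  by field; nonzero.
Qed.

(* As a + i and a - 3i have the same parity, f(a + i) + f(a - 3i + 1) and f(a + i) + f(a - 3i + 3)
   are affine in i with slope -3, so the quotient of the two products telescopes. *)
Lemma prod_telescope_thirds (G : int -> F) (c : int) (a : nat) : (forall p, G p != 0) ->
  prodz (cl a%:Z 3) (fun i => G (c + fF (a%:Z + i) - 1 + (fF (a%:Z - 3 * i + 3) - 1)) / G (c + fF (a%:Z + i) - 1)) =
  prodz (cl (a%:Z - 2) 3) (fun i => G (c + fF (a%:Z + i) - 1 + (fF (a%:Z - 3 * i + 1) - 1)) / G (c + fF (a%:Z + i) - 1))
  * (G (c + 3 * a%:Z) / G (c + 2 * a%:Z)).
Proof.
move=> G0.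
have t1 (i : int) : c + fF (a%:Z + i) - 1 + (fF (a%:Z - 3 * i + 3) - 1) = c + 3 * a%:Z - 3 * (i - 1) by rewrite /fF /fl; lia.
have t2 (i : int) : c + fF (a%:Z + i) - 1 + (fF (a%:Z - 3 * i + 1) - 1) = c + 3 * a%:Z - 3 * i by rewrite /fF /fl; lia.
have [p [q [ea q2]]] : exists p q : nat, a = (3 * p + q)%N /\ (q <= 2)%N.
  by exists (a %/ 3)%N, (a %% 3)%N; rewrite mulnC -divn_eq -ltnS ltn_pmod.
have e2 : cl (a%:Z - 2) 3 = p%:Z by rewrite /cl; lia.
pose h i := (G (c + 3 * a%:Z - 3 * i))^-1.
have P : prodz p (fun i => G (c + fF (a%:Z + i) - 1 + (fF (a%:Z - 3 * i + 3) - 1)) / G (c + fF (a%:Z + i) - 1)) =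
  prodz p (fun i => G (c + fF (a%:Z + i) - 1 + (fF (a%:Z - 3 * i + 1) - 1)) / G (c + fF (a%:Z + i) - 1)) *
  (G (c + 3 * a%:Z) / G (c + 3 * a%:Z - 3 * p%:Z)).
  have -> : G (c + 3 * a%:Z) / G (c + 3 * a%:Z - 3 * p%:Z) = h p / h 0 by rewrite /h mulr0 subr0 invrK mulrC.
  rewrite -prodz_telescope; last by move=> i _; rewrite invr_eq0.
  rewrite -prodzM; apply: eq_prodz => i _ _; rewrite t1 t2 /h invrK.
  have g1 := G0 (c + 3 * a%:Z - 3 * i%:Z); have g2 := G0 (c + fF (a%:Z + i%:Z) - 1).
  by field; nonzero.
rewrite e2; case: q ea q2 => [|q] ea q2.
  have -> : cl a%:Z 3 = p%:Z by rewrite /cl; lia.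
  by rewrite P; congr (_ * (_ / G _)); lia.
have -> : cl a%:Z 3 = p%:Z + 1 by rewrite /cl; lia.
rewrite prodzS P -mulrA t1; congr (_ * _).
have -> : c + 3 * a%:Z - 3 * (p%:Z + 1 - 1) = c + 3 * a%:Z - 3 * p%:Z by lia.
have -> : c + fF (a%:Z + (p%:Z + 1)) - 1 = c + 2 * a%:Z by rewrite /fF /fl; lia.
by rewrite mulrA mulfVK.
Qed.

Lemma evenF_z0 (k a : nat) (M := 3 * k%:Z + 2 * a%:Z) :
  evenF u k a.+1 = oddF u k a * (go (M + a%:Z) / go M).
Proof.
rewrite /evenF /oddF mulrAC; congr (_ * _); last first.
  have -> : a.+1%:Z - 2 = a%:Z - 1 by lia.
  by apply: eq_prodz => i _ _; congr (poch (u + (_ + fF _ + _)%:~R) (fF _ - _)); lia.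
have := prod_telescope_thirds (3 * k%:Z) a go0.
have -> : 3 * k%:Z + 3 * a%:Z = M + a%:Z by rewrite /M; lia.
rewrite -/M => E; rewrite (_ : a.+1%:Z - 1 = a%:Z); last by lia.
transitivity (prodz (cl a%:Z 3) (fun i => go (3 * k%:Z + fF (a%:Z + i) - 1 + (fF (a%:Z - 3 * i + 3) - 1)) / go (3 * k%:Z + fF (a%:Z + i) - 1))).
  apply: eq_prodz => i _ _; rewrite -(spoch_go generic).
  by congr (spoch (L _) (fF _ - _)); rewrite /fF /fl; lia.
rewrite E; congr (_ * _).
apply: eq_prodz => i _ _; rewrite -(spoch_go generic).
by congr (spoch (L _) _); lia.
Qed.

Lemma oddF_z0 (k a : nat) (M := 3 * k%:Z + 2 * a%:Z + 2) :
  oddF u k a.+1 = evenF u k.+1 a * (gu (M + a%:Z) / gu M).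
Proof.
rewrite /evenF /oddF -[RHS]mulrA; congr (_ * _).
  have -> : a.+1%:Z - 2 = a%:Z - 1 by lia.
  by apply: eq_prodz => i _ _; congr (spoch (L _) (fF _ - _)); rewrite ?/fF ?/fl; lia.
have := prod_telescope_thirds (3 * k%:Z + 2) a gu0.
have -> : 3 * k%:Z + 2 + 3 * a%:Z = M + a%:Z by rewrite /M; lia.
have -> : 3 * k%:Z + 2 + 2 * a%:Z = M by rewrite /M; lia.
move=> E; rewrite (_ : a.+1%:Z - 1 = a%:Z); last by lia.
transitivity (prodz (cl a%:Z 3) (fun i => gu (3 * k%:Z + 2 + fF (a%:Z + i) - 1 + (fF (a%:Z - 3 * i + 3) - 1)) / gu (3 * k%:Z + 2 + fF (a%:Z + i) - 1))).
  apply: eq_prodz => i _ _; rewrite -(poch_gu generic).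
  by congr (poch (u + _%:~R) (fF _ - _)); rewrite /fF /fl; lia.
rewrite E; congr (_ * _).
apply: eq_prodz => i _ _; rewrite -(poch_gu generic).
by congr (poch (u + _%:~R) _); rewrite /fF /fl; lia.
Qed.

End E4Base.

(** * Closed form of the product formula *)

Section E4Closed.
Variables (F : fieldType) (u : F).
Hypothesis int_inj : forall c : int, c != 0 -> c%:~R != 0 :> F.
Hypothesis generic : forall c : int, 2%:R * u + c%:~R != 0.
Local Notation gu := (gu u).
Local Notation guS := (guS generic).
Local Notation gu0 := (gu_neq0 generic).
Local Notation g1 := (g1 u).
Local Notation g1_0 := (g1_neq0 generic).
Local Notation go := (go u).
Local Notation go0 := (go_neq0 generic).
Local Notation L p := (2%:R * u + p%:~R).

(** At [z = 0] the last [uphalf a] factors of the first numerator product are the first denominator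
    product and cancel. *)
Lemma Keven_z0E (k a : nat) :
  Keven u k 0 a = 2%:R ^ (k%:Z + (uphalf a)%:Z - 1) * prodz (k + a./2)%N (fun i => L (6 * i - 5)) /
    prodz (k + a./2)%N (fun i => u + (3 * k%:Z + 3 * (uphalf a)%:Z + 3 * i - 4)%:~R).
Proof.
have ea := half_sum a.
rewrite /Keven !fl_half1 !fl_half.
rewrite [uphalf 0]/= [0./2]/= [prodz 0%N%:Z _](prodz_le0 _ (lexx 0)) mulr1.
have -> : k%:Z + 0%N%:Z + (uphalf a)%:Z - 1 = k%:Z + (uphalf a)%N%:Z - 1 by lia.
have -> : k%:Z + 0%N%:Z + a%:Z = (k + a./2)%N%:Z + (uphalf a)%N%:Z by lia.
have -> : k%:Z + 0%N%:Z + (a./2)%:Z = (k + a./2)%N%:Z by lia.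
rewrite prodz_add.
rewrite (eq_prodz (n := uphalf a) (f := fun i => L (6 * k%:Z + _ + 6 * i - 5)) (g := fun i => L (6 * ((k + a./2)%N%:Z + i) - 5))); last first.
  by move=> i _ _; congr (L _); lia.
have h0 : prodz (uphalf a)%N (fun i => L (6 * ((k + a./2)%N%:Z + i) - 5)) != 0.
  by apply: prodz_neq0 => i; apply: generic.
move: (prodz (uphalf a)%N _) h0 => p p0.
by rewrite invfM !mulrA mulfK.
Qed.

Lemma Kodd_z0E (k a : nat) :
  Kodd u k 0 a = 2%:R ^ (k + a./2)%N%:Z * prodz (k + uphalf a)%N (fun i => L (6 * i - 5)) /
    prodz (k + uphalf a)%N (fun i => u + (3 * k%:Z + 3 * (a./2)%:Z + 3 * i - 1)%:~R).
Proof.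
have ea := half_sum a.
rewrite /Kodd !fl_half1 !fl_half.
rewrite [uphalf 0]/= [0./2]/= [prodz 0%N%:Z _](prodz_le0 _ (lexx 0)) mulr1.
have -> : k%:Z + 0%N%:Z + (a./2)%:Z = (k + a./2)%N%:Z by lia.
have -> : k%:Z + 0%N%:Z + a%:Z = (k + uphalf a)%N%:Z + (a./2)%N%:Z by lia.
have -> : k%:Z + 0%N%:Z + (uphalf a)%:Z = (k + uphalf a)%N%:Z by lia.
rewrite prodz_add.
rewrite (eq_prodz (n := a./2) (f := fun i => L (6 * k%:Z + _ + 6 * i - 5)) (g := fun i => L (6 * ((k + uphalf a)%N%:Z + i) - 5))); last first.
  by move=> i _ _; congr (L _); lia.
have h0 : prodz (a./2)%N (fun i => L (6 * ((k + uphalf a)%N%:Z + i) - 5)) != 0.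
  by apply: prodz_neq0 => i; apply: generic.
move: (prodz (a./2)%N _) h0 => p p0.
by rewrite invfM !mulrA mulfK.
Qed.

Lemma Keven_z0 (k a : nat) : Keven u k 0 a.+1 = Kodd u k 0 a.
Proof.
rewrite Keven_z0E Kodd_z0E.
have -> : uphalf a.+1 = a./2.+1 by [].
have -> : (a.+1)./2 = uphalf a by [].
congr (2 ^ _ * _ / _); first by lia.
by apply: eq_prodz => i _ _; congr (u + _%:~R); lia.
Qed.

Lemma Kodd_z0 (k a : nat) : Kodd u k 0 a.+1 = Keven u k.+1 0 a.
Proof.
rewrite Keven_z0E Kodd_z0E.
have -> : uphalf a.+1 = a./2.+1 by [].
have -> : (a.+1)./2 = uphalf a by [].
rewrite addnS; congr (2 ^ _ * _ / _); first by lia.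
by apply: eq_prodz => i _ _; congr (u + _%:~R); lia.
Qed.

Lemma E4_z0_shift y a : (0 < y)%N -> E4 u y 0 a.+1 = E4 u y.+1 0 a.
Proof.
have e0 := prod_lterm0 int_inj generic.
move=> y0; have := odd_double_half y; case: (odd y) => /= ey.
  rewrite -ey add1n -mul2n; set k := y./2.
  have -> : ((2 * k).+2 = 2 * k.+1)%N by lia.
  rewrite E4_odd E4_even (E3oddE int_inj generic) (E3evenE int_inj generic) // !e0 Kodd_z0; congr (_ / _).
  rewrite (oddH_z0 generic) (oddF_z0 generic).
  have -> : ((2 * k).+1 + 0 + a.+1 = 2 * k.+1 + 0 + a)%N by lia.
  set M := 3 * _ + _ + _.
  have h1 := gu0 M; have h2 := gu0 (M + a%:Z).
  by field; nonzero.
rewrite add0n -mul2n in ey; have [k ek] : exists k, y = (2 * k.+1)%N by exists (y./2).-1; lia.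
rewrite ek E4_odd E4_even (E3oddE int_inj generic) (E3evenE int_inj generic) // !e0 Keven_z0; congr (_ / _).
rewrite (evenH_z0 generic) (evenF_z0 generic).
have -> : (2 * k.+1 + 0 + a.+1 = (2 * k.+1).+1 + 0 + a)%N by lia.
set M := 3 * _ + _.
have h1 := go0 M; have h2 := go0 (M + a%:Z).
by field; nonzero.
Qed.

Lemma leadE n : lead u n = 2%:R^-1 ^+ n * prodz n (fun i => cfac u i) * prodz n (fun i => u + (3 * i - 1)%:~R).
Proof.
rewrite -(prodz_cst n) -!prodzM prodz_nat /lead; apply: eq_bigr => i _.
by rewrite -(cfac_sig int_inj generic) div1r mulrA.
Qed.

(** [L (3i - 2)] is [L (6j - 5)] for [i = 2j - 1] and [2 (u + 3j - 1)] for [i = 2j]. This explains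
    the shape of [K], which converts the numerator of E_3 into [lead]. *)
Lemma numer_lead n : numer u n * prodz n (fun i => u + (3 * i - 1)%:~R) =
  2%:R ^+ n * lead u n * (prodz (uphalf n) (fun i => L (6 * i - 5)) * prodz n./2 (fun i => u + (3 * i - 1)%:~R) * 2%:R ^+ n./2).
Proof.
have n2 : (2%:R : F) != 0 by apply: (natr_neq0 int_inj).
rewrite leadE /numer prodzM -(prodz_merge n (fun i => L (3 * i - 2))).
rewrite (eq_prodz (n := n./2) (g := fun i => (u + (3 * i - 1)%:~R) * 2)); last first.
  by move=> i _ _; rewrite (half_lin _ int_inj) mulfVK //; congr (L _); lia.
rewrite (eq_prodz (n := uphalf n) (g := fun i => L (6 * i - 5))); last by move=> i _ _; congr (L _); lia.
rewrite prodzM prodz_cst exprVn; have := expf_neq0 n n2; move: (2 ^+ n) => t t0.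
by field; nonzero.
Qed.

Lemma E4_base y : (0 < y)%N -> E4 u y 0 0 = lead u y.-1.
Proof.
have n2 : (2%:R : F) != 0 by apply: (natr_neq0 int_inj).
have pv n (c : int) : prodz n (fun i => u + (c + 3 * i)%:~R) != 0.
  by apply: prodz_neq0 => i; apply: (generic1 generic).
have pl n : prodz n (fun i => L (6 * i - 5)) != 0 by apply: prodz_neq0 => i; apply: generic.
pose v (c : int) (i : int) := u + (c + 3 * i)%:~R.
move=> y0; have := odd_double_half y; case: (odd y) => /= ey.
  rewrite -ey add1n -mul2n; set k := y./2 => /=.
  rewrite E4_odd (E3oddE int_inj generic) big_ord0 mulr1 Kodd_z0E !addn0 /=.
  rewrite /oddH /oddF !mul0n /= !addn0.
  rewrite [prodz (cl (0%N%:Z - 2) 3) _]prodz_le0 // [prodz (cl (0%N%:Z - 1) 3) _]prodz_le0 // ![prodz 0%N%:Z _]prodz_le0 // !mulr1.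
  have := numer_lead (2 * k).
  have -> : uphalf (2 * k) = k by rewrite mul2n uphalf_double.
  have -> : (2 * k)./2 = k by rewrite mul2n doubleK.
  rewrite (eq_prodz (n := (2 * k)%N) (g := v (- 1))); last by move=> i _ _; congr (u + _%:~R); lia.
  (* The lower half of this product cancels the one on the right of [numer_lead]; the upper half is
     the denominator of [Kodd]. *)
  have -> : (2 * k)%N%:Z = k%:Z + k%:Z by lia.
  rewrite prodz_add (eq_prodz (n := k) (f := fun i => u + (3 * i - 1)%:~R) (g := v (- 1))); last by move=> i _ _; congr (u + _%:~R); lia.
  rewrite (eq_prodz (n := k) (f := fun i => u + _) (g := fun i => v (- 1) (k%:Z + i))); last by move=> i _ _; congr (u + _%:~R); lia.
  have v0 : prodz k (v (-1)) != 0 by apply: pv.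
  have v1 : prodz k (fun i => v (-1) (k%:Z + i)) != 0 by apply: prodz_neq0 => i; apply: (generic1 generic).
  have -> : 0%N%:Z - 0%N%:Z - 0%N%:Z - 2 * k%:Z = - (k + k)%N%:Z by lia.
  have l0 := pl k; rewrite -exprnN mul2n -addnn !exprD.
  have p0 := expf_neq0 k n2.
  rewrite -exprnP; move: l0 p0 v0 v1; move: (numer _ _) (lead _ _) => N D.
  move: (prodz k (v (-1))) (prodz k (fun i => v (-1) (k%:Z + i))) (prodz k _) (2 ^+ k) => V0 V1 P T l0 p0 v0 v1 E.
  have -> : N = T * T * D * (P * V0 * T) / (V0 * V1) by rewrite -E mulfK // mulf_neq0.
  by field; nonzero.
rewrite add0n -mul2n in ey; have [k ek] : exists k, y = (2 * k.+1)%N by exists (y./2).-1; lia.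
rewrite ek E4_even (E3evenE int_inj generic) // big_ord0 mulr1 Keven_z0E !addn0.
have -> : ((2 * k.+1).-1 = (2 * k).+1)%N by lia.
rewrite /evenH /evenF !mul0n /=.
rewrite [prodz (cl (0%N%:Z - 2) 3) _]prodz_le0 // [prodz (cl (0%N%:Z - 1) 3) _]prodz_le0 // ![prodz 0%N%:Z _]prodz_le0 // !mulr1.
have := numer_lead (2 * k).+1.
have -> : uphalf (2 * k).+1 = k.+1 by rewrite mul2n /= doubleK.
have -> : (2 * k).+1./2 = k by rewrite mul2n /= uphalf_double.
rewrite (eq_prodz (n := (2 * k).+1%N) (g := v (- 1))); last by move=> i _ _; congr (u + _%:~R); lia.
have -> : (2 * k).+1%N%:Z = k%:Z + k.+1%:Z by lia.
rewrite prodz_add (eq_prodz (n := k) (f := fun i => u + (3 * i - 1)%:~R) (g := v (- 1))); last by move=> i _ _; congr (u + _%:~R); lia.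
rewrite addn0 (eq_prodz (n := k.+1) (f := fun i => u + _) (g := fun i => v (- 1) (k%:Z + i))); last by move=> i _ _; congr (u + _%:~R); lia.
have v0 : prodz k (v (-1)) != 0 by apply: pv.
have v1 : prodz k.+1 (fun i => v (-1) (k%:Z + i)) != 0 by apply: prodz_neq0 => i; apply: (generic1 generic).
have -> : 0%N%:Z - 0%N%:Z - 0%N%:Z - 2 * k.+1%:Z + 1 = - (k + k + 1)%N%:Z by lia.
have -> : k.+1%:Z + 0%N%:Z - 1 = k%:Z by lia.
have l0 := pl k.+1; rewrite -exprnN -[(2 * k).+1]addn1 mul2n -addnn !exprD.
have p0 := expf_neq0 k n2.
rewrite -exprnP; move: l0 p0 v0 v1; move: (numer _ _) (lead _ _) => N D.
move: (prodz k (v (-1))) (prodz k.+1 (fun i => v (-1) (k%:Z + i))) (prodz k.+1 _) (2 ^+ k) => V0 V1 P T l0 p0 v0 v1 E.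
have -> : N = T * T * 2 * D * (P * V0 * T) / (V0 * V1) by rewrite -E mulfK // mulf_neq0.
by field; nonzero.
Qed.

Lemma zprod0 y a : zprod u y 0 a = 1.
Proof. by rewrite /zprod big_ord0. Qed.

Lemma E4_pos y z a : (0 < y)%N -> E4 u y z a = lead u (y + a).-1 * zprod u y z a.
Proof.
move=> y0; elim: z => [|z IH]; last by rewrite E4_zstep // IH zprodS mulrA.
rewrite zprod0 mulr1; elim: a y y0 => [|a IH] y y0; first by rewrite E4_base // addn0.
by rewrite E4_z0_shift // IH // addSnnS.
Qed.

Lemma E4_y0_a0 z : (0 < z)%N -> E4 u 0 z 0 = lead u z.-1.
Proof.
case: z => // z _; rewrite /E4 eqxx [prodz (0%N%:Z - 1) _]prodz_le0 // mulr1 [z.+1.-1]/=.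
have -> : 0%N%:Z + z.+1%:Z - 1 = z%:Z by lia.
rewrite (eq_prodz (g := fun i => cfac u i * (u + (3 * i - 1)%:~R))); last first.
  move=> i _ _; rewrite /cfac /facratio.
  have -> : 3 * 0%N%:Z + i%:Z - 2 = i%:Z - 2 by lia.
  have -> : 3 * 0%N%:Z + 2 * i%:Z - 1 = 2 * i%:Z - 1 by lia.
  have -> : 6 * 0%N%:Z + 2 * i%:Z - 2 = 2 * i%:Z - 2 by lia.
  have -> : 3 * 0%N%:Z + 3 * i%:Z - 1 = 3 * i%:Z - 1 by lia.
  by rewrite mulrAC.
by rewrite prodzM leadE exprVn div1r -exprnP mulrA.
Qed.

(** At [y = 0] several arguments of [g1] become even; by duplication they cancel against [gu] and
    [go], and up to 1/2 what remains is the general factor of the second product in the formula for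
    [y = 0]. *)
Lemma zratio_y0 z a : (0 < z + a)%N ->
  zratio u 0 z a = 1 / 2%:R * ((z`!)%:R / ((2 * z)`!)%:R * (gu (3 * a%:Z + z%:Z - 1) / gu (3 * a%:Z + 2 * z%:Z)) *
    (g1 (6 * a%:Z + 3 * z%:Z - 2) / g1 (6 * a%:Z + 2 * z%:Z - 2)) *
    (gu (3 * a%:Z + 3 * z%:Z) / gu (3 * a%:Z + 2 * z%:Z - 1))).
Proof.
have n2 : (2%:R : F) != 0 by apply: (natr_neq0 int_inj).
move=> za; rewrite /zratio /sig !add0n; set n := (z + a)%N.
have [m em] : exists m, n = m.+1 by exists n.-1; rewrite prednK.
have -> : 4 * n%:Z - 2 * n%:Z - 2 = 2 * m%:Z by lia.
have -> : 4 * n%:Z - n%:Z - 2 = 3 * n%:Z - 2 by lia.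
have -> : 3 * n%:Z - n%:Z = 2 * n%:Z by lia.
have -> : 2 * n%:Z - n%:Z - 1 = m%:Z by lia.
have -> : n%:Z - 1 = m%:Z by lia.
have -> : n%:Z + a%:Z - 1 = (m + a)%N%:Z by lia.
have -> : 3 * 0%N%:Z + 2 * z%:Z + 4 * a%:Z - 2 = 2 * (m + a)%N%:Z by lia.
have -> : 3 * 0%N%:Z + 2 * z%:Z + 6 * a%:Z - 2 = 6 * a%:Z + 2 * z%:Z - 2 by lia.
have -> : 3 * n%:Z + 3 * a%:Z - 2 = 6 * a%:Z + 3 * z%:Z - 2 by lia.
have -> : 2 * 0%N%:Z + z%:Z + 3 * a%:Z - 1 = 3 * a%:Z + z%:Z - 1 by lia.
have -> : 2 * 0%N%:Z + z%:Z + 2 * a%:Z - 1 = (m + a)%N%:Z by lia.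
have -> : 2 * n%:Z + a%:Z - 1 = 3 * a%:Z + 2 * z%:Z - 1 by lia.
have -> : 2 * n%:Z + a%:Z = 3 * a%:Z + 2 * z%:Z by lia.
have -> : 3 * n%:Z = 3 * a%:Z + 3 * z%:Z by lia.
rewrite !(g1_double generic) ffactnn exprD exprVn.
have E : (2 * z + 2 * a)`! = ((2 * n) ^_ n * n`!)%N.
  have h : (n <= 2 * n)%N by lia.
  by rewrite -mulnDr -(ffact_fact h) (_ : (2 * n - n = n)%N) //; lia.
rewrite E !natrM.
have f1 := fact0F int_inj n; have f2 := fact0F int_inj (2 * z).
have f3 : ((2 * n) ^_ n)%:R != 0 :> F by apply: (natr_neq0 int_inj); rewrite ffact_gt0; lia.
have t1 := expf_neq0 m n2; have t2 := expf_neq0 a n2.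
have a1 := gu0 m; have a2 := go0 m; have a3 := gu0 (m + a)%N; have a4 := go0 (m + a)%N.
have a5 := gu0 (2 * n%:Z); have a6 := gu0 (2 * n%:Z - 1).
have a7 := gu0 (3 * a%:Z + 2 * z%:Z - 1); have a8 := gu0 (3 * a%:Z + 2 * z%:Z).
have a9 := g1_0 (6 * a%:Z + 2 * z%:Z - 2).
have a10 := g1_0 (3 * a%:Z + 3 * z%:Z - 2).
move: f1 f2 f3 t1 t2; move: (n`!%:R) ((2 * z)`!%:R) ((2 * n) ^_ n)%:R (2 ^+ m) (2 ^+ a) => F1 F2 F3 T1 T2 f1 f2 f3 t1 t2.
move: a1 a2 a3 a4; move: (gu m) (go m) (gu (m + a)%N) (go (m + a)%N) => G1 G2 G3 G4 a1 a2 a3 a4.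
move: a5 a6 a7 a8 a9 a10; move: (gu (2 * n%:Z)) (gu (2 * n%:Z - 1)) (gu (3 * a%:Z + 2 * z%:Z - 1)) (gu (3 * a%:Z + 2 * z%:Z)) (g1 (6 * a%:Z + 2 * z%:Z - 2)) (g1 (3 * a%:Z + 3 * z%:Z - 2)).
move=> H1 H2 H3 H4 H5 H6 a5 a6 a7 a8 a9 a10.
by field; nonzero.
Qed.

Lemma E4_y0 z a : (0 < a)%N -> E4 u 0 z a = lead u a.-1 * zprod u 0 z a.
Proof.
have n2 : (2%:R : F) != 0 by apply: (natr_neq0 int_inj).
move=> a0; elim: z => [|z IH].
  rewrite zprod0 mulr1 /E4 eqxx [prodz (0%N%:Z - 1) _]prodz_le0 // mulr1 leadE /=.
  have -> : a%:Z - 1 = a.-1%:Z by lia.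
  have -> : a%:Z + 0%N%:Z - 1 = a.-1%:Z by lia.
  by rewrite prodzM exprVn div1r -exprnP mulrA.
rewrite zprodS mulrA -IH /E4 eqxx /=.
have -> : a%:Z + z.+1%:Z - 1 = a%:Z + z%:Z - 1 + 1%N%:Z by lia.
rewrite (two_pow int_inj) expr1.
have p0 : 2 ^ (a%:Z + z%:Z - 1) != 0 :> F by apply: expfz_neq0.
(* The second product stops at [Z - 1], so it is empty for both [z = 0] and [z = 1]; this first step
   is accounted for by the power of 2 alone. *)
case: z {IH} p0 => [|z] p0.
  have -> : 1%N%:Z - 1 = 0 by [].
  rewrite ![prodz 0 _]prodz_le0 // [prodz (0%N%:Z - 1) _]prodz_le0 //.
  rewrite (zratio_z0 int_inj generic) (sig0 generic).
  by field; nonzero.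
have -> : z.+2%:Z - 1 = z%:Z + 1 by lia.
have -> : z.+1%:Z - 1 = z%:Z by lia.
rewrite prodzS zratio_y0 ?addSn //.
have -> : z%:Z + 1 = z.+1%:Z by lia.
rewrite /ifac /facratio (poch_gu generic) (poch_g1 generic) (poch_gu generic).
rewrite abszM [`|2|%N]/=.
set c := 3 * a%:Z + 2 * z.+1%:Z.
have -> : 3 * a%:Z + 2 * z.+1%:Z - 1 + 1 = c by rewrite /c; lia.
have -> : c + (3 * a%:Z + z.+1%:Z - 2 - (3 * a%:Z + 2 * z.+1%:Z - 1)) = 3 * a%:Z + z.+1%:Z - 1 by rewrite /c; lia.
have -> : 6 * a%:Z + 2 * z.+1%:Z - 2 + z.+1%:Z = 6 * a%:Z + 3 * z.+1%:Z - 2 by lia.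
have -> : 3 * a%:Z + 2 * z.+1%:Z - 1 + z.+1%:Z = 3 * a%:Z + 3 * z.+1%:Z - 1 by lia.
have -> : 3 * a%:Z + 3 * z.+1%:Z = 3 * a%:Z + 3 * z.+1%:Z - 1 + 1 by lia.
rewrite guS addrK.
move: p0; move: (2 ^ _) => T p0.
have f1 := fact0F int_inj (2 * z.+1).
have b1 := gu0 c; have b2 := g1_0 (6 * a%:Z + 2 * z.+1%:Z - 2); have b3 := gu0 (c - 1).
by field; nonzero.
Qed.

End E4Closed.

(** * Tilings and nonintersecting paths *)

Section Recursion.
Variable wt : cell -> 'I_3 -> rat.

(** Lozenges are placed one up triangle at a time, [R] holding the down triangles still uncovered;
    the sum over functions becomes a recursion that the sweep can follow. *)
Fixpoint trec (us R : seq cell) : rat :=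
  if us is u :: us' then
    \sum_(d : 'I_3) if nbr u d \in R then wt u d * trec us' (rem (nbr u d) R) else 0
  else (R == [::])%:R.

Lemma perm_cons_rem (T : eqType) (x : T) s t : perm_eq (x :: s) t = (x \in t) && perm_eq s (rem x t).
Proof.
apply/idP/andP => [p|[xt p]].
  have xt : x \in t by rewrite -(perm_mem p) mem_head.
  by split=> //; rewrite -(perm_cons x) (perm_trans p) // perm_to_rem.
by rewrite perm_sym (perm_trans (perm_to_rem xt)) // perm_cons perm_sym.
Qed.

Lemma tgf_trec us R : tgf us R wt = trec us R.
Proof.
elim: us R => [|u us IH] R.
  rewrite /tgf /= (eq_bigl (fun=> R == [::])); last first.
    move=> f; rewrite /is_tiling (_ : enum _ = [::]); last by apply/nilP; rewrite /nilp size_enum_ord.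
    by rewrite /= perm_sym; apply/idP/eqP => [/perm_nilP|->].
  case: (R == [::]); last by rewrite big_pred0.
  rewrite (eq_bigr (fun=> 1)); last by move=> f _; rewrite big_ord0.
  by rewrite sumr_const card_ffun !card_ord expn0.
rewrite /tgf /=.
pose h (p : 'I_3 * {ffun 'I_(size us) -> 'I_3}) : {ffun 'I_(size us).+1 -> 'I_3} :=
  [ffun i => if unlift ord0 i is Some j then p.2 j else p.1].
pose g (f : {ffun 'I_(size us).+1 -> 'I_3}) : 'I_3 * {ffun 'I_(size us) -> 'I_3} :=
  (f ord0, [ffun j => f (lift ord0 j)]).
have gK : cancel g h.
  by move=> f; apply/ffunP => i; rewrite ffunE; case: unliftP => [j ->|->]; rewrite /= ?ffunE.
have hK : cancel h g.
  case=> d f; rewrite /g; congr (_, _); first by rewrite ffunE unlift_none.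
  by apply/ffunP => j; rewrite !ffunE liftK.
rewrite (reindex h) /=; last by exists g => f _; [exact: hK | exact: gK].
rewrite -(pair_big_dep xpredT (fun d f => is_tiling (u :: us) R (h (d, f)))
   (fun d f => \prod_(i < (size us).+1) wt (nth (0, 0) (u :: us) i) (h (d, f) i))) /=.
apply: eq_bigr => d _.
have T f : is_tiling (u :: us) R (h (d, f)) = (nbr u d \in R) && is_tiling us (rem (nbr u d) R) f.
  rewrite /is_tiling -perm_cons_rem enum_ordSl /= ffunE unlift_none -map_comp; congr (perm_eq (_ :: _) _).
  by apply: eq_map => i /=; rewrite ffunE liftK.
under eq_bigl do rewrite T; case: (nbr u d \in R); last by rewrite big_pred0.
rewrite -IH /tgf big_distrr /=; apply: eq_bigr => f _.
rewrite big_ord_recl /= ffunE unlift_none; congr (_ * _).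
by apply: eq_bigr => i _; rewrite ffunE liftK.
Qed.

Lemma perm_rem (T : eqType) (x : T) s t : perm_eq s t -> perm_eq (rem x s) (rem x t).
Proof.
move=> p; case: (boolP (x \in s)) => xs.
  by rewrite -(perm_cons x) -(permPl (perm_to_rem xs)) (perm_trans p) // perm_to_rem // -(perm_mem p).
by rewrite !rem_id // -(perm_mem p).
Qed.

Lemma perm_trec us R R' : perm_eq R R' -> trec us R = trec us R'.
Proof.
elim: us R R' => [|u us IH] R R' p /=.
  by rewrite -!size_eq0 (perm_size p).
by apply: eq_bigr => d _; rewrite (perm_mem p) (IH _ _ (perm_rem _ p)).
Qed.

(** [cellsP] lists the rows from the bottom upwards, while the sweep starts at the top. *)
Lemma tgf_rev us R : tgf (rev us) R wt = tgf us R wt.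
Proof.
have sz := size_rev us; rewrite /tgf.
pose c (i : 'I_(size (rev us))) : 'I_(size us) := rev_ord (cast_ord sz i).
pose c' (i : 'I_(size us)) : 'I_(size (rev us)) := cast_ord (esym sz) (rev_ord i).
have cK : cancel c c' by move=> i; rewrite /c /c' rev_ordK cast_ordK.
have c'K : cancel c' c by move=> i; rewrite /c /c' cast_ordKV rev_ordK.
have nthc i : nth (0, 0) (rev us) (val i) = nth (0, 0) us (val (c i)).
  by rewrite /c /= nth_rev -?sz.
rewrite (reindex (fun f : {ffun 'I_(size us) -> 'I_3} => [ffun i => f (c i)])) /=; last first.
  exists (fun f : {ffun 'I_(size (rev us)) -> 'I_3} => [ffun i => f (c' i)]) => f _; apply/ffunP => i.
    by rewrite !ffunE c'K.
  by rewrite !ffunE cK.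
apply: eq_big => f; last first.
  move=> _; rewrite (reindex c) /=; last by exists c' => i _; [exact: cK | exact: c'K].
  by apply: eq_bigr => i _; rewrite ffunE nthc.
rewrite /is_tiling.
rewrite (eq_map (g := (fun i => nbr (nth (0, 0) us (val i)) (f i)) \o c)); last first.
  by move=> i; rewrite /= ffunE nthc.
rewrite map_comp; apply: permPl; apply: perm_map; apply: uniq_perm.
- by rewrite map_inj_uniq ?enum_uniq //; apply: can_inj cK.
- exact: enum_uniq.
- by move=> i; rewrite mem_enum -(c'K i) map_f // mem_enum.
Qed.

(** Detects wrong choices: a down triangle left without a possible partner makes the count
    vanish. *)
Lemma trec_stuck us R d0 : d0 \in R ->
  (forall u d, u \in us -> nbr u d != d0) -> trec us R = 0.
Proof.
elim: us R => [|u us IH] R dR nb /=; first by case: R dR.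
rewrite big1 // => d _; case: ifP => // dR'; rewrite IH ?mulr0 //.
  have := perm_to_rem dR'; move/perm_mem/(_ d0); rewrite dR inE.
  by rewrite eq_sym (negPf (nb _ _ (mem_head _ _))) /= => <-.
by move=> v e vu; apply: nb; rewrite inE vu orbT.
Qed.
End Recursion.

Definition scan (u v : cell) : bool := (u.2 < v.2)%R || ((u.2 == v.2) && (u.1 < v.1)%R).

Lemma scan_trans : transitive scan.
Proof. by move=> [a b] [c d] [e f]; rewrite /scan /=; lia. Qed.

Lemma scan_irr : irreflexive scan.
Proof. by move=> [a b]; rewrite /scan /=; lia. Qed.

Lemma mem_irange lo hi (c : int) : (c \in irange lo hi) = (lo <= c <= hi)%R.
Proof.
apply/mapP/idP => [[k]|h].
  by rewrite mem_iota => /andP[_]; case: ifP => // h kk -> ; lia.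
by exists (absz (c - lo)); rewrite ?mem_iota; [rewrite ifT; lia | lia].
Qed.

Lemma irange_pairwise lo hi : pairwise <%R (irange lo hi).
Proof.
rewrite /irange pairwise_map.
have := iota_ltn_sorted 0 (if (lo <= hi)%R then absz (hi - lo + 1) else 0%N).
rewrite (sorted_pairwise ltn_trans); apply: sub_pairwise => i j /= ij.
by rewrite ltrD2l ltz_nat.
Qed.

(** * The region and its path starts and ends *)

Section RegionCells.
Variables x y z a : nat.
Hypothesis yz : (1 <= y + z)%N.
Local Notation N := ((y + z + a).-1).
Local Notation En := (En y z a).
Local Notation Eq := (Eq y z a).
Local Notation rowtop := (rowtop y z a).
Local Notation rowmax := (rowmax x y z a).
Local Notation NEup := (NEup x y z a).

Lemma mem_cells t : (t \in cellsP x y z a) = (0 <= t.2 <= 2 * En - 1)%R && (-1 <= t.1 <= rowmax t.2)%R.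
Proof.
case: t => X j /=; apply/flattenP/andP => [[r /mapP[j' jr ->] /mapP[X' Xr [-> ->]]]|[h1 h2]].
  by rewrite -!mem_irange.
exists [seq (X', j) | X' <- irange (-1) (rowmax j)].
  by apply/mapP; exists j; rewrite ?mem_irange.
by apply/mapP; exists X; rewrite ?mem_irange.
Qed.

Lemma cells_scan : pairwise scan (cellsP x y z a).
Proof.
rewrite /cellsP; have := irange_pairwise 0 (2 * En - 1).
elim: (irange 0 (2 * En - 1)) => [//|j js IH] /= /andP[jlt pjs].
rewrite pairwise_cat IH // andbT; apply/andP; split.
  apply/allrelP => [[X i] [X' i']] /mapP[X0 _ [_ ->]] /flattenP[r /mapP[j' j'js ->] /mapP[X1 _ [_ ->]]].
  by rewrite /scan /= (allP jlt).
rewrite pairwise_map; apply: sub_pairwise (irange_pairwise _ _) => X X' h.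
by rewrite /scan /= eqxx h orbT.
Qed.

Lemma cells_uniq : uniq (cellsP x y z a).
Proof. exact: (pairwise_uniq scan_irr cells_scan). Qed.

Lemma ups_sorted : pairwise (fun u v => scan v u) (rev (Eups x y z a)).
Proof.
rewrite -sorted_pairwise; last by move=> u v w h1 h2; apply: scan_trans h2 h1.
rewrite -rev_sorted revK sorted_pairwise; last exact: scan_trans.
exact: pairwise_filter cells_scan.
Qed.

Lemma EnE : En = N%:Z.
Proof. by rewrite /Defs.En; lia. Qed.

Lemma rowmax_le (X j : int) : (X <= rowmax j)%R =
  (X <= 2 * x%:Z + 3 * rowtop j - 1)%R && (X <= 2 * x%:Z + 4 * Eq - 4 - rowtop j)%R.
Proof. by rewrite /Defs.rowmax -lerBlDl le_min; apply/andP/andP; lia. Qed.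

Lemma NEupE (X j : int) : NEup (X, j) =
  [&& (j <= 2 * N%:Z - 1)%R, (2 * N%:Z - 1 - j < (y + z + 2 * a)%:Z - 1)%R
    & X == 2 * x%:Z + 3 * (2 * N%:Z - 1 - j) - 1].
Proof. by rewrite /Defs.NEup /Defs.rowtop EnE /Defs.Eq /=; apply/idP/idP; lia. Qed.

Lemma mem_ups (X j : int) : ((X, j) \in Eups x y z a) =
  [&& (0 <= j)%R, (j <= 2 * N%:Z - 1)%R, (-1 <= X)%R, (X <= 2 * x%:Z + 3 * (2 * N%:Z - 1 - j) - 1)%R,
   (X <= 2 * x%:Z + 4 * ((y + z + 2 * a)%:Z - 1) - 4 - (2 * N%:Z - 1 - j))%R, ~~ odd (absz (X + j)) &
   ~~ (NEup (X, j) && ((y + a)%:Z <= 2 * N%:Z - j <= (y + 2 * a)%:Z - 1)%R)].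
Proof.
rewrite mem_filter mem_cells rowmax_le /Defs.removed /Defs.rowtop EnE /Defs.Eq /=.
case: (NEup (X, j)); case: (odd _) => //=; apply/idP/idP; lia.
Qed.

Lemma mem_downs (X j : int) : ((X, j) \in Edowns x y z a) =
  [&& (0 <= j)%R, (j <= 2 * N%:Z - 1)%R, (-1 <= X)%R, (X <= 2 * x%:Z + 3 * (2 * N%:Z - 1 - j) - 1)%R,
   (X <= 2 * x%:Z + 4 * ((y + z + 2 * a)%:Z - 1) - 4 - (2 * N%:Z - 1 - j))%R & odd (absz (X + j))].
Proof.
rewrite mem_filter mem_cells rowmax_le /Defs.rowtop EnE /Defs.Eq /=.
case: (odd _) => //=; apply/idP/idP; lia.
Qed.

(** Only even rows begin with a down triangle, [(-1, j)]; its label is the position [(-2, j)] just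
    outside the region. *)
Definition west_end (k : nat) : cell := (- 2%:Z, 2 * N%:Z - 2 - 2 * k%:Z).
Definition ends : seq cell := [seq west_end k | k <- iota 0 N].
Definition start (i : nat) : cell :=
  (2 * x%:Z + 3 * (row_index y a i)%:Z - 4, 2 * N%:Z - (row_index y a i)%:Z).

Lemma mem_ends (X j : int) : ((X, j) \in ends) =
  [&& X == - 2%:Z, (0 <= j)%R, (j <= 2 * N%:Z - 1)%R & ~~ odd (absz j)].
Proof.
apply/mapP/idP => [[k]|/and4P[/eqP -> j0 jN ej]].
  by rewrite mem_iota /= => kN [-> ->]; rewrite eqxx /=; apply/and3P; split; lia.
exists (absz (N%:Z - 1 - (j %/ 2)%Z)%R); first by rewrite mem_iota; lia.
by congr (_, _); lia.
Qed.

Lemma ends_uniq : uniq ends.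
Proof. by rewrite map_inj_uniq ?iota_uniq // => i j [] /eqP; lia. Qed.

Lemma start_NE (i : 'I_N) : NEup (start i).
Proof. by rewrite /start NEupE /row_index; have := ltn_ord i; case: ifP; lia. Qed.

Lemma start_ups (i : 'I_N) : start i \in Eups x y z a.
Proof.
rewrite /start mem_ups NEupE /row_index; have := ltn_ord i.
by case: ifP; lia.
Qed.

Lemma NE_start (u : cell) : u \in Eups x y z a -> NEup u -> exists i : 'I_N, u = start i.
Proof.
case: u => X j; rewrite mem_ups => h ne; move: h; rewrite ne /= => h.
have [I eI] : exists I : nat, I%:Z = 2 * N%:Z - j by exists (absz (2 * N%:Z - j)%R); lia.
move: ne; rewrite NEupE => ne.
have lI : (I.-1 - (if (I < y + a)%N then 0 else a) < N)%N by case: ifP; lia.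
exists (Ordinal lI); rewrite /start /row_index /=.
by congr (_, _); case: ifP; case: ifP; lia.
Qed.

(** A lozenge of direction 0 at [u] covers [east (u.1 - 2, u.2)], one of direction 2 covers
    [east (u.1 - 1, u.2 - 1)], and one of direction 1 covers [east u]. The first two labels are thus
    the possible next positions of a path at [u]. *)
Lemma west_label u : u \in Eups x y z a -> u.1 != - 1%:Z ->
  (u.1 - 2, u.2) \in Eups x y z a \/ (u.1 - 2, u.2) \in ends.
Proof.
case: u => X j; rewrite /= !mem_ups mem_ends !NEupE => h X1.
case: (X =P 0) => X0; [right | left]; lia.
Qed.

Lemma south_label u : u \in Eups x y z a -> u.2 != 0 ->
  (u.1 - 1, u.2 - 1) \in Eups x y z a \/ (u.1 - 1, u.2 - 1) \in ends.
Proof.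
case: u => X j; rewrite /= !mem_ups mem_ends !NEupE => h X1.
case: (X =P - 1%:Z) => X0; [right | left]; lia.
Qed.

(** With [south_notNE]: no step leads to the northeastern side, so the weight 1/2 can occur only in
    the first step of a path. *)
Lemma west_notNE u : u \in Eups x y z a -> ~~ NEup (u.1 - 2, u.2).
Proof. by case: u => X j; rewrite /= !mem_ups !NEupE; lia. Qed.

Lemma south_notNE u : u \in Eups x y z a -> ~~ NEup (u.1 - 1, u.2 - 1).
Proof. by case: u => X j; rewrite /= !mem_ups !NEupE; lia. Qed.

(* A down triangle [east p] is labelled by the position [p] of the up triangle west of it; on the
   western side this position lies outside the region and is listed in [ends]. *)
Definition east (p : cell) : cell := (p.1 + 1, p.2).

(** An up triangle of the northeastern side has no down triangle of the region to its east; so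
    initially the starts are exactly the labels without a down triangle. *)
Lemma downs_east : perm_eq (Edowns x y z a)
  [seq east p | p <- [seq p <- rev (Eups x y z a) ++ ends | p \notin codom (fun i : 'I_N => start i)]].
Proof.
have ue : uniq (rev (Eups x y z a) ++ ends).
  rewrite cat_uniq rev_uniq filter_uniq ?cells_uniq // ends_uniq andbT; apply/hasPn => [[X j]].
  by rewrite mem_ends mem_rev mem_ups; lia.
apply: uniq_perm.
- exact: filter_uniq cells_uniq.
- rewrite map_inj_uniq ?filter_uniq // => [[X j] [X' j']] [] h ->; congr (_, _); lia.
case=> X j; rewrite mem_downs; apply/idP/mapP => [h|[[X' j']]].
  exists (X - 1, j); last by rewrite /east /= subrK.
  rewrite mem_filter; apply/andP; split.
    apply/negP => /codomP[i ei]; have := start_NE i; rewrite -ei NEupE; lia.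
  by rewrite mem_cat mem_rev mem_ups mem_ends NEupE; case: (X =P - 1%:Z) => X1; lia.
rewrite mem_filter mem_cat mem_rev => /andP[ns lab] [-> ->].
case/orP: lab => [up|]; last by rewrite mem_ends; lia.
have nNE : ~~ NEup (X', j').
  apply: contra ns => ne; have [i ->] := NE_start up ne.
  exact: codom_f.
by move: up nNE; rewrite mem_ups NEupE; lia.
Qed.
End RegionCells.

Lemma incr_ord_ge n (f : 'I_n -> 'I_n) : (forall i j : 'I_n, (i < j)%N -> (f i < f j)%N) ->
  forall i : 'I_n, (i <= f i)%N.
Proof.
move=> mf [m mn]; elim: m mn => [//|m IH] mn /=.
exact: leq_ltn_trans (IH (ltnW mn)) (mf (Ordinal (ltnW mn)) (Ordinal mn) (ltnSn m)).
Qed.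

(** The lower bound [incr_ord_ge], applied to [f] conjugated by [rev_ord], is the upper bound. *)
Lemma incr_ord_id n (f : 'I_n -> 'I_n) : (forall i j : 'I_n, (i < j)%N -> (f i < f j)%N) ->
  forall i, f i = i.
Proof.
move=> mf i; apply: val_inj; apply/eqP; rewrite eqn_leq (incr_ord_ge mf i) andbT.
have mg (k l : 'I_n) : (k < l)%N -> (rev_ord (f (rev_ord k)) < rev_ord (f (rev_ord l)))%N.
  move=> kl; have /= := mf (rev_ord l) (rev_ord k); have := ltn_ord (f (rev_ord k)); have := ltn_ord (f (rev_ord l)).
  by have := ltn_ord k; have := ltn_ord l; lia.
have /= := incr_ord_ge mg (rev_ord i); rewrite rev_ordK.
by have := ltn_ord i; have := ltn_ord (f i); lia.
Qed.

(** * The sweep from tilings to a determinant *)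

Section PathCount.
Variables x y z a : nat.
Hypothesis yz : (1 <= y + z)%N.
Local Notation N := ((y + z + a).-1).
Local Notation Eups := (Eups x y z a).
Local Notation NEup := (NEup x y z a).
Local Notation ends := (ends y z a).
Local Notation west_end := (west_end y z a).
Local Notation wt := (Ewt x y z a).

(* Number of paths from [p] to [west_end k] by steps (-2, 0) and (-1, -1). *)
Definition npaths (p : cell) (k : nat) : rat :=
  let d := p.2 - (2 * N%:Z - 2 - 2 * k%:Z) in let w := p.1 - d + 2 in
  if (0 <= d)%R && (0 <= w)%R then ('C(absz d + (absz w)./2, absz d))%:R else 0.

Definition wpaths (p : cell) (k : nat) : rat :=
  if NEup p then 1 / 2%:R * npaths (p.1 - 2, p.2) k + npaths (p.1 - 1, p.2 - 1) k else npaths p k.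

(** Pascal's rule. The bound on [X] excludes the endpoints, where the empty path breaks the
    recursion. *)
Lemma npaths_pascal (X j : int) k : ~~ odd (absz (X + j)) -> (-1 <= X)%R ->
  npaths (X, j) k = npaths (X - 2, j) k + npaths (X - 1, j - 1) k.
Proof.
move=> pXj X1; rewrite /npaths /=; set e := 2 * N%:Z - 2 - 2 * k%:Z.
have -> : X - 1 - (j - 1 - e) + 2 = X - (j - e) + 2 by lia.
have -> : j - 1 - e = j - e - 1 by lia.
have -> : X - 2 - (j - e) + 2 = X - (j - e) + 2 - 2 by lia.
have pw : ~~ odd (absz (X - (j - e) + 2)) by rewrite /e; lia.
have pos : (0 < (j - e) + (X - (j - e) + 2))%R by lia.
move: (j - e) (X - (j - e) + 2) pw pos => d w pw pos.
case: (lerP 0 d) => d0; last first.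
  by rewrite (_ : (0 <= d - 1)%R = false) /= ?addr0 //; lia.
case: (lerP 0 w) => w0 /=; last first.
  by rewrite (_ : (0 <= w - 2)%R = false) ?andbF ?addr0 //; lia.
have [m em] : exists m : nat, w = (2 * m)%:Z by exists (absz w)./2; lia.
have [n en] : exists n : nat, d = n%:Z by exists (absz d); lia.
rewrite em en in pos *.
have half2 l : (absz (2 * l)%N%:Z)./2 = l by rewrite absz_nat mul2n doubleK.
case: m em pos => [|m] em pos.
  rewrite (_ : (0 <= (2 * 0)%N%:Z - 2)%R = false) /= ?add0r; last by lia.
  case: n en pos => [|n] en pos; first by lia.
  rewrite (_ : n.+1%:Z - 1 = n%:Z) /= ?addn0 ?binn //; lia.
have -> : (2 * m.+1)%N%:Z - 2 = (2 * m)%N%:Z by lia.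
rewrite !half2 !absz_nat /=.
case: n en pos => [|n] en pos; first by rewrite !bin0 addr0.
have -> : n.+1%:Z - 1 = n%:Z by lia.
rewrite !absz_nat (_ : (n.+1 + m.+1 = (n + m.+1).+1)%N) // binS natrD; congr (_%:R + _).
by congr ('C(_, _)); lia.
Qed.

Lemma npaths_west j k : npaths (- 3%:Z, j) k = 0.
Proof. by rewrite /npaths /= ifF //; lia. Qed.

Lemma npaths_south (X : int) (k : 'I_N) : npaths (X, - 1%:Z) k = 0.
Proof. by rewrite /npaths /= ifF //; have := ltn_ord k; lia. Qed.

Lemma npaths_end (i k : 'I_N) : npaths (west_end i) k = (i == k)%:R.
Proof.
rewrite /npaths /=; case: eqP => [->|/eqP ne]; first by rewrite subrr.
rewrite ifF //; move: ne; rewrite -(inj_eq val_inj) /=; lia.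
Qed.

Lemma wpaths_rec (u : cell) k : u \in Eups ->
  wpaths u k = wt u ord0 * wpaths (u.1 - 2, u.2) k + wpaths (u.1 - 1, u.2 - 1) k.
Proof.
move=> uE; rewrite /wpaths (negPf (west_notNE yz uE)) (negPf (south_notNE yz uE)) /Ewt /=.
case: (NEup u) => //; rewrite mul1r; case: u uE => X j; rewrite mem_ups // => h.
by apply: npaths_pascal; lia.
Qed.

(** The order in which the tips stay throughout the sweep. It forces the [i]-th path to end at the
    [i]-th endpoint, so no permutation signs arise. *)
Definition lex (p q : cell) : bool := (q.2 < p.2)%R || ((p.2 == q.2) && (p.1 < q.1)%R).

(** The uncovered down triangles are recovered from the up triangles still to come and the tips, so
    the state of the sweep is [us] and [s] alone. *)
Definition free (us : seq cell) (s : 'I_N -> cell) : seq cell :=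
  [seq east p | p <- us ++ ends & p \notin codom s].

Definition upd (s : 'I_N -> cell) i0 p : 'I_N -> cell := fun i => if i == i0 then p else s i.

Definition paths_mx (s : 'I_N -> cell) : 'M[rat]_N := \matrix_(i, k) wpaths (s i) k.

Lemma east_inj : injective east.
Proof. by move=> [X j] [X' j'] [] h ->; congr (_, _); lia. Qed.

Lemma lex_inj (s : 'I_N -> cell) : (forall i j : 'I_N, (i < j)%N -> lex (s i) (s j)) -> injective s.
Proof.
move=> ls i j e; apply: val_inj => /=; have irr p : lex p p = false by rewrite /lex; lia.
by case: (ltngtP i j) => // h; [have := ls _ _ h | have := ls _ _ h]; rewrite e irr.
Qed.

Lemma codom_upd (s : 'I_N -> cell) i0 p q : injective s ->
  (q \in codom (upd s i0 p)) = (q == p) || ((q \in codom s) && (q != s i0)).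
Proof.
move=> si; apply/codomP/orP => [[i]|[/eqP ->|/andP[/codomP[i ->] ne]]].
- rewrite /upd; case: eqP => [_ ->|ne ->]; [by left | right].
  by rewrite codom_f (inj_eq si); apply/eqP.
- by exists i0; rewrite /upd eqxx.
- by exists i; rewrite /upd; case: (i =P i0) ne => [->|//]; rewrite eqxx.
Qed.

Lemma base_case (s : 'I_N -> cell) : (forall i, s i \in ends) ->
  (forall i j : 'I_N, (i < j)%N -> lex (s i) (s j)) -> trec wt [::] (free [::] s) = \det (paths_mx s).
Proof.
move=> se ls.
have ex i : exists k : 'I_N, s i == west_end k.
  have /mapP[k] := se i; rewrite mem_iota /= => kN ->.
  by exists (Ordinal kN).
pose f i := xchoose (ex i); have fE i : s i = west_end (f i) by apply/eqP; apply: (xchooseP (ex i)).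
have fid : forall i, f i = i.
  apply: incr_ord_id => i j ij; have := ls _ _ ij; rewrite !fE /lex /west_end /=; lia.
have sE i : s i = west_end i by rewrite fE fid.
have -> : free [::] s = [::].
  rewrite /free (eq_in_filter (a2 := pred0)) ?filter_pred0 // => p /mapP[k].
  rewrite mem_iota /= => kN ->; apply/negbF; rewrite -[west_end k]/(west_end (Ordinal kN)) -sE.
  exact: codom_f.
rewrite /= (_ : paths_mx s = 1%:M) ?det1 //; apply/matrixP => i k; rewrite !mxE sE /wpaths ifF ?npaths_end //.
by rewrite /west_end NEupE //; have := ltn_ord i; lia.
Qed.

Lemma labels_uniq pre us : rev Eups = pre ++ us -> uniq (us ++ ends).
Proof.
move=> eE; have u1 : uniq (rev Eups) by rewrite rev_uniq filter_uniq // cells_uniq.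
rewrite cat_uniq ends_uniq // andbT; apply/andP; split.
  by move: u1; rewrite eE cat_uniq => /and3P[].
apply/hasPn => [[X j]] pe; apply/negP => pu.
have : (X, j) \in rev Eups by rewrite eE mem_cat pu orbT.
by move: pe; rewrite mem_rev mem_ends // mem_ups //; lia.
Qed.

Lemma free_uniq pre us s : rev Eups = pre ++ us -> uniq (free us s).
Proof.
by move=> /labels_uniq ul; rewrite /free map_inj_uniq ?filter_uniq //; apply: east_inj.
Qed.

Lemma mem_free us s p : (east p \in free us s) = (p \notin codom s) && (p \in us ++ ends).
Proof. by rewrite /free (mem_map east_inj) mem_filter. Qed.

Lemma free_upd pre u us (s : 'I_N -> cell) i0 p :
  rev Eups = pre ++ u :: us -> injective s -> s i0 = u -> p \in us ++ ends -> p \notin codom s ->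
  perm_eq (rem (east p) (free (u :: us) s)) (free us (upd s i0 p)).
Proof.
move=> eE si su pl pns.
have eE' : rev Eups = rcons pre u ++ us by rewrite cat_rcons.
have u1 := free_uniq s eE; have u2 := free_uniq (upd s i0 p) eE'.
apply: uniq_perm => //; first exact: rem_uniq.
move=> [X j]; have -> : (X, j) = east (X - 1, j) by rewrite /east /= subrK.
move: (X - 1, j) => q; rewrite mem_rem_uniq // inE /= (inj_eq east_inj) !mem_free codom_upd // su.
have ul := labels_uniq eE; have us0 : u \in codom s by rewrite -su codom_f.
rewrite cat_cons inE; case: (q =P u) => [->|_] /=.
  by move: ul; rewrite cat_cons /= => /andP[/negPf -> _]; rewrite us0 !andbF.
by rewrite andbT negb_or -andbA.
Qed.

(** Splitting a row according to the first step of its path is the counterpart, on the determinant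
    side, of choosing a lozenge in [trec]. *)
Lemma paths_mx_upd (s : 'I_N -> cell) i0 : s i0 \in Eups ->
  \det (paths_mx s) = wt (s i0) ord0 * \det (paths_mx (upd s i0 ((s i0).1 - 2, (s i0).2))) +
     \det (paths_mx (upd s i0 ((s i0).1 - 1, (s i0).2 - 1))).
Proof.
move=> uE; rewrite -[X in _ + X]mul1r; apply: (determinant_multilinear (i0 := i0)).
- by apply/rowP => k; rewrite !mxE /upd eqxx mul1r wpaths_rec.
- by apply/matrixP => i k; rewrite !mxE /upd eq_sym (negPf (neq_lift _ _)).
- by apply/matrixP => i k; rewrite !mxE /upd eq_sym (negPf (neq_lift _ _)).
Qed.

Lemma paths_mx_upd0 (s : 'I_N -> cell) i0 p : p \in codom s -> p != s i0 -> \det (paths_mx (upd s i0 p)) = 0.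
Proof.
case/codomP => i1 -> ne; have i10 : i1 != i0 by apply: contraNneq ne => ->.
apply: (determinant_alternate (i1 := i0) (i2 := i1)); first by rewrite eq_sym.
by move=> k; rewrite !mxE /upd eqxx (negPf i10).
Qed.

Lemma paths_mx_dead (s : 'I_N -> cell) i0 p : (forall k : 'I_N, wpaths p k = 0) -> \det (paths_mx (upd s i0 p)) = 0.
Proof.
by move=> p0; rewrite (expand_det_row _ i0) big1 // => k _; rewrite mxE /upd eqxx p0 mul0r.
Qed.

(* Up triangles are removed row by row from the top, right to left, [pre] being already gone. The
   tips [s] of the partial paths are the labels of the down triangles already covered. If the next triangle [u] is
   not a tip, it must cover [east u], since no later triangle can. If it is a tip, its path steps
   west or southwest; stepping onto another tip gives a repeated row, hence determinant 0. *)
Lemma trec_det us pre (s : 'I_N -> cell) :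
  rev Eups = pre ++ us -> (forall i, s i \in us ++ ends) ->
  (forall i j : 'I_N, (i < j)%N -> lex (s i) (s j)) ->
  (forall i, [|| NEup (s i), ((s i).1 + 2, (s i).2) \in pre | ((s i).1 + 1, (s i).2 + 1) \in pre]) ->
  trec wt us (free us s) = \det (paths_mx s).
Proof.
elim: us pre s => [|u us IH] pre s eE sl ls pr; first exact: base_case.
have eE' : rev Eups = rcons pre u ++ us by rewrite cat_rcons.
have si := lex_inj ls.
have uE : u \in Eups by rewrite -mem_rev eE mem_cat mem_head orbT.
have := ups_sorted x y z a; rewrite eE pairwise_cat /= => /and4P[/allrelP prs _ /allP usc _].
have later v : v \in Eups -> scan v u -> v \in us.
  move=> vE vu; move: vE; rewrite -mem_rev eE mem_cat inE => /or3P[vp|/eqP vu'|//].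
    have := prs _ _ vp (mem_head u us); have := scan_trans vu; rewrite /= => h1 /h1.
    by rewrite scan_irr.
  by move: vu; rewrite vu' scan_irr.
have pres v : v \in pre -> scan u v by move=> vp; apply: prs vp (mem_head _ _).
have unl : u \notin us ++ ends by have := labels_uniq eE; rewrite cat_cons /= => /andP[].
case: (boolP (u \in codom s)) => us0; last first.
  have -> : free (u :: us) s = east u :: free us s by rewrite /free cat_cons /= us0.
  rewrite /=.
  (* Later triangles lie in lower rows or further left in the same row, and none of them touches
     [east u]. *)
  have nbrE d : nbr u d != east u -> (if nbr u d \in east u :: free us s then wt u d * trec wt us (rem (nbr u d) (east u :: free us s)) else 0) = 0.
    move=> ne; case: ifP => // _; rewrite (@trec_stuck wt us _ (east u)) ?mulr0 //=.
      by rewrite eq_sym (negPf ne) mem_head.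
    move=> v [e le] /usc; rewrite /scan /nbr /east; case: v u {eE eE' uE later pres unl us0 IH sl ls pr prs usc ne d} => X j [X' j'] /=.
    by case: e le => [|[|e]] _ /= h; apply/eqP => -[]; lia.
  rewrite !big_ord_recl big_ord0 addr0.
  rewrite nbrE ?add0r; last by rewrite /nbr /east /=; apply/eqP => -[]; lia.
  rewrite [X in _ + X]nbrE ?addr0; last by rewrite /nbr /east /=; apply/eqP => -[]; lia.
  have -> : nbr u (lift ord0 ord0) = east u by [].
  have -> : wt u (lift ord0 ord0) = 1 by [].
  rewrite mem_head mul1r [rem _ _]/= eqxx.
  apply: (IH (rcons pre u)) => // i.
    have := sl i; rewrite cat_cons inE => /orP[/eqP e|//].
    by move: us0; rewrite -e codom_f.
  by have := pr i; rewrite !mem_rcons !inE => /or3P[->|->|->]; rewrite ?orbT.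
have [i0 su] : exists i0, s i0 = u by have /codomP[i ->] := us0; exists i.
have step p : p \in us ++ ends -> p \notin codom s ->
  (forall i, i != i0 -> (lex (s i) u -> lex (s i) p) /\ (lex u (s i) -> lex p (s i))) ->
  ((p.1 + 2, p.2) == u) || ((p.1 + 1, p.2 + 1) == u) ->
  trec wt us (rem (east p) (free (u :: us) s)) = \det (paths_mx (upd s i0 p)).
  move=> pl pns lp pu; rewrite (perm_trec _ _ (free_upd eE si su pl pns)).
  apply: (IH (rcons pre u)) => // [i|i j ij|i].
  - rewrite /upd; case: eqP => // /eqP ne; have := sl i; rewrite cat_cons inE => /orP[/eqP e|//].
    by move: ne; rewrite -(inj_eq si) su e eqxx.
  - rewrite /upd; case: (i =P i0) => [ei|/eqP ni]; case: (j =P i0) => [ej|/eqP nj].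
    + by move: ij; rewrite ei ej ltnn.
    + by have [_] := lp _ nj; apply; rewrite -su -ei; apply: ls.
    + by have [h _] := lp _ ni; apply: h; rewrite -su -ej; apply: ls.
    + exact: ls.
  - rewrite /upd; case: eqP => [_|_]; rewrite !mem_rcons !inE.
      by case/orP: pu => ->; rewrite ?orbT.
    by have /or3P[->|->|->] := pr i; rewrite ?orbT.
rewrite (paths_mx_upd (i0 := i0)) su //= !big_ord_recl big_ord0 addr0.
have parity q : q \in us ++ ends -> ~~ odd (absz (q.1 + q.2)) /\ (- 2%:Z <= q.1)%R.
  case: q => X j; rewrite mem_cat mem_ends // => /orP[qu|]; last by rewrite /=; lia.
  have : (X, j) \in rev Eups by rewrite eE mem_cat inE qu !orbT.
  by rewrite mem_rev mem_ups //= ; lia.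
have parityu : ~~ odd (absz (u.1 + u.2)) /\ (- 1%:Z <= u.1)%R /\ (0 <= u.2)%R.
  by case: u uE {IH eE sl eE' prs usc later pres unl us0 su step} => X j; rewrite mem_ups //=; lia.
have sl' i : i != i0 -> s i \in us ++ ends.
  move=> ne; have := sl i; rewrite cat_cons inE => /orP[/eqP e|//].
  by move: ne; rewrite -(inj_eq si) su e eqxx.
(* Labels in one row have equal parity, so a tip left of [u] is at most at [u.1 - 2], and that
   position is assumed not to be a tip. *)
have lexW i : i != i0 -> (u.1 - 2, u.2) \notin codom s ->
    (lex (s i) u -> lex (s i) (u.1 - 2, u.2)) /\ (lex u (s i) -> lex (u.1 - 2, u.2) (s i)).
  move=> ne nW; have : s i != (u.1 - 2, u.2) by apply: contraNneq nW => <-; apply: codom_f.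
  have := parity _ (sl' _ ne); case: (s i) => X j; rewrite /lex xpair_eqE /=.
  by case: parityu; lia.
(* Here the last hypothesis is needed: a tip in the row below [u] is a start or was reached from a
   triangle already removed, hence lies to the right of the southwest target of [u]. *)
have lexS i : i != i0 ->
    (lex (s i) u -> lex (s i) (u.1 - 1, u.2 - 1)) /\ (lex u (s i) -> lex (u.1 - 1, u.2 - 1) (s i)).
  move=> ne; split; first by rewrite /lex /=; lia.
  have same : s i \in us ++ ends -> (s i).2 = u.2 -> ((s i).1 < u.1)%R.
    rewrite mem_cat => /orP[/usc|]; first by rewrite /scan; lia.
    by case: (s i) => X j; rewrite mem_ends //=; lia.
  move/(_ (sl' _ ne)): same; have := pr i.
  case: (s i) => X j /= /or3P[|/pres|/pres]; rewrite /scan /lex /= ?NEupE //; try lia.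
  by case: u uE {IH eE sl eE' prs usc later pres unl us0 su step lexW parityu parity sl'} => X' j' /=; rewrite mem_ups //; lia.
(* Three cases agree on both sides: [p] is another tip (covered, and two equal rows), [p] is a label
   (induction), or the step leaves the region (zero row). *)
have term d p : nbr u d = east p -> p != u -> (p \in us ++ ends) \/ (forall k : 'I_N, wpaths p k = 0) ->
    ((p.1 + 2, p.2) == u) || ((p.1 + 1, p.2 + 1) == u) ->
    (p \notin codom s -> forall i, i != i0 -> (lex (s i) u -> lex (s i) p) /\ (lex u (s i) -> lex p (s i))) ->
    (if nbr u d \in free (u :: us) s then wt u d * trec wt us (rem (nbr u d) (free (u :: us) s)) else 0) =
    wt u d * \det (paths_mx (upd s i0 p)).
  move=> -> pu lab step_pu lp; rewrite mem_free cat_cons inE (negPf pu).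
  case: (boolP (p \in codom s)) => ps /=; first by rewrite paths_mx_upd0 ?mulr0 // su.
  case: lab => [pl|p0]; first by rewrite pl step //; apply: lp.
  by case: ifP => [pl|_]; [rewrite step //; apply: lp | rewrite paths_mx_dead ?mulr0].
rewrite (term ord0 (u.1 - 2, u.2)); first last.
- by move=> nW i ne; apply: lexW.
- by rewrite /= subrK -surjective_pairing eqxx.
- case: (u.1 =P - 1%:Z) => [u1|/eqP u1].
    right=> k; rewrite /wpaths (negPf (west_notNE yz uE)) u1.
    by rewrite (_ : - 1%:Z - 2 = - 3%:Z) // npaths_west.
  left; rewrite mem_cat; have [wE|->] := west_label yz uE u1; last by rewrite orbT.
  by rewrite later // /scan /=; lia.
- by case: (u) => X j; rewrite xpair_eqE /=; lia.
- by rewrite /nbr /east /=; congr (_, _); lia.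
(* Direction 1 contributes nothing, since [east u] is already covered when [u] is a tip. *)
congr (_ + _); rewrite mem_free us0 /= add0r.
rewrite (term _ (u.1 - 1, u.2 - 1)); first last.
- by move=> _; apply: lexS.
- by rewrite /= !subrK -surjective_pairing eqxx orbT.
- case: (u.2 =P 0) => [u2|/eqP u2].
    right=> k; rewrite /wpaths (negPf (south_notNE yz uE)) u2 sub0r.
    by rewrite npaths_south.
  left; rewrite mem_cat; have [wE|->] := south_label yz uE u2; last by rewrite orbT.
  by rewrite later // /scan /=; lia.
- by case: (u) => X j; rewrite xpair_eqE /=; lia.
- by rewrite /nbr /east /=; congr (_, _); lia.
by rewrite /Ewt /= mul1r.
Qed.
End PathCount.

Lemma row_index_gt0 y a i : (0 < row_index y a i)%N.
Proof. by rewrite /row_index; case: ifP. Qed.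

Lemma gbin_nat (n e : nat) : gbin (n%:R : rat) e = 'C(n, e)%:R.
Proof.
have e0 : (e`!)%:R != 0 :> rat by rewrite pnatr_eq0 -lt0n fact_gt0.
rewrite /gbin; apply: (canLR (mulfK e0)); rewrite -natrM bin_ffact.
elim: e {e0} => [|e IH]; first by rewrite big_ord0.
rewrite big_ord_recr /= IH ffactnSr natrM; case: (leqP e n) => en; first by rewrite natrB.
by rewrite ffact_small // !mul0r.
Qed.

Section Assembly.
Variables x y z a : nat.
Hypothesis yz : (1 <= y + z)%N.
Local Notation N := ((y + z + a).-1).

(** After either first step from row index [I], a path to endpoint [k] has [x + I + k - 1] steps
    left, the common upper argument in [ent]; the lower arguments count the southwest steps among
    them. *)
Lemma wpaths_start (i k : 'I_N) :
  wpaths x y z a (start x y z a i) k = path_mx (x%:R : rat) y z a i k.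
Proof.
rewrite /wpaths start_NE // mxE /ent /npaths /start /=.
have := row_index_gt0 y a i; move: (row_index y a i) => I I0.
have -> : (x%:R : rat) + (I + k.+1)%:R - 2%:R = (x + (I + k.+1 - 2))%:R.
  by rewrite [in RHS]natrD natrB ?addrA //; lia.
rewrite !gbin_nat; set c := 2 * N%:Z - 2 - 2 * k%:Z.
have -> : 2 * N%:Z - I%:Z - c = 2 * k.+1%:Z - I%:Z by rewrite /c; lia.
have -> : 2 * N%:Z - I%:Z - 1 - c = 2 * k.+1%:Z - I%:Z - 1 by rewrite /c; lia.
have binE (d w : int) (e : nat) : d = e%:Z ->
    w = 2 * ((x + (I + k.+1 - 2))%:Z - e%:Z) ->
    (if (0 <= d)%R && (0 <= w)%R then 'C(absz d + (absz w)./2, absz d)%:R else 0) =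
    'C(x + (I + k.+1 - 2), e)%:R :> rat.
  move=> -> ->; rewrite absz_nat; case: (leqP e (x + (I + k.+1 - 2))) => h.
    rewrite ifT; last by lia.
    by congr ('C(_, _)%:R); lia.
  by rewrite [in RHS]bin_small // ifF //; lia.
case: (leqP I (2 * k.+1)) => ik; last first.
  rewrite ifF; last by lia.
  by rewrite ifF ?mulr0 ?addr0 //; lia.
rewrite (binE _ _ (2 * k.+1 - I)%N); [|lia|lia].
rewrite mulrC mulrA mulr1; congr (_ + _).
case: ltnP => ik'; last by rewrite ifF //; lia.
by rewrite (binE _ _ (2 * k.+1 - I - 1)%N) //; lia.
Qed.

Lemma Etgf_det : Etgf x y z a = \det (path_mx (x%:R : rat) y z a).
Proof.
rewrite /Etgf -tgf_rev tgf_trec (perm_trec _ _ (downs_east x a yz)).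
rewrite (@trec_det x y z a yz _ [::] (fun i : 'I_N => start x y z a i)) //.
- by congr (\det _); apply/matrixP => i k; rewrite mxE wpaths_start.
- by move=> i; rewrite mem_cat mem_rev start_ups.
- move=> i j ij; rewrite /lex /start /row_index /=; apply/orP; left.
  by case: ifP; case: ifP; lia.
- by move=> i; rewrite start_NE.
Qed.
End Assembly.

(** * Specialization of the indeterminate *)

Section Morphism.
Variables (R S : comUnitRingType) (f : {rmorphism R -> S}).
Hypothesis unitR : forall n, (0 < n)%N -> (n%:R : R) \is a GRing.unit.

Lemma rmorph_gbin v e : f (gbin v e) = gbin (f v) e.
Proof.
rewrite /gbin rmorphM rmorphV ?unitR ?fact_gt0 // rmorph_nat rmorph_prod; congr (_ / _).
by apply: eq_bigr => j _; rewrite rmorphB rmorph_nat.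
Qed.

(** The entries divide only by 2 and by factorials, so they are preserved by every morphism from a
    ring in which positive integers are units. *)
Lemma rmorph_det_path u y z a : f (\det (path_mx u y z a)) = \det (path_mx (f u) y z a).
Proof.
rewrite -det_map_mx; congr (\det _); apply/matrixP => i k; rewrite !mxE /ent.
case: ifP => _; last exact: rmorph0.
have -> : f u + (row_index y a i + k.+1)%:R - 2 = f (u + (row_index y a i + k.+1)%:R - 2).
  by rewrite [RHS]rmorphB [X in _ = X - _]rmorphD !rmorph_nat.
rewrite [LHS]rmorphD [X in X + _ = _]rmorphM rmorphV ?unitR // rmorph_nat !rmorph_gbin.
by case: ifP; rewrite ?rmorph_gbin // rmorph0.
Qed.
End Morphism.

Lemma polyrat_unit n : (0 < n)%N -> (n%:R : {poly rat}) \is a GRing.unit.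
Proof.
move=> n0; rewrite -polyC_natr poly_unitE size_polyC coefC /= pnatr_eq0 unitfE pnatr_eq0.
by rewrite -lt0n n0.
Qed.

Lemma ratfun_int_inj (c : int) : c != 0 -> c%:~R != 0 :> ratfun.
Proof.
move=> c0; rewrite -(rmorph_int (@tofrac _)) tofrac_eq0.
by rewrite -(rmorph_int (@polyC rat)) polyC_eq0 intr_eq0.
Qed.

Lemma Xfrac_generic (c : int) : 2%:R * Xfrac + c%:~R != 0.
Proof.
rewrite -(rmorph_nat (@tofrac _)) -rmorphM -(rmorph_int (@tofrac _)) -rmorphD tofrac_eq0.
apply/eqP => /(congr1 (fun p : {poly rat} => p`_1)).
by rewrite coefD -polyC_natr coefCM coefX -(rmorph_int (@polyC rat)) coefC coef0.
Qed.

Lemma E4rat_det y z a : (1 <= y + z)%N -> E4rat y z a = \det (path_mx Xfrac y z a).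
Proof.
move=> yz; rewrite /E4rat; case: y yz => [|y] yz.
  case: a => [|a].
    by rewrite (E4_y0_a0 ratfun_int_inj Xfrac_generic) // (det_path00 ratfun_int_inj Xfrac_generic).
  by rewrite (E4_y0 ratfun_int_inj Xfrac_generic) // (det_path ratfun_int_inj Xfrac_generic).
by rewrite (E4_pos ratfun_int_inj Xfrac_generic) // (det_path ratfun_int_inj Xfrac_generic).
Qed.

Theorem theorem4p9 (x y z a : nat) :
  (1 <= y + z)%N -> value_at (E4rat y z a) x%:R (Etgf x y z a).
Proof.
(* The determinant over polynomials is the numerator, with denominator 1: its image in the fraction
   field is the product formula, its value at [x] the generating function. *)
move=> yz; exists (\det (path_mx ('X : {poly rat}) y z a)), 1.
rewrite hornerC oner_neq0 !divr1 E4rat_det // Etgf_det //; split=> //; split.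
  by rewrite (rmorph_det_path (@tofrac _) polyrat_unit).
by rewrite -horner_evalE (rmorph_det_path (horner_eval x%:R) polyrat_unit) /= /horner_eval hornerX.
Qed.
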